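(* Let $j>0$ and $\rho_{\rm init}\in L^\infty([0,1],\mathbb R_+)$ with $F(r;\rho_{\rm init})\ge\alpha(1-r)$ for all $r\in[0,1]$, for some $\alpha>0$. Let initial configurations $\xi=\xi^{(\epsilon)}$ satisfy, with $\ell=\lfloor\epsilon^{-9/10}\rfloor$ and $a=1/20$, $\max_{x\in\{0,\dots,\epsilon^{-1}-\ell+1\}}|\mathcal A_\ell(x,\xi)-\mathcal A'_\ell(x,\rho_{\rm init})|\le\epsilon^a$, and let $\rho(r,t)$ be the hydrodynamic limit, i.e. the non negative continuous function on $[0,1]\times(0,\infty)$ with $\lim_{t\to0}F(r;\rho(\cdot,t))=F(r;\rho_{\rm init})$ for all $r$ and such that for all $t>0,\zeta>0$, $\lim_{\epsilon\to0}P^{(\epsilon)}_\xi\big[\max_x|\epsilon F_\epsilon(x;\xi_{\epsilon^{-2}t})-F(\epsilon x;\rho(\cdot,t))|\le\zeta\big]=1$. Then there exists $T>0$ such that $\rho(1,t)>0$ for $t\in(0,T]$ and $$\rho(r,t)=G^{\rm neum}_t*\rho_{\rm init}(r)+j\int_0^t\big\{G^{\rm neum}_s(r,0)-G^{\rm neum}_s(r,1)\big\}ds,\qquad r\in[0,1],\ t\in(0,T].$$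
   Context: Particle system on $\Lambda_\epsilon=\{0,\dots,\epsilon^{-1}\}$ ($\epsilon^{-1}\in\mathbb N$): Markov process $(\xi_t)$ on $\mathbb N^{\Lambda_\epsilon}$ with generator $L=L^0+L_b+L_a$, $L^0f(\xi)=\frac12\sum_{x=0}^{\epsilon^{-1}-1}[\xi(x)(f(\xi^{x,x+1})-f(\xi))+\xi(x+1)(f(\xi^{x+1,x})-f(\xi))]$ ($\xi^{x,y}$: one particle moved from $x$ to $y$), $L_bf(\xi)=j\epsilon(f(\xi+\mathbf 1_{\{0\}})-f(\xi))$, $L_af(\xi)=j\epsilon(f(\xi-\mathbf 1_{\{R_\xi\}})-f(\xi))$ with $R_\xi$ the rightmost occupied site ($L_af=0$ if $\xi\equiv 0$). $P^{(\epsilon)}_\xi$ is the law started at $\xi$. $F_\epsilon(x;\xi)=\sum_{y\ge x}\xi(y)$; $F(r;u)=\int_r^1u$. $\mathcal A_\ell(x,\xi)=\frac1\ell\sum_{y=x}^{x+\ell-1}\xi(y)$, $\mathcal A'_\ell(x,u)=\frac1{\epsilon\ell}(F(\epsilon x;u)-F(\epsilon(x+\ell);u))$. $G^{\rm neum}_t(r,r')=\sum_kG_t(r,r'_k)$, $G_t(r,r')=e^{-(r-r')^2/2t}/\sqrt{2\pi t}$, $r'_k$ the images of $r'$ under repeated reflections of $[0,1]$ (Neumann heat kernel on $[0,1]$); $G^{\rm neum}_t*f(r)=\int G^{\rm neum}_t(r,r')f(r')dr'$. *)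

(* Defs.v *)
From HB Require Import structures.
From mathcomp Require Import all_boot all_order all_algebra.
From mathcomp Require Import all_classical all_reals all_analysis.
Set Implicit Arguments. Unset Strict Implicit. Unset Printing Implicit Defensive.
Import Order.TTheory GRing.Theory Num.Theory.
Import numFieldNormedType.Exports.
Local Open Scope classical_set_scope.
Local Open Scope ring_scope.

Section ModelDefs.
Variable R : realType.
Local Notation mu := (@lebesgue_measure R).

(* F(r;u) = \int_r^1 u  (u is only used on [0,1]; for r > 1 the interval is
   empty and F(r;u) = 0, i.e. u is extended by 0 outside [0,1]). *)
Definition Fmac (r : R) (u : R -> R) : R := Rintegral mu `[r, 1] u.

Definition gauss (t x : R) : R := expR (- (x ^+ 2) / (2 * t)) / Num.sqrt (2 * pi * t).

(* Neumann heat kernel on [0,1]: sum over all images of r' under repeated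
   reflections, i.e. the points 2m + r' and 2m - r' (m in Z), with multiplicity. *)
Definition Gneum (t r r' : R) : R :=
  fine (\esum_(m in [set: int])
          ((gauss t (r - (r' + 2 * m%:~R)) + gauss t (r - (2 * m%:~R - r')))%:E)%E).

Definition heat_conv (t : R) (f : R -> R) (r : R) : R :=
  Rintegral mu `[0, 1] (fun r' => Gneum t r r' * f r').

(* ---------- microscopic objects, N = epsilon^{-1} ---------- *)

Definition config (N : nat) := {ffun 'I_N.+1 -> nat}.

(* xi(y), with the convention xi(y) = 0 outside {0..N} (never used in the statement) *)
Definition cfg_at N (xi : config N) (y : nat) : nat :=
  if (y <= N)%N then xi (inord y) else 0%N.

Definition Feps N (xi : config N) (x : nat) : nat :=
  (\sum_(x <= y < N.+1) cfg_at xi y)%N.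

Definition Aell N (xi : config N) (l x : nat) : R :=
  (l%:R)^-1 * \sum_(x <= y < x + l) (cfg_at xi y)%:R.

Definition Aell' (N : nat) (u : R -> R) (l x : nat) : R :=
  ((N%:R)^-1 * l%:R)^-1 * (Fmac (x%:R / N%:R) u - Fmac ((x + l)%:R / N%:R) u).

Definition move N (xi : config N) (x y : 'I_N.+1) : config N :=
  [ffun z => if z == y then (xi z).+1 else if z == x then (xi z).-1 else xi z].

Definition add0 N (xi : config N) : config N :=
  [ffun z : 'I_N.+1 => if z == ord0 then (xi z).+1 else xi z].

Definition rightmost N (xi : config N) : nat :=
  (\max_(z : 'I_N.+1 | (0 < xi z)%N) (z : nat))%N.

Definition remR N (xi : config N) : config N :=
  [ffun z : 'I_N.+1 => if (z : nat) == rightmost xi then (xi z).-1 else xi z].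

Definition nonempty_cfg N (xi : config N) : bool := [exists z, (0 < xi z)%N].

(* Off-diagonal part of the generator L = L^0 + L_b + L_a:
   Loff g xi = sum over transitions xi -> xi' of rate(xi,xi') * g(xi'). *)
Definition Loff (j : R) N (g : config N -> R) (xi : config N) : R :=
  \sum_(x < N)
     ((xi (inord x))%:R / 2 * g (move xi (inord x) (inord x.+1))
      + (xi (inord x.+1))%:R / 2 * g (move xi (inord x.+1) (inord x)))
  + j * (N%:R)^-1 * g (add0 xi)
  + (if nonempty_cfg xi then j * (N%:R)^-1 * g (remR xi) else 0).

Definition qtot (j : R) N (xi : config N) : R := Loff j (fun _ => 1) xi.

(* fn n xi eta t = P_xi[ xi_t = eta and exactly n jumps in [0,t] ]
   (jump chain / holding time construction of the Markov chain with
   generator L). *)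
Fixpoint fn (j : R) N (n : nat) : config N -> config N -> R -> R :=
  match n with
  | 0%N => fun xi eta t => (xi == eta)%:R * expR (- qtot j xi * t)
  | n'.+1 => fun xi eta t =>
      Rintegral mu `[0, t]
        (fun s => expR (- qtot j xi * s) * Loff j (fun zeta => fn j n' zeta eta (t - s)) xi)
  end.

Definition trans_prob (j : R) N (xi : config N) (t : R) (A : set (config N)) : R :=
  fine (\esum_(eta in A) (\esum_(n in [set: nat]) (fn j n xi eta t)%:E))%E.

Definition ell (N : nat) : nat := Num.truncn ((N%:R : R) `^ (9 / 10)).

End ModelDefs.

(* Main.v *)
(** Essentially only first moments of the particle system are needed.  For a smooth test
function b(s, x) (s is backward time) with vanishing Neumann data, the generator
applied to N^-1 sum_x b(s, x) xi(x) is a discrete heat operator plus the boundary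
term j (b(s, 0) - b(s, R_xi)), where R_xi is the rightmost particle.  A Dynkin
inequality for the minimal chain turns this into an upper bound for the
macroscopic integral of b against rho(., t), obtained from the hydrodynamic
hypothesis; using b and -b gives an identity.

Testing with the Neumann kernel G_{s+tau}(1, .) and bounding the boundary term by
the peak j (s + tau)^{-1/2} of the kernel gives rho(1, t) >= c alpha - C j sqrt t,
which is positive for small t.  Then F(r; rho(., t)) > 0 for all r < 1, so R_xi / N
tends to 1 in probability, the boundary term becomes j (b(s, 0) - b(s, 1)), and
testing with G_{s+tau}(r, .) and tau -> 0 gives the formula. *)

Require Import Defs.
From HB Require Import structures.
From mathcomp Require Import all_boot all_order all_algebra.
From mathcomp Require Import all_classical all_reals all_analysis.
From mathcomp Require Import finmap measurable_realfun real_interval.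
From mathcomp Require Import ring lra zify.
Import Order.TTheory GRing.Theory Num.Theory.
Import numFieldNormedType.Exports.
Local Open Scope classical_set_scope.
Local Open Scope ring_scope.

(** The chain is given only through its jump expansion, so neither non-explosion nor moment bounds
    are available in advance. Estimates are therefore made on sums over paths with fewer than m
    jumps. These lose probability; an upper bound by a supersolution survives the loss, but only for
    nonnegative functions. A linear functional is signed and unbounded, so a constant and a small
    multiple of 1 + mass^2 are added to it. The quadratic term is affordable because injection and
    removal cancel the linear part of the drift of mass^2.

    There is a circularity: the boundary term involves R_xi, which is located only once F is known
    to be positive near 1. The first pass breaks it by using nothing about R_xi, only the sign and
    the size of the kernel. The loss s^{-1/2} is integrable in time, while the gain is bounded below
    uniformly in the regularisation tau.

    Finite image sums serve as test functions, so that all derivatives are explicit. The limits are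
    taken in the order N, number of images, error e, tau. *)

Section Calculus.
Context {R : realType}.
Local Notation mu := (@lebesgue_measure R).
Implicit Types (f g F G : R -> R) (a b c x s t : R).

Lemma is_derive_continuous f x df :
  is_derive x 1 f df -> {for x, continuous f}.
Proof. by move=> [d _]; exact/differentiable_continuous/derivable1_diffP. Qed.

Lemma continuous_within_cc a b f :
  (forall x, a <= x <= b -> {for x, continuous f}) ->
  {within `[a, b], continuous f}.
Proof.
move=> fc; apply: continuous_in_subspaceT => x /set_mem /=.
by rewrite in_itv /=; exact: fc.
Qed.

Lemma mean_value f df a b : a <= b ->
  (forall x, a <= x <= b -> is_derive x 1 f (df x)) ->
  exists2 c, a <= c <= b & f b - f a = df c * (b - a).
Proof.
move=> ab fd.
have [||c] := @MVT_segment R f df a b ab.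
- by move=> x; rewrite in_itv /= => /andP[ax xb]; apply: fd; rewrite !ltW.
- by apply: continuous_within_cc => x /fd; exact: is_derive_continuous.
- by rewrite in_itv /= => cab fE; exists c.
Qed.

Lemma derive_ge0_le f df a b : a <= b ->
  (forall x, a <= x <= b -> is_derive x 1 f (df x)) ->
  (forall x, a <= x <= b -> 0 <= df x) -> f a <= f b.
Proof.
move=> ab fd df0; have [c cab fE] := mean_value _ _ _ _ ab fd.
by rewrite -subr_ge0 fE mulr_ge0 ?subr_ge0 // df0.
Qed.

Lemma derive0_eq f a b : a <= b ->
  (forall x, a <= x <= b -> is_derive x 1 f 0) -> f a = f b.
Proof.
move=> ab fd; have [c cab fE] := mean_value f (fun=> 0) _ _ ab fd.
by apply/eqP; rewrite eq_sym -subr_eq0 fE mul0r.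
Qed.

Lemma drv_cst (k x : R) : is_derive x 1 (fun=> k : R) 0.
Proof. exact: is_derive_cst. Qed.

Lemma drv_id (x : R) : is_derive x 1 (fun y : R => y) 1.
Proof. exact: is_derive_id. Qed.

Lemma drv_add f g (df dg x : R) : is_derive x 1 f df -> is_derive x 1 g dg ->
  is_derive x 1 (fun y => f y + g y) (df + dg).
Proof. by move=> hf hg; exact: (is_deriveD hf hg). Qed.

Lemma drv_shift (a s : R) : is_derive s 1 (fun s => s + a) 1.
Proof.
by apply: (is_derive_eq (drv_add _ _ _ _ _ (drv_id s) (drv_cst a s))); rewrite addr0.
Qed.

Lemma drv_opp f (df x : R) : is_derive x 1 f df -> is_derive x 1 (fun y => - f y) (- df).
Proof. by move=> hf; exact: (is_deriveN hf). Qed.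

Lemma drv_sub f g (df dg x : R) : is_derive x 1 f df -> is_derive x 1 g dg ->
  is_derive x 1 (fun y => f y - g y) (df - dg).
Proof. by move=> hf hg; exact: (is_deriveB hf hg). Qed.

Lemma drv_mul f g (df dg x : R) : is_derive x 1 f df -> is_derive x 1 g dg ->
  is_derive x 1 (fun y => f y * g y) (df * g x + f x * dg).
Proof.
move=> hf hg; apply: (is_derive_eq (is_deriveM hf hg)).
by rewrite /GRing.scale /= addrC (mulrC (g x)).
Qed.

Lemma drv_scale k f (df x : R) : is_derive x 1 f df ->
  is_derive x 1 (fun y => k * f y) (k * df).
Proof.
by move=> hf; apply: (is_derive_eq (drv_mul _ _ _ _ _ (drv_cst k x) hf)); rewrite mul0r add0r.
Qed.

Lemma drv_comp f g (df dg x : R) : is_derive x 1 f df -> is_derive (f x) 1 g dg ->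
  is_derive x 1 (fun y => g (f y)) (dg * df).
Proof. by move=> hf hg; exact: (is_derive1_comp hg hf). Qed.

Lemma drv_exp f (df x : R) : is_derive x 1 f df ->
  is_derive x 1 (fun y => expR (f y)) (expR (f x) * df).
Proof. by move=> hf; apply: drv_comp => //; exact: is_derive_expR. Qed.

Lemma drv_sum (I : Type) (r : seq I) (F : I -> R -> R) (dF : I -> R) (x : R) :
  (forall i, is_derive x 1 (F i) (dF i)) ->
  is_derive x 1 (fun y => \sum_(i <- r) F i y) (\sum_(i <- r) dF i).
Proof.
move=> h; elim: r => [|i r IH].
  rewrite big_nil; apply: (is_derive_eq _ erefl).
  by rewrite (_ : (fun _ => _) = fun=> 0); [exact: drv_cst|apply/funext => y; rewrite big_nil].
rewrite big_cons (_ : (fun _ => _) = fun y => F i y + \sum_(k <- r) F k y).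
  exact: drv_add.
by apply/funext => y; rewrite big_cons.
Qed.

Lemma is_derive_expRM (q x : R) : is_derive x 1 (fun y => expR (q * y)) (q * expR (q * x)).
Proof.
apply: (is_derive_eq (drv_exp _ _ _ (drv_scale q _ _ _ (drv_id x)))).
by rewrite mulr1 mulrC.
Qed.

(** The integrating factor [expR (q * s)] turns the differential inequality into monotonicity of
    [expR (q * s) * D s]. *)
Lemma ode_ge0 (q t : R) (D dD : R -> R) : 0 <= t ->
  (forall s, 0 <= s <= t -> is_derive s 1 D (dD s)) ->
  (forall s, 0 <= s <= t -> - q * D s <= dD s) -> 0 <= D 0 -> 0 <= D t.
Proof.
move=> t0 Dd dDge D0.
have : expR (q * 0) * D 0 <= expR (q * t) * D t.
  apply: (derive_ge0_le (fun s => expR (q * s) * D s)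
    (fun s => expR (q * s) * dD s + D s * (q * expR (q * s)))) => //.
    move=> s s0t; have := Dd _ s0t; have := is_derive_expRM q s => h2 h1.
    by apply: (is_derive_eq (drv_mul _ _ _ _ _ h2 h1)); ring.
  move=> s s0t; have := dDge _ s0t; have := expR_gt0 (q * s).
  move: (expR _) => e e0 h.
  by rewrite (_ : _ + _ = e * (dD s + q * D s)); [apply: mulr_ge0; [exact: ltW|lra]|ring].
by rewrite mulr0 expR0 mul1r => /(le_trans D0); rewrite pmulr_rge0 ?expR_gt0.
Qed.

Lemma continuous_integrable f a b :
  (forall x, a <= x <= b -> {for x, continuous f}) ->
  mu.-integrable `[a, b] (EFin \o f).
Proof.
move=> fc; apply: continuous_compact_integrable; first exact: segment_compact.
exact: continuous_within_cc.
Qed.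

Lemma FTC2_Rintegral f F a b : a <= b ->
  (forall x, a <= x <= b -> is_derive x 1 F (f x)) ->
  (forall x, a <= x <= b -> {for x, continuous f}) ->
  Rintegral mu `[a, b] f = F b - F a.
Proof.
rewrite le_eqVlt => /predU1P[->|ab] Fd fc.
  by rewrite set_itv1 Rintegral_set1 subrr.
rewrite /Rintegral (@continuous_FTC2 R f F) //.
- exact: continuous_within_cc.
- have Fc x : a <= x <= b -> {for x, continuous F}.
    by move/Fd/is_derive_continuous.
  split.
  + by move=> x; rewrite in_itv /= => /andP[ax xb]; have [] := Fd x; rewrite // !ltW.
  + by apply: cvg_at_right_filter; apply: Fc; rewrite lexx ltW.
  + by apply: cvg_at_left_filter; apply: Fc; rewrite lexx ltW.
- move=> x; rewrite in_itv /= => /andP[ax xb]; rewrite derive1E.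
  by have [] := Fd x; rewrite // !ltW.
Qed.

(** Clamping the argument at 0 extends [g] continuously to the negative axis, and integrating from
    -1 makes 0 an interior point. Hence the derivative at 0 is two-sided. *)
Lemma primitive_exists g : (forall x, 0 <= x -> {for x, continuous g}) ->
  exists G, G 0 = 0 /\ forall x, 0 <= x -> is_derive x 1 G (g x).
Proof.
move=> gc; pose h (y : R) := g (Num.max y 0).
have hc (y : R) : {for y, continuous h}.
  have mc : {for y, continuous (fun y : R => Num.max y 0)}.
    by apply: continuous_max; [exact: cvg_id|exact: cvg_cst].
  rewrite (_ : h = g \o (fun y => Num.max y 0)) //.
  apply: (continuous_comp mc).
  by apply: gc; rewrite le_max lexx orbT.
pose F x := Rintegral mu `[-1, x] h.
exists (fun x => F x - F 0); split; first by rewrite subrr.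
move=> x x0.
have [] := @continuous_FTC1 R h (BLeft (-1)) x (x + 1).
- by rewrite ltrDl.
- by apply: continuous_integrable => y _; exact: hc.
- by rewrite /Order.lt /=; lra.
- exact: hc.
move=> Fd FE.
have Fx : is_derive x 1 F (g x).
  split; first exact: Fd.
  by rewrite -derive1E FE /h; congr g; apply/max_idPl.
by apply: is_derive_eq; rewrite subr0.
Qed.

End Calculus.

(** * Truncated semigroup of the jump chain *)

Section Chain.
Context {R : realType} (j : R) (N : nat) (j0 : 0 <= j).
Local Notation mu := (@lebesgue_measure R).
Local Notation config := (config N).
Implicit Types (xi eta : config) (f g : config -> R) (s t : R).

Definition jumps xi : seq (R * config) :=
  [seq ((xi (inord (x : 'I_N)))%:R / 2, move xi (inord x) (inord x.+1)) | x <- index_enum 'I_N] ++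
  [seq ((xi (inord (x : 'I_N).+1))%:R / 2, move xi (inord x.+1) (inord x)) | x <- index_enum 'I_N] ++
  (j * N%:R^-1, add0 xi) ::
  if nonempty_cfg xi then [:: (j * N%:R^-1, remR xi)] else [::].

Lemma LoffE g xi : Loff j g xi = \sum_(p <- jumps xi) p.1 * g p.2.
Proof.
rewrite /Loff /jumps !big_cat /= !big_map big_cons big_split /= !addrA.
by case: ifP => _; rewrite ?big_seq1 ?big_nil.
Qed.

Lemma jumps_ge0 xi (p : R * config) : p \in jumps xi -> 0 <= p.1.
Proof.
have jN : 0 <= j * N%:R^-1 by rewrite mulr_ge0 // invr_ge0.
rewrite !mem_cat inE => /or4P[/mapP[x _ ->]|/mapP[x _ ->]|/eqP->|] //=.
by case: ifP => // _; rewrite inE => /eqP ->.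
Qed.

Lemma Loff_le f g xi : (forall eta, f eta <= g eta) -> Loff j f xi <= Loff j g xi.
Proof.
move=> fg; rewrite !LoffE; rewrite big_seq [leRHS]big_seq.
by apply: ler_sum => p /jumps_ge0 p0; rewrite ler_wpM2l.
Qed.

Lemma LoffD f g xi : Loff j (fun z => f z + g z) xi = Loff j f xi + Loff j g xi.
Proof. by rewrite !LoffE -big_split /=; apply: eq_bigr => p _; rewrite mulrDr. Qed.

Lemma LoffZ k f xi : Loff j (fun z => k * f z) xi = k * Loff j f xi.
Proof. by rewrite !LoffE big_distrr /=; apply: eq_bigr => p _; rewrite mulrCA. Qed.

Lemma LoffN f xi : Loff j (fun z => - f z) xi = - Loff j f xi.
Proof.
rewrite -[RHS]mulN1r -LoffZ; congr (Loff j _ xi); apply/funext => z.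
by rewrite mulN1r.
Qed.

Lemma Loff_sum (I : Type) (r : seq I) (F : I -> config -> R) xi :
  Loff j (fun z => \sum_(i <- r) F i z) xi = \sum_(i <- r) Loff j (F i) xi.
Proof.
elim: r => [|i r IH].
  rewrite big_nil LoffE big1 // => p _; by rewrite big_nil mulr0.
rewrite big_cons -IH -LoffD; congr (Loff j _ xi); apply/funext => z.
by rewrite big_cons.
Qed.

Lemma Loff0 xi : Loff j (fun=> 0) xi = 0.
Proof. by rewrite LoffE big1 // => p _; rewrite mulr0. Qed.

Lemma Loff_cst k xi : Loff j (fun=> k) xi = k * qtot j xi.
Proof.
by rewrite /qtot -LoffZ; congr (Loff j _ xi); apply/funext => z; rewrite mulr1.
Qed.

Lemma Loff_derive (U dU : config -> R -> R) xi t :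
  (forall z, is_derive t 1 (U z) (dU z t)) ->
  is_derive t 1 (fun s => Loff j (U^~ s) xi) (Loff j (dU^~ t) xi).
Proof.
move=> h; rewrite LoffE.
rewrite (_ : (fun s => _) = fun s => \sum_(p <- jumps xi) p.1 * U p.2 s).
  by apply: drv_sum => p; exact: drv_scale.
by apply/funext => s; rewrite LoffE.
Qed.

(** The comparison principle behind all bounds on the chain. The state space is infinite with
    unbounded rates, so the induction runs over the truncation level: once level m is nonnegative,
    so is [Loff] of it, and level m.+1 obeys a scalar inequality at each configuration, settled by
    [ode_ge0]. *)
Lemma Loff_positivity (U dU : nat -> config -> R -> R) t : 0 <= t ->
  (forall m xi s, 0 <= s <= t -> is_derive s 1 (U m.+1 xi) (dU m xi s)) ->
  (forall m xi s, 0 <= s <= t ->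
     - qtot j xi * U m.+1 xi s + Loff j (fun z => U m z s) xi <= dU m xi s) ->
  (forall xi s, 0 <= s <= t -> 0 <= U 0%N xi s) ->
  (forall m xi, 0 <= U m.+1 xi 0) ->
  forall m xi, 0 <= U m xi t.
Proof.
move=> t0 Ud dUge U0 Ui.
suff H m s xi : 0 <= s <= t -> 0 <= U m xi s by move=> m xi; apply: H; rewrite t0 lexx.
elim: m s xi => [|m IH] s xi s0t; first exact: U0.
have sub r : 0 <= r <= s -> 0 <= r <= t.
  by case/andP=> -> /le_trans -> //; case/andP: s0t.
apply: (ode_ge0 (qtot j xi) s (U m.+1 xi) (dU m xi)) => //.
- by case/andP: s0t.
- by move=> r /sub; exact: Ud.
- move=> r /sub r0t; apply: le_trans (dUge _ _ _ r0t).
  rewrite lerDl -(Loff0 xi); apply: Loff_le => eta; exact: IH.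
Qed.

(** The recursion of [fn] with the final indicator replaced by an arbitrary function, so that
    expectations are covered as well. *)
Fixpoint Tn f (n : nat) xi t : R :=
  match n with
  | 0%N => f xi * expR (- qtot j xi * t)
  | n'.+1 => Rintegral mu `[0, t]
      (fun s => expR (- qtot j xi * s) * Loff j (fun z => Tn f n' z (t - s)) xi)
  end.

Lemma fnE n xi eta t : fn j n xi eta t = Tn (fun z => (z == eta)%:R) n xi t.
Proof.
elim: n xi t => [//|n IH] xi t /=; congr (Rintegral _ _ _); apply/funext => s.
by congr (_ * Loff j _ _); apply/funext => z; exact: IH.
Qed.

Definition prim (g : R -> R) : R -> R :=
  xget (fun=> 0) [set G : R -> R | G 0 = 0 /\ forall x : R, 0 <= x -> is_derive x 1 G (g x)].

Lemma primP (g : R -> R) : (forall x : R, 0 <= x -> {for x, continuous g}) ->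
  prim g 0 = 0 /\ forall x : R, 0 <= x -> is_derive x 1 (prim g) (g x).
Proof. by move=> h; exact: (@xgetPex _ (fun=> 0) _ (primitive_exists g h)). Qed.

(* Unlike [Tn], which is an integral over an empty interval for t < 0, [Wn] is
   two-sided differentiable at t = 0. *)
Fixpoint Wn f (n : nat) xi (t : R) : R :=
  match n with
  | 0%N => f xi * expR (- qtot j xi * t)
  | n'.+1 => expR (- qtot j xi * t) *
      prim (fun s => expR (qtot j xi * s) * Loff j (fun z => Wn f n' z s) xi) t
  end.

(** Right-hand side of the backward Kolmogorov equation, split by the number of jumps. *)
Definition dWn f n xi t : R :=
  - qtot j xi * Wn f n xi t + if n is n'.+1 then Loff j (fun z => Wn f n' z t) xi else 0.

Lemma Wn_integrand_continuous f n xi (t : R) :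
  (forall z, is_derive t 1 (Wn f n z) (dWn f n z t)) ->
  {for t, continuous (fun s => expR (qtot j xi * s) * Loff j (fun z => Wn f n z s) xi)}.
Proof.
move=> h.
refine (is_derive_continuous _ _ _ (drv_mul _ _ _ _ _ (is_derive_expRM (qtot j xi) t)
  (Loff_derive (fun z s => Wn f n z s) (fun z s => dWn f n z s) xi t h))).
Qed.

Lemma Wn_derive f n xi t : 0 <= t -> is_derive t 1 (Wn f n xi) (dWn f n xi t).
Proof.
elim: n xi t => [|n IH] xi t t0.
  have h := drv_scale (f xi) _ _ _ (is_derive_expRM (- qtot j xi) t).
  by apply: (is_derive_eq h); rewrite /dWn /=; ring.
have [_ h] := primP _ (fun t tp => Wn_integrand_continuous f n xi t (fun z => IH z t tp)).
have h' := drv_mul _ _ _ _ _ (is_derive_expRM (- qtot j xi) t) (h _ t0).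
apply: (is_derive_eq h').
rewrite /dWn /= -mulrA; congr (_ + _).
by rewrite mulrA -expRD mulNr addNr expR0 mul1r.
Qed.

Lemma Wn_init f n xi : Wn f n xi 0 = if n is 0%N then f xi else 0.
Proof.
case: n => [|n] /=; first by rewrite mulr0 expR0 mulr1.
have [-> _] := primP _ (fun t tp =>
  Wn_integrand_continuous f n xi t (fun z => Wn_derive f n z t tp)).
by rewrite mulr0.
Qed.

Lemma TnE f n xi t : 0 <= t -> Tn f n xi t = Wn f n xi t.
Proof.
elim: n xi t => [//|n IH] xi t t0 /=.
set q := qtot j xi; set h := fun s => expR (q * s) * Loff j (fun z => Wn f n z s) xi.
have [h0 hd] := primP _ (fun t tp =>
  Wn_integrand_continuous f n xi t (fun z => Wn_derive f n z t tp)).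
transitivity (Rintegral mu `[0, t]
    (fun s => expR (- q * s) * Loff j (fun z => Wn f n z (t - s)) xi)).
  apply: eq_Rintegral => s /set_mem /=; rewrite in_itv /= => /andP[s0 st]; congr (_ * Loff j _ _).
  by apply/funext => z; rewrite IH // subr_ge0.
have td s : is_derive s 1 (fun s : R => t - s) (-1).
  by apply: (is_derive_eq (drv_sub _ _ _ _ _ (drv_cst t s) (drv_id s))); rewrite sub0r.
(* With the argument t - s the exponentials combine into [expR (- q * t)], so the integrand has the
   primitive [- (expR (- q * t) * prim h (t - s))], which vanishes at s = t. *)
have -> : expR (- q * t) * prim h t =
    - (expR (- q * t) * prim h (t - t)) - - (expR (- q * t) * prim h (t - 0)).
  by rewrite subrr subr0 h0 mulr0 oppr0 sub0r opprK.
refine (FTC2_Rintegral _ (fun s => - (expR (- q * t) * prim h (t - s))) 0 t t0 _ _).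
- move=> s /andP[s0 st].
  have ts : 0 <= t - s by rewrite subr_ge0.
  apply: (is_derive_eq (drv_opp _ _ _ (drv_scale (expR (- q * t)) _ _ _ (drv_comp _ _ _ _ _ (td s) (hd _ ts))))).
  rewrite mulrN1 mulrN opprK mulrA -expRD; congr (expR _ * _); rewrite /q; ring.
- move=> s /andP[s0 st].
  have ts : 0 <= t - s by rewrite subr_ge0.
  refine (is_derive_continuous _ _ _ (drv_mul _ _ _ _ _ (is_derive_expRM (- qtot j xi) s)
   (Loff_derive (fun z s => Wn f n z (t - s)) (fun z s => dWn f n z (t - s) * -1) xi s _))) => z.
  exact: (drv_comp _ _ _ _ _ (td s) (Wn_derive f n z _ ts)).
Qed.

(** Expectation of [f] at time [t] over paths with fewer than [m] jumps. For nonnegative [f] it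
    increases with [m], towards the minimal chain. *)
Definition Sn f (m : nat) xi (t : R) : R := \sum_(n < m) Wn f n xi t.

Definition dSn f m xi t : R :=
  if m is m'.+1 then - qtot j xi * Sn f m xi t + Loff j (fun z => Sn f m' z t) xi else 0.

Lemma Sn_derive f m xi t : 0 <= t -> is_derive t 1 (Sn f m xi) (dSn f m xi t).
Proof.
move=> t0; apply: (is_derive_eq (drv_sum _ _ _ _ _ (fun n : 'I_m => Wn_derive f n xi t t0))).
case: m => [|m] /=; first by rewrite big_ord0.
rewrite /dWn big_split /= -mulr_sumr; congr (_ + _).
by rewrite big_ord_recl /= add0r /Sn Loff_sum.
Qed.

Lemma Sn_init f m xi : Sn f m.+1 xi 0 = f xi.
Proof. by rewrite /Sn big_ord_recl big1 ?addr0 ?Wn_init // => i _; rewrite Wn_init. Qed.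

Lemma Sn0 f xi t : Sn f 0 xi t = 0. Proof. by rewrite /Sn big_ord0. Qed.

Lemma Sn_continuous f m xi t : 0 <= t -> {for t, continuous (Sn f m xi)}.
Proof. by move=> t0; exact: (is_derive_continuous _ _ _ (Sn_derive f m xi t t0)). Qed.

Lemma Wn_ge0 f n xi t : 0 <= t -> (forall z, 0 <= f z) -> 0 <= Wn f n xi t.
Proof.
move=> t0 f0.
(* The index shift puts the zero function at level 0, where positivity is trivial. *)
pose U n z s := if n is n'.+1 then Wn f n' z s else 0.
apply: (Loff_positivity U (fun n => dWn f n) t t0 _ _ _ _ n.+1) => //=.
- by move=> m z s /andP[s0 _]; exact: Wn_derive.
- by move=> [|m] z s _ //; rewrite /dWn /= Loff0.
- by move=> [|m] z; rewrite Wn_init.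
Qed.

Lemma Sn_ge0 f m xi t : 0 <= t -> (forall z, 0 <= f z) -> 0 <= Sn f m xi t.
Proof. by move=> t0 f0; apply: sumr_ge0 => n _; exact: Wn_ge0. Qed.

Lemma Sn_nondecreasing f xi t : 0 <= t -> (forall z, 0 <= f z) ->
  nondecreasing_seq (fun m => Sn f m xi t).
Proof.
move=> t0 f0; apply/nondecreasing_seqP => m.
by rewrite /Sn big_ord_recr lerDl; exact: Wn_ge0.
Qed.

(** The difference solves the truncated backward equation and vanishes at level 0. Weighted families
    are allowed because both the sum over target configurations in [trans_prob] and the pairing of
    complementary functions are instances. *)
Lemma Sn_le (f : config -> R) (I : Type) (r : seq I) (g : I -> config -> R) (k : I -> R) m xi t :
  0 <= t -> (forall z, \sum_(i <- r) k i * g i z <= f z) ->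
  \sum_(i <- r) k i * Sn (g i) m xi t <= Sn f m xi t.
Proof.
move=> t0 fg; rewrite -subr_ge0.
apply: (Loff_positivity (fun m xi t => Sn f m xi t - \sum_(i <- r) k i * Sn (g i) m xi t)
 (fun m xi t => dSn f m.+1 xi t - \sum_(i <- r) k i * dSn (g i) m.+1 xi t) t t0).
- move=> n z s /andP[s0 _]; apply: drv_sub; first exact: Sn_derive.
  by apply: drv_sum => i; apply: drv_scale; exact: Sn_derive.
- move=> n z s _ /=.
  rewrite (_ : Loff j _ z = Loff j (fun z => Sn f n z s) z -
      \sum_(i <- r) k i * Loff j (fun z => Sn (g i) n z s) z); last first.
    rewrite LoffD LoffN; congr (_ - _); rewrite Loff_sum; apply: eq_bigr => i _.
    by rewrite LoffZ.
  have -> : \sum_(i <- r) k i * (- qtot j z * Sn (g i) n.+1 z s + Loff j (fun z => Sn (g i) n z s) z)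
     = - qtot j z * (\sum_(i <- r) k i * Sn (g i) n.+1 z s) +
       \sum_(i <- r) k i * Loff j (fun z => Sn (g i) n z s) z.
    by rewrite mulr_sumr -big_split /=; apply: eq_bigr => i _; ring.
  lra.
- by move=> z s _; rewrite Sn0 big1 ?subr0 // => i _; rewrite Sn0 mulr0.
- move=> n z; rewrite Sn_init subr_ge0; apply: le_trans (fg z).
  by apply: ler_sum => i _; rewrite Sn_init.
Qed.

Lemma Sn_scale_le f g k m xi t : 0 <= t -> (forall z, k * g z <= f z) ->
  k * Sn g m xi t <= Sn f m xi t.
Proof.
move=> t0 fg; have := Sn_le f _ [:: tt] (fun=> g) (fun=> k) m xi t t0.
by rewrite big_seq1; apply => z; rewrite big_seq1.
Qed.

(** The constant 1 solves the backward equation exactly and dominates the truncated sum at level 0.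
    Equality cannot be expected, since long paths are cut off. *)
Lemma Sn1_le1 m xi t : 0 <= t -> Sn (fun=> 1) m xi t <= 1.
Proof.
move=> t0; rewrite -subr_ge0.
apply: (Loff_positivity (fun m xi t => 1 - Sn (fun=> 1) m xi t)
  (fun m xi t => 0 - dSn (fun=> 1) m.+1 xi t) t t0).
- by move=> n z s /andP[s0 _]; exact: (drv_sub _ _ _ _ _ (drv_cst 1 s) (Sn_derive _ n.+1 z s s0)).
- move=> n z s _ /=.
  by rewrite LoffD LoffN Loff_cst; lra.
- by move=> z s _; rewrite Sn0 subr0 ler01.
- by move=> n z; rewrite Sn_init subrr.
Qed.

Lemma Sn_le_compl f g m xi t : 0 <= t -> (forall z, f z + g z <= 1) ->
  Sn f m xi t <= 1 - Sn g m xi t.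
Proof.
move=> t0 fg; rewrite lerBrDr.
have := Sn_le (fun=> 1) _ [:: f; g] id (fun=> 1) m xi t t0.
rewrite !big_cons big_nil addr0 !mul1r => /(_ _)/le_trans; apply.
  by move=> z; rewrite !big_cons big_nil addr0 !mul1r.
exact: Sn1_le1.
Qed.

(** [F] is a supersolution of the backward equation up to the source [C * bad]. Adding the time
    integral of that source gives a genuine supersolution, which dominates every truncated sum;
    nonnegativity of [F] starts the comparison at level 0. *)
Lemma dynkin (F dF : R -> config -> R) (bad : config -> R) (C t : R) m xi :
  0 <= t -> 0 <= C -> (forall z, 0 <= bad z) ->
  (forall s z, 0 <= s <= t -> 0 <= F s z) ->
  (forall s z, 0 <= s <= t -> is_derive s 1 (F^~ z) (dF s z)) ->
  (forall s z, 0 <= s <= t ->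
    Loff j (F s) z - qtot j z * F s z <= dF s z + C * bad z) ->
  Sn (F 0) m xi t <= F t xi + C * Rintegral mu `[0, t] (Sn bad m xi).
Proof.
move=> t0 C0 bad0 F0 Fd FL.
pose J m z := prim (Sn bad m z).
have JP n z : J n z 0 = 0 /\ forall s, 0 <= s -> is_derive s 1 (J n z) (Sn bad n z s).
  by apply: primP => s; exact: Sn_continuous.
(* Time-integrated backward equation: both sides have the same derivative and agree at time 0. The
   free term [bad z] is what offsets the source in the hypothesis on [F]. *)
have JE m' z s : 0 <= s ->
  Sn bad m'.+1 z s = bad z - qtot j z * J m'.+1 z s + Loff j (fun y => J m' y s) z.
  move=> s0; apply/eqP; rewrite -subr_eq0; apply/eqP.
  pose K s := Sn bad m'.+1 z s - (bad z - qtot j z * J m'.+1 z s + Loff j (fun y => J m' y s) z).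
  have Kd r : 0 <= r <= s -> is_derive r 1 K 0.
    move=> /andP[r0 rs].
    have h1 := Sn_derive bad m'.+1 z r r0.
    have h2 := (JP m'.+1 z).2 r r0.
    have h3 := Loff_derive (fun y r => J m' y r) (fun y r => Sn bad m' y r) z r
      (fun y => (JP m' y).2 r r0).
    have h := drv_sub _ _ _ _ _ h1 (drv_add _ _ _ _ _ (drv_sub _ _ _ _ _
      (drv_cst (bad z) r) (drv_scale (qtot j z) _ _ _ h2)) h3).
    by apply: (is_derive_eq h) => /=; ring.
  transitivity (K 0); first exact/esym/derive0_eq.
  rewrite /K Sn_init (JP m'.+1 z).1 (_ : (fun y => J m' y 0) = fun=> 0).
    by rewrite Loff0 mulr0; ring.
  by apply/funext => y; exact: (JP m' y).1.
have -> : Rintegral mu `[0, t] (Sn bad m xi) = J m xi t.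
  have -> : J m xi t = J m xi t - J m xi 0 by rewrite (JP m xi).1 subr0.
  refine (FTC2_Rintegral _ (J m xi) 0 t t0 _ _).
  - by move=> x /andP[xp _]; exact: (JP m xi).2.
  - by move=> x /andP[xp _]; exact: Sn_continuous.
rewrite -subr_ge0.
apply: (Loff_positivity (fun m z s => F s z + C * J m z s - Sn (F 0) m z s)
  (fun m z s => dF s z + C * Sn bad m.+1 z s - dSn (F 0) m.+1 z s) t t0).
- move=> n z s /[dup] s0t /andP[s0 _]; apply: drv_sub; last exact: Sn_derive.
  by exact: (drv_add _ _ _ _ _ (Fd s z s0t) (drv_scale C _ _ _ ((JP n.+1 z).2 s s0))).
- move=> n z s /[dup] s0t /andP[s0 _] /=.
  rewrite !LoffD LoffN LoffZ JE //; have := FL _ z s0t.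
  move: (Loff j (F s) z) (Loff j (fun y => J n y s) z) (Loff j (fun y => Sn _ n y s) z).
  by move=> *; lra.
- move=> z s /[dup] s0t /andP[s0 _]; rewrite Sn0 subr0 addr_ge0 ?F0 // mulr_ge0 //.
  rewrite -(JP 0%N z).1; apply: (derive_ge0_le _ _ _ _ s0) => x /andP[x0 _].
    exact: (JP 0%N z).2.
  by rewrite Sn0.
- move=> n z; rewrite Sn_init (JP n.+1 z).1 mulr0; lra.
Qed.

End Chain.

(** * Dominated convergence and time rescaling for real-valued integrals *)

Section Convergence.
Context {R : realType}.
Local Notation mu := (@lebesgue_measure R).

Implicit Types (s t x k : R).

Lemma dominated_Rintegral_cvg (D : set R) (f_ : nat -> R -> R) (f g : R -> R) :
  measurable D -> (forall n, measurable_fun D (f_ n)) ->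
  (forall x, D x -> f_ ^~ x @ \oo --> f x) ->
  mu.-integrable D (EFin \o g) ->
  (forall n x, D x -> `|f_ n x| <= g x) ->
  mu.-integrable D (EFin \o f) /\
  Rintegral mu D (f_ n) @[n --> \oo] --> Rintegral mu D f.
Proof.
move=> mD mf_ f_f ig fg.
have [] := @dominated_convergence _ _ _ mu D mD (fun n => EFin \o f_ n) (EFin \o f) (EFin \o g).
- by move=> n; apply/measurable_EFinP; exact: mf_.
- by apply/measurable_EFinP; exact: (measurable_fun_cvg mf_ f_f).
- by apply: aeW => x Dx; apply/fine_cvgP; split; [exact: nearW|exact: f_f].
- exact: ig.
- by apply: aeW => x n Dx; rewrite /= lee_fin; exact: fg.
move=> fi _ h; split=> //.
apply: fine_cvg; rewrite fineK; first exact: h.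
exact: integrable_fin_num.
Qed.

Lemma integrable_cst_itv (a b k : R) : mu.-integrable `[a, b] (EFin \o (fun=> k)).
Proof. by apply: continuous_integrable => x _; exact: cvg_cst. Qed.

Lemma linear_derive k s : is_derive s 1 (fun s : R => k * s) k.
Proof. by apply: (is_derive_eq (drv_scale k _ _ _ (drv_id s))); rewrite mulr1. Qed.

Lemma continuous_rescale k s (g : R -> R) : {for k * s, continuous g} ->
  {for s, continuous (fun s => g (k * s))}.
Proof.
move=> gc; have kc := is_derive_continuous _ _ _ (linear_derive k s).
exact: (continuous_comp kc gc).
Qed.

Lemma Rintegral_rescale (k t : R) (g : R -> R) : 0 < k -> 0 <= t ->
  (forall s, 0 <= s -> {for s, continuous g}) ->
  Rintegral mu `[0, k * t] g = k * Rintegral mu `[0, t] (fun s => g (k * s)).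
Proof.
move=> k0 t0 gc.
have [G [G0 Gd]] := primitive_exists g gc.
have ks := linear_derive k.
have kp s : 0 <= s -> 0 <= k * s by move=> s0; rewrite mulr_ge0 // ltW.
rewrite -RintegralZl //; last first.
  apply: continuous_integrable => s /andP[s0 _].
  by apply: continuous_rescale; apply: gc; exact: kp.
transitivity (G (k * t) - G 0).
  refine (FTC2_Rintegral _ G 0 (k * t) (kp _ t0) _ _) => x /andP[x0 _].
    exact: Gd.
  exact: gc.
apply/esym; transitivity (G (k * t) - G (k * 0)); last by rewrite mulr0.
refine (FTC2_Rintegral _ (fun s => G (k * s)) 0 t t0 _ _) => x /andP[x0 _].
  apply: (is_derive_eq (drv_comp _ _ _ _ _ (ks x) (Gd _ (kp _ x0)))).
  by rewrite mulrC.
have gk := continuous_rescale k x g (gc _ (kp _ x0)).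
exact: (continuousM (cvg_cst _) gk).
Qed.

End Convergence.

(** * Removal of the jump truncation *)

Section Survival.
Context {R : realType} (j : R) (N : nat) (j0 : 0 <= j).
Local Notation mu := (@lebesgue_measure R).
Local Notation config := (config N).
Implicit Types (xi eta : config) (s t k : R).

(** Probability that the minimal chain, not yet exploded, is in [A] at time [t]. *)
Definition surv (xi : config) (A : set config) (t : R) : R :=
  limn (fun m => Sn j N (\1_A : config -> R) m xi t).

Lemma ind01 (A : set config) z : 0 <= (\1_A z : R) <= 1.
Proof. by rewrite indicE ler0n lern1 leq_b1. Qed.

Lemma Sn_ind_le1 (A : set config) m xi (t : R) : 0 <= t -> Sn j N (\1_A) m xi t <= 1.
Proof.
move=> tp; apply: le_trans (Sn1_le1 _ _ j0 m xi t tp).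
rewrite -[leLHS]mul1r; apply: Sn_scale_le => // z; rewrite mul1r.
Qed.

Lemma Sn_ind_nd (A : set config) xi (t : R) : 0 <= t ->
  nondecreasing_seq (fun m => Sn j N (\1_A : config -> R) m xi t).
Proof.
by move=> tp; apply: Sn_nondecreasing => // z; case/andP: (ind01 A z).
Qed.

Lemma Sn_ind_cvg (A : set config) xi (t : R) : 0 <= t ->
  (fun m => Sn j N (\1_A : config -> R) m xi t) @ \oo --> surv xi A t.
Proof.
move=> tp; apply: nondecreasing_is_cvgn; first exact: Sn_ind_nd.
by exists 1 => _ [m _ <-]; exact: Sn_ind_le1.
Qed.

Lemma Sn_le_surv (A : set config) m xi (t : R) : 0 <= t ->
  Sn j N (\1_A) m xi t <= surv xi A t.
Proof.
move=> tp; apply: (nondecreasing_cvgn_le (Sn_ind_nd A xi t tp)).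
by apply: cvgP; exact: Sn_ind_cvg.
Qed.

Lemma surv_le (A : set config) xi (t c : R) : 0 <= t ->
  (forall m, Sn j N (\1_A) m xi t <= c) -> surv xi A t <= c.
Proof.
move=> tp h; apply: limr_le; first by apply: cvgP; exact: Sn_ind_cvg.
by apply: nearW => m; exact: h.
Qed.

Lemma surv_le1 (A : set config) xi (t : R) : 0 <= t -> surv xi A t <= 1.
Proof. by move=> tp; apply: surv_le => // m; exact: Sn_ind_le1. Qed.

Lemma surv_ge0 (A : set config) xi (t : R) : 0 <= t -> 0 <= surv xi A t.
Proof.
move=> tp; apply: le_trans (Sn_le_surv A 0 xi t tp); by rewrite Sn0.
Qed.

Lemma surv_mono (A B : set config) xi (t : R) : 0 <= t -> A `<=` B ->
  surv xi A t <= surv xi B t.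
Proof.
move=> tp AB; apply: surv_le => // m; apply: le_trans (Sn_le_surv B m xi t tp).
rewrite -[leLHS]mul1r; apply: Sn_scale_le => // z; rewrite mul1r !indicE ler_nat.
by case: (boolP (z \in A)) => // /set_mem/AB/mem_set ->.
Qed.

(** A partial sum over finitely many targets and jump numbers below [m] is dominated, through
    [Sn_le], by a single truncated sum for the indicator of [A]. This bounds the extended sum by a
    real number, so [fine] hides no infinite value. The hydrodynamic hypothesis is a lower bound on
    [trans_prob] and thus carries over to [surv]. *)
Lemma trans_prob_le_surv (A : set config) xi (t : R) : 0 <= t ->
  trans_prob j xi t A <= surv xi A t.
Proof.
move=> tp; rewrite /trans_prob.
have f0 n eta : 0 <= fn j n xi eta t.
  by rewrite fnE TnE //; apply: Wn_ge0.
set E := esum _ _.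
have E0 : (0 <= E)%E.
  by apply: esum_ge0 => eta _; apply: esum_ge0 => n _; rewrite lee_fin.
suff : (E <= (surv xi A t)%:E)%E.
  move: E E0 => [e| |] //=; rewrite ?lee_fin // => _ _; exact: surv_ge0.
apply: ge_ereal_sup => _ [F [finF FA] <-].
rewrite fsbig_finite //= -esum_sum; last by move=> *; rewrite lee_fin.
rewrite -nneseries_esumT; last by move=> n; apply: sume_ge0 => *; rewrite lee_fin.
apply: lime_le; first by apply: is_cvg_nneseries => n _ _; apply: sume_ge0 => *; rewrite lee_fin.
apply: nearW => m; rewrite big_mkord.
under eq_bigr do rewrite sumEFin.
rewrite sumEFin lee_fin exchange_big /=.
apply: le_trans (Sn_le_surv A m xi t tp).
set r := enum_fset (fset_set F).
rewrite [leLHS](_ : _ = \sum_(eta <- r) 1 * Sn j N (fun z => (z == eta)%:R) m xi t); last first.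
  by apply: eq_bigr => eta _; rewrite mul1r /Sn; apply: eq_bigr => n _; rewrite fnE TnE.
apply: Sn_le => // z.
rewrite [leLHS](_ : _ = \sum_(eta <- r) (z == eta)%:R); last first.
  by apply: eq_bigr => eta _; rewrite mul1r.
have [zr|zr] := boolP (z \in r).
  have zA : z \in A.
    apply/mem_set/FA; move: zr; rewrite /r -[z \in _]/(z \in fset_set F) in_fset_set //; exact: set_mem.
  rewrite (bigD1_seq z zr (fset_uniq _)) /= big1 ?addr0 ?indicE ?zA ?eqxx //.
  by move=> i /negPf; rewrite eq_sym => ->.
rewrite big_seq big1 ?indicE // => i ir; case: eqP => // zi.
by rewrite zi ir in zr.
Qed.

Lemma surv_continuous_measurable (A : set config) xi (k t : R) : 0 <= k ->
  measurable_fun `[0, t] (fun s => surv xi A (k * s)).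
Proof.
move=> k0; apply: (@measurable_fun_cvg _ _ _ _ (fun m s => Sn j N (\1_A) m xi (k * s))).
  move=> m; apply: subspace_continuous_measurable_fun => //.
  apply: continuous_within_cc => s /andP[s0 _].
  apply: continuous_rescale.
  by apply: Sn_continuous => //; rewrite mulr_ge0.
move=> s; rewrite /= in_itv /= => /andP[s0 _]; apply: Sn_ind_cvg.
by rewrite mulr_ge0.
Qed.

(** Time is accelerated by [k], so that [s] is macroscopic. As probability may be lost, the
    truncated occupation of the complement of [good] is bounded by one minus that of [good], which
    converges under the time integral. *)
Lemma dynkin_surv (F dF : R -> config -> R) (A good : set config) (X C k t : R) xi :
  0 < k -> 0 <= t -> 0 <= C -> 0 <= X ->
  (forall s z, 0 <= s <= t -> 0 <= F s z) ->
  (forall s z, 0 <= s <= t -> is_derive s 1 (F^~ z) (dF s z)) ->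
  (forall s z, 0 <= s <= t ->
    k * (Loff j (F s) z - qtot j z * F s z) <= dF s z + C * (1 - \1_good z)) ->
  (forall z, A z -> X <= F 0 z) ->
  X * surv xi A (k * t) <=
    F t xi + C * Rintegral mu `[0, t] (fun s => 1 - surv xi good (k * s)).
Proof.
move=> k0 t0 C0 X0 F0 Fd FL FA.
have kp s : 0 <= s -> 0 <= k * s by move=> s0; rewrite mulr_ge0 // ltW.
pose bad z : R := 1 - \1_good z.
have bad0 z : 0 <= bad z by rewrite subr_ge0; case/andP: (ind01 good z).
have kV s : is_derive s 1 (fun s : R => s / k) k^-1.
  apply: (is_derive_eq (drv_mul _ _ _ _ _ (drv_id s) (drv_cst k^-1 s))).
  by rewrite mul1r mulr0 addr0.
have skt s : 0 <= s <= k * t -> 0 <= s / k <= t.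
  by case/andP=> s0 skt; rewrite ler_pdivrMr // (mulrC t) skt andbT divr_ge0 // ltW.
have D m : Sn j N (F 0) m xi (k * t) <=
    F t xi + C * Rintegral mu `[0, t] (fun s => Sn j N bad m xi (k * s)).
  have := @dynkin R j N j0 (fun s => F (s / k)) (fun s z => dF (s / k) z / k) bad (C / k) (k * t) m xi.
  rewrite mul0r (mulrC k t) mulfK ?gt_eqF // => /(_ _ _ bad0 _ _ _)/le_trans; apply => //.
  - by rewrite mulrC kp.
  - by rewrite divr_ge0 // ltW.
  - by move=> s z; rewrite mulrC => /skt; exact: F0.
  - move=> s z; rewrite mulrC => /skt h.
    exact: (drv_comp (fun s => s / k) (F^~ z) _ _ _ (kV s) (Fd _ _ h)).
  - move=> s z; rewrite mulrC => /skt h; have := FL _ z h.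
    rewrite -/(bad z) -(ler_pM2l (x := k^-1)) ?invr_gt0 // mulKf ?gt_eqF //.
    by rewrite mulrDr (mulrC k^-1) mulrA (mulrC k^-1 C).
  rewrite (mulrC t) Rintegral_rescale //; last by move=> s s0; exact: Sn_continuous.
  by rewrite mulrA divfK // gt_eqF.
pose I := Rintegral mu `[0, t] (fun s => 1 - surv xi good (k * s)).
have si : mu.-integrable `[0, t] (EFin \o (fun s => 1 - surv xi good (k * s))) /\
   Rintegral mu `[0, t] (fun s => 1 - Sn j N \1_good m xi (k * s)) @[m --> \oo] --> I.
  apply: (dominated_Rintegral_cvg _ _ _ (fun=> 1)) => //.
  - move=> m; apply: subspace_continuous_measurable_fun => //.
    apply: continuous_within_cc => s /andP[s0 _]; apply: continuousB; first exact: cvg_cst.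
    apply: continuous_rescale.
    by apply: Sn_continuous => //; exact: kp.
  - move=> s; rewrite /= in_itv /= => /andP[s0 _]; apply: cvgB; first exact: cvg_cst.
    by apply: Sn_ind_cvg; exact: kp.
  - exact: integrable_cst_itv.
  - move=> m s; rewrite /= in_itv /= => /andP[s0 _]; rewrite ger0_norm ?subr_ge0 ?Sn_ind_le1 ?kp //.
    by rewrite lerBlDr lerDl; apply: Sn_ge0 => //; exact: kp.
(* Two levels are used: [m] in the target event stays fixed while [n] in the source term tends to
   infinity. Monotonicity in the level replaces [m] by [n] before [dynkin] applies. *)
have XS m n : (m <= n)%N -> X * Sn j N \1_A m xi (k * t) <=
    F t xi + C * Rintegral mu `[0, t] (fun s => 1 - Sn j N \1_good n xi (k * s)).
  move=> mn; apply: (@le_trans _ _ (X * Sn j N \1_A n xi (k * t))).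
    by rewrite ler_wpM2l //; apply: Sn_ind_nd => //; exact: kp.
  apply: le_trans (_ : Sn j N (F 0) n xi (k * t) <= _).
    apply: Sn_scale_le => //; first exact: kp.
    move=> z; rewrite indicE; have [/set_mem zA|_] := boolP (z \in A); rewrite ?mulr1 ?mulr0.
      exact: FA.
    by apply: F0; rewrite lexx t0.
  apply: le_trans (D n) _; rewrite lerD2l ler_wpM2l //.
  have sc f s : 0 <= s <= t -> {for s, continuous (fun s => Sn j N f n xi (k * s))}.
    move=> /andP[s0 _].
    apply: continuous_rescale.
    by apply: Sn_continuous => //; exact: kp.
  apply: le_Rintegral => //.
  - by apply: continuous_integrable => s; exact: sc.
  - apply: continuous_integrable => s st; apply: continuousB; [exact: cvg_cst|exact: sc].
  - move=> s; rewrite /= in_itv /= => /andP[s0 _].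
    by apply: Sn_le_compl => //; [exact: kp|move=> z; rewrite /bad subrK].
have XI m : X * Sn j N \1_A m xi (k * t) <= F t xi + C * I.
  have lim : (fun n => F t xi + C * Rintegral mu `[0, t] (fun s => 1 - Sn j N \1_good n xi (k * s)))
      @ \oo --> F t xi + C * I.
    by apply: cvgD; [exact: cvg_cst|apply: cvgM; [exact: cvg_cst|exact: si.2]].
  apply: (cvgr_to_ge lim).
  by exists m => // n /= mn; exact: XS.
(* Passing to the limit in [m] divides by [X], hence the separate case [X = 0]. *)
move: X0; rewrite le_eqVlt => /predU1P[X0|X0].
  by have := XI 0%N; rewrite -X0 !mul0r.
rewrite mulrC -ler_pdivlMr //; apply: surv_le => [|m]; first exact: kp.
by rewrite ler_pdivlMr // (mulrC _ X); exact: XI.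
Qed.

End Survival.

(** * Generator acting on linear functionals *)

Section Generator.
Context {R : realType} (j : R) (N : nat) (j0 : 0 <= j) (N0 : (0 < N)%N).
Local Notation mu := (@lebesgue_measure R).
Local Notation config := (config N).
Implicit Types (xi : config) (b : nat -> R) (f : config -> R).

Definition lin b xi : R := \sum_(z : 'I_N.+1) b z * (xi z)%:R.
Definition mass xi : R := \sum_(z : 'I_N.+1) (xi z)%:R.
Definition Gen f xi : R := Loff j f xi - qtot j xi * f xi.

(** Generator of a single walker jumping at rate 1/2 across each bond, reflected at both ends. *)
Definition lap b (z : nat) : R :=
  ((if (z < N)%N then b z.+1 - b z else 0) + (if (0 < z)%N then b z.-1 - b z else 0)) / 2.

Lemma GenE f xi : Gen f xi = \sum_(p <- jumps j N xi) p.1 * (f p.2 - f xi).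
Proof.
rewrite /Gen /qtot !LoffE mulr_suml -sumrB; apply: eq_bigr => p _.
by rewrite mulr1 mulrBr.
Qed.

Lemma Gen_unfold f xi : Gen f xi =
  \sum_(x < N) ((xi (inord x))%:R / 2 * (f (move xi (inord x) (inord x.+1)) - f xi)
     + (xi (inord x.+1))%:R / 2 * (f (move xi (inord x.+1) (inord x)) - f xi))
  + j * N%:R^-1 * (f (add0 xi) - f xi)
  + (if nonempty_cfg xi then j * N%:R^-1 * (f (remR xi) - f xi) else 0).
Proof. by rewrite GenE -(LoffE j N (fun z => f z - f xi)). Qed.

Lemma linD1 b (i : 'I_N.+1) xi :
  lin b xi = b i * (xi i)%:R + \sum_(z | z != i) b z * (xi z)%:R.
Proof. by rewrite /lin (bigD1 i). Qed.

Lemma lin_move b xi (x y : 'I_N.+1) : x != y -> (0 < xi x)%N ->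
  lin b (move xi x y) = lin b xi + (b y - b x).
Proof.
move=> xy xi0; rewrite (linD1 _ x) [in RHS](linD1 _ x).
rewrite (bigD1 y) 1?eq_sym //= [in RHS](bigD1 y) 1?eq_sym //=.
rewrite !ffunE !eqxx (negPf xy) -natr1.
rewrite (_ : \sum_(i < N.+1 | (i != x) && (i != y)) b i * (move xi x y i)%:R =
  \sum_(i < N.+1 | (i != x) && (i != y)) b i * (xi i)%:R); last first.
  by apply: eq_bigr => i /andP[/negPf ix /negPf iy]; rewrite ffunE iy ix.
by rewrite -[in RHS](prednK xi0) -[in RHS]natr1; ring.
Qed.

Lemma lin_add0 b xi : lin b (add0 xi) = lin b xi + b 0%N.
Proof.
rewrite (linD1 _ ord0) [in RHS](linD1 _ ord0) !ffunE eqxx -natr1.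
rewrite (_ : \sum_(i < N.+1 | i != ord0) b i * (add0 xi i)%:R =
  \sum_(i < N.+1 | i != ord0) b i * (xi i)%:R); last first.
  by apply: eq_bigr => i /negPf i0; rewrite ffunE i0.
by rewrite /=; ring.
Qed.

Lemma rightmostP xi : nonempty_cfg xi ->
  exists2 z : 'I_N.+1, (z : nat) = rightmost xi & (0 < xi z)%N.
Proof.
move=> /existsP[z0 z0P].
pose A := [pred z : 'I_N.+1 | (0 < xi z)%N].
have [|z zA E] := @eq_bigmax_cond _ A (fun z : 'I_N.+1 => z : nat).
  by apply/card_gt0P; exists z0.
by exists z => //; rewrite /rightmost -E; apply: eq_bigl => i; rewrite inE.
Qed.

Lemma lin_remR b xi : nonempty_cfg xi ->
  lin b (remR xi) = lin b xi - b (rightmost xi).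
Proof.
move=> /rightmostP[x xR x0].
rewrite (linD1 _ x) [in RHS](linD1 _ x) !ffunE xR eqxx.
rewrite (_ : \sum_(i < N.+1 | i != x) b i * (remR xi i)%:R =
  \sum_(i < N.+1 | i != x) b i * (xi i)%:R); last first.
  apply: eq_bigr => i /negPf i0; rewrite ffunE -xR.
  by rewrite (_ : (i : nat) == x = false) //; rewrite -i0.
by rewrite -[in RHS](prednK x0) -[in RHS]natr1; ring.
Qed.

(** A [move] out of an empty site would create a particle, since [.-1] is 0 at 0. The vanishing rate
    in front lets such transitions be ignored. *)
Lemma rate_mulr (n : nat) (A B : R) : ((0 < n)%N -> A = B) -> n%:R / 2 * A = n%:R / 2 * B.
Proof. by case: n => [|n] AB; rewrite ?mul0r // AB. Qed.

(** The bond sum is regrouped by sites, right and left hops being reindexed separately; the missing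
    bonds at the two ends give the reflecting convention of [lap]. *)
Lemma Gen_lin b xi : Gen (lin b) xi =
  \sum_(z : 'I_N.+1) lap b z * (xi z)%:R
  + j * N%:R^-1 * (b 0%N - if nonempty_cfg xi then b (rightmost xi) else 0).
Proof.
rewrite Gen_unfold.
have -> : \sum_(x < N) ((xi (inord x))%:R / 2 * (lin b (move xi (inord x) (inord x.+1)) - lin b xi)
     + (xi (inord x.+1))%:R / 2 * (lin b (move xi (inord x.+1) (inord x)) - lin b xi)) =
    \sum_(z : 'I_N.+1) lap b z * (xi z)%:R.
  pose X k : R := (xi (inord k))%:R.
  transitivity (\sum_(x < N) X x / 2 * (b x.+1 - b x) + \sum_(x < N) X x.+1 / 2 * (b x - b x.+1)).
    rewrite -big_split /=; apply: eq_bigr => x _.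
    have xn : (inord x : 'I_N.+1) != inord x.+1.
      by rewrite -val_eqE /= !inordK ?ltnS ?(ltnW (ltn_ord x)) // neq_ltn ltnSn.
    have E1 : (inord x : 'I_N.+1) = x :> nat by rewrite inordK // ltnS ltnW.
    have E2 : (inord x.+1 : 'I_N.+1) = x.+1 :> nat by rewrite inordK // ltnS.
    congr (_ + _); apply: rate_mulr => xi0.
      by rewrite lin_move // E1 E2; ring.
    by rewrite lin_move 1?eq_sym // E1 E2; ring.
  rewrite (eq_bigr (fun z : 'I_N.+1 =>
    X z / 2 * (if (z < N)%N then b z.+1 - b z else 0) +
    X z / 2 * (if (0 < z)%N then b z.-1 - b z else 0))); last first.
    by move=> z _; rewrite /lap /X inord_val; ring.
  rewrite big_split /=; congr (_ + _).
    rewrite big_ord_recr /= ltnn mulr0 addr0; apply: eq_bigr => x _.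
    by rewrite ltn_ord.
  rewrite big_ord_recl /= mulr0 add0r; apply: eq_bigr => x _.
  by rewrite /bump /= add1n.
rewrite lin_add0 -addrA; congr (_ + _).
case: ifP => [ne|_]; last by ring.
by rewrite lin_remR //; ring.
Qed.

Lemma massE xi : mass xi = lin (fun=> 1) xi.
Proof. by apply: eq_bigr => z _; rewrite mul1r. Qed.

Lemma mass_ge0 xi : 0 <= mass xi.
Proof. exact: sumr_ge0. Qed.

Lemma mass_empty xi : nonempty_cfg xi = false -> mass xi = 0.
Proof.
move=> h; apply: big1 => z _; apply/eqP; rewrite pnatr_eq0.
by apply/negPn/negP; rewrite -lt0n => z0; move/negbT/existsP: h; apply; exists z.
Qed.

(** Hops conserve the mass m. Injection and removal change its square by 2m + 1 and -2m + 1 at equal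
    rates, so the linear parts cancel. On the empty configuration only injection remains, giving
    half of the bound. *)
Lemma Gen_mass2 xi : Gen (fun z => mass z ^+ 2) xi <= 2 * j / N%:R.
Proof.
have jN : 0 <= j * N%:R^-1 by rewrite mulr_ge0 // invr_ge0.
rewrite Gen_unfold big1 => [|x _]; last first.
  have xn : (inord x : 'I_N.+1) != inord x.+1.
    by rewrite -val_eqE /= !inordK ?ltnS ?(ltnW (ltn_ord x)) // neq_ltn ltnSn.
  rewrite (_ : _ * (mass (move xi (inord x) _) ^+ 2 - _) = (xi (inord x))%:R / 2 * 0); last first.
    by apply: rate_mulr => x0; rewrite !massE lin_move // subrr addr0 subrr.
  rewrite (_ : _ * (mass (move xi (inord x.+1) _) ^+ 2 - _) = (xi (inord x.+1))%:R / 2 * 0); last first.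
    by apply: rate_mulr => x0; rewrite !massE lin_move 1?eq_sym // subrr addr0 subrr.
  by rewrite !mulr0 addr0.
rewrite add0r !massE lin_add0 -!massE.
case: ifP => [ne|/mass_empty ->].
  rewrite (massE (remR xi)) lin_remR // -massE le_eqVlt; apply/orP; left; apply/eqP.
  by ring.
by rewrite !(add0r, addr0) expr0n expr1n subr0 mulr1 -mulrA; lra.
Qed.

Definition scaled_mass xi : R := mass xi / N%:R.

Lemma scaled_mass_ge0 xi : 0 <= scaled_mass xi.
Proof. by rewrite divr_ge0 ?mass_ge0. Qed.

Lemma Gen_combo (f g : config -> R) (k c d : R) xi :
  Gen (fun z => k + c * f z + d * g z) xi = c * Gen f xi + d * Gen g xi.
Proof.
rewrite !GenE !mulr_sumr -big_split /=; apply: eq_bigr => p _; ring.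
Qed.

(* The quadratic term keeps the test function nonnegative, which is what allows
   discarding the part of the mass that the truncated sums [Sn] have lost. *)
Definition test_fun (b : R -> nat -> R) (H : R -> R) (K d t s : R) xi : R :=
  K + lin (b s) xi / N%:R + H s + d * expR (s - t) * (1 + scaled_mass xi ^+ 2)
   + 2 * j * d / N%:R * s.

Lemma lin_norm_le (B : R) b xi :
  (forall z, (z <= N)%N -> `|b z| <= B) -> `|lin b xi / N%:R| <= B * scaled_mass xi.
Proof.
move=> bB; rewrite normrM normfV (ger0_norm (ler0n _ _)) /scaled_mass mulrA.
rewrite ler_wpM2r ?invr_ge0 // /mass mulr_sumr.
apply: le_trans (ler_norm_sum _ _ _) _; apply: ler_sum => z _.
by rewrite normrM (ger0_norm (ler0n _ _)) ler_wpM2r // bB // -ltnS.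
Qed.

(** Each term of [test_fun] pays for one error: the growth of [expR (s - t)] absorbs [e] times the
    mass, the term linear in s pays for [Gen_mass2], [H] carries the expected boundary flux, and [K]
    completes a square to keep the sum nonnegative. The factors N^2 of time, 1/N of the functional
    and j/N of the rate leave [j] in front of the boundary difference. *)
Lemma first_moment_bound (b db : R -> nat -> R) (H dH : R -> R)
    (A good : set config) (B e d K X C t : R) xi :
  0 <= t -> 0 <= C -> 0 <= X -> 0 < d -> 2 * e <= d * expR (- t) -> 0 <= e ->
  B + B ^+ 2 * expR t / (4 * d) <= K ->
  (forall s z, 0 <= s <= t -> (z <= N)%N -> is_derive s 1 (b^~ z) (db s z)) ->
  (forall s, 0 <= s <= t -> is_derive s 1 H (dH s)) ->
  (forall s z, 0 <= s <= t -> (z <= N)%N -> `|b s z| <= B) ->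
  (forall s, 0 <= s <= t -> `|H s| <= B) ->
  (forall s z, 0 <= s <= t -> (z <= N)%N -> N%:R ^+ 2 * lap (b s) z - db s z <= e) ->
  (forall s z, 0 <= s <= t ->
     j * (b s 0%N - if nonempty_cfg z then b s (rightmost z) else 0) - dH s
       <= e + C * (1 - \1_good z)) ->
  (forall z, A z -> X <= K + lin (b 0) z / N%:R + H 0) ->
  X * surv j N xi A (N%:R ^+ 2 * t) <=
    K + lin (b t) xi / N%:R + H t + d * (1 + scaled_mass xi ^+ 2) + 2 * j * d / N%:R * t
    + C * Rintegral mu `[0, t] (fun s => 1 - surv j N xi good (N%:R ^+ 2 * s)).
Proof.
move=> t0 C0 X0 d0 ed e0 BK bd Hd bB HB lapb bndry XA.
have Np : 0 < N%:R :> R by rewrite ltr0n.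
have Nn : N%:R != 0 :> R by rewrite gt_eqF.
have jdN : 0 <= 2 * j * d / N%:R.
  by rewrite divr_ge0 ?mulr_ge0 // ltW.
have Fpos s z : 0 <= s <= t -> 0 <= K + lin (b s) z / N%:R + H s + d * expR (s - t) * scaled_mass z ^+ 2.
  move=> /[dup] s0t /andP[s0 st].
  have h1 := lin_norm_le B (b s) z (fun y => bB s y s0t).
  have /ler_normlP[h2 _] := HB s s0t.
  have {}h1 : - (B * scaled_mass z) <= lin (b s) z / N%:R.
    by have /ler_normlP[? _] := h1; lra.
  have M0 := scaled_mass_ge0 z.
  have eE : expR (- t) * expR t = 1 by rewrite -expRD addNr expR0.
  have h3 : d * expR (- t) * scaled_mass z ^+ 2 <= d * expR (s - t) * scaled_mass z ^+ 2.
    rewrite ler_wpM2r ?exprn_ge0 // ler_wpM2l ?(ltW d0) // ler_expR; lra.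
  (* the discriminant of [d e^-t M^2 - B M + B^2 e^t / (4 d)] vanishes *)
  have h4 : 0 <= d * expR (- t) * scaled_mass z ^+ 2 - B * scaled_mass z + B ^+ 2 * expR t / (4 * d).
    have -> : d * expR (- t) * scaled_mass z ^+ 2 - B * scaled_mass z + B ^+ 2 * expR t / (4 * d) =
       d * expR (- t) * (scaled_mass z - B * expR t / (2 * d)) ^+ 2.
      have ne : expR t != 0 by rewrite gt_eqF // expR_gt0.
      have -> : expR (- t) = (expR t)^-1 by rewrite expRN.
      by field; rewrite ne (gt_eqF d0).
    by rewrite mulr_ge0 ?sqr_ge0 // mulr_ge0 ?expR_ge0 // ltW.
  lra.
have <- : test_fun b H K d t t xi = K + lin (b t) xi / N%:R + H t +
    d * (1 + scaled_mass xi ^+ 2) + 2 * j * d / N%:R * t.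
  by rewrite /test_fun subrr expR0 mulr1.
refine (@dynkin_surv R j N j0 (test_fun b H K d t)
  (fun s z => lin (db s) z / N%:R + dH s + d * expR (s - t) * (1 + scaled_mass z ^+ 2) + 2 * j * d / N%:R)
  A good X C (N%:R ^+ 2) t xi _ t0 C0 X0 _ _ _ _).
- by rewrite exprn_gt0.
- move=> s z s0t; rewrite /test_fun; have := Fpos s z s0t.
  have : 0 <= d * expR (s - t) by rewrite mulr_ge0 ?expR_ge0 // ltW.
  have : 0 <= 2 * j * d / N%:R * s by rewrite mulr_ge0 //; case/andP: s0t.
  rewrite mulrDr mulr1; lra.
- move=> s z s0t; rewrite /test_fun.
  have hl : is_derive s 1 (fun s => lin (b s) z) (lin (db s) z).
    apply: drv_sum => y.
    exact: (is_derive_eq (drv_mul _ _ _ _ _ (bd s y s0t (ltn_ord y)) (drv_cst _ s))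
       ltac:(by rewrite mulr0 addr0)).
  have he : is_derive s 1 (fun s => expR (s - t)) (expR (s - t)).
    apply: (is_derive_eq (drv_exp _ _ _ (drv_sub _ _ _ _ _ (drv_id s) (drv_cst t s)))).
    by rewrite subr0 mulr1.
  have h := drv_add _ _ _ _ _ (drv_add _ _ _ _ _ (drv_add _ _ _ _ _ (drv_add _ _ _ _ _ (drv_cst K s)
    (drv_mul _ _ _ _ _ hl (drv_cst N%:R^-1 s))) (Hd s s0t))
    (drv_mul _ _ _ _ _ (drv_scale d _ _ _ he) (drv_cst (1 + scaled_mass z ^+ 2) s)))
    (drv_scale (2 * j * d / N%:R) _ _ _ (drv_id s)).
  by apply: (is_derive_eq h); ring.
- move=> s z s0t; rewrite -/(Gen _ z).
  set E := expR (s - t).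
  have -> : test_fun b H K d t s = (fun y => (K + H s + d * E + 2 * j * d / N%:R * s) +
     N%:R^-1 * lin (b s) y + (d * E / N%:R ^+ 2) * mass y ^+ 2).
    by apply/funext => y; rewrite /test_fun -/E /scaled_mass; field.
  rewrite Gen_combo Gen_lin.
  have E0 : 0 <= d * E by rewrite mulr_ge0 ?expR_ge0 // ltW.
  have E1 : d * E <= d.
    by rewrite ger_pMr // -expR0 ler_expR; case/andP: s0t => _ ?; lra.
  have E2 : d * expR (- t) <= d * E.
    by rewrite ler_pM2l // ler_expR; case/andP: s0t => ? _; lra.
  have h1 : d * E * Gen (fun y => mass y ^+ 2) z <= 2 * j * d / N%:R.
    apply: (@le_trans _ _ (d * E * (2 * j / N%:R))).
      by rewrite ler_wpM2l // Gen_mass2.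
    rewrite -subr_ge0 (_ : _ - _ = (d - d * E) * (2 * j / N%:R)).
      by rewrite mulr_ge0 ?subr_ge0 // divr_ge0 // mulr_ge0.
    by field.
  have h2 : (N%:R * \sum_(y < N.+1) lap (b s) y * (z y)%:R) <= lin (db s) z / N%:R + e * scaled_mass z.
    rewrite /scaled_mass mulrA -mulrDl ler_pdivlMr //.
    rewrite (_ : N%:R * _ * N%:R = \sum_(y < N.+1) (N%:R ^+ 2 * lap (b s) y) * (z y)%:R); last first.
      by rewrite mulrAC mulr_sumr; apply: eq_bigr => y _; ring.
    rewrite /lin /mass mulr_sumr -big_split /=; apply: ler_sum => y _.
    rewrite -mulrDl ler_wpM2r //; have := lapb s y s0t (ltn_ord y); lra.
  have h3 := bndry s z s0t.
  (* Uses m + 1 <= 2 (1 + m^2), a consequence of (m - 1)^2 >= 0; this is the factor 2 in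
     [2 * e <= d * expR (- t)]. *)
  have h4 : e * scaled_mass z + e <= d * E * (1 + scaled_mass z ^+ 2).
    apply: (@le_trans _ _ (2 * e * (1 + scaled_mass z ^+ 2))).
      have := sqr_ge0 (scaled_mass z - 1); have := scaled_mass_ge0 z; nra.
    by rewrite ler_wpM2r ?addr_ge0 ?exprn_ge0 ?scaled_mass_ge0 //; lra.
  rewrite (_ : _ * (_ + _) = N%:R * \sum_(y < N.+1) lap (b s) y * (z y)%:R +
    j * (b s 0%N - (if nonempty_cfg z then b s (rightmost z) else 0)) +
    d * E * Gen (fun y => mass y ^+ 2) z); first by lra.
  by field.
- move=> z zA; apply: le_trans (XA z zA) _.
  rewrite /test_fun mulr0 addr0 lerDl mulr_ge0 ?addr_ge0 ?sqr_ge0 //.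
  by rewrite mulr_ge0 ?expR_ge0 // ltW.
Qed.

End Generator.

(** * Taylor bounds and consistency of the reflecting discrete Laplacian *)

Section Taylor.
Context {R : realType}.
Implicit Types (c x y z : R).

Lemma taylor1 (w w1 : R -> R) (C : R) x y :
  0 <= x <= 1 -> 0 <= y <= 1 ->
  (forall z, 0 <= z <= 1 -> is_derive z 1 w (w1 z)) ->
  (forall z z', 0 <= z <= 1 -> 0 <= z' <= 1 -> `|w1 z - w1 z'| <= C * `|z - z'|) ->
  `|w y - w x - (y - x) * w1 x| <= C * (y - x) ^+ 2.
Proof.
move=> x01 y01 wd wC.
have between (a b c : R) : 0 <= a <= 1 -> 0 <= b <= 1 -> a <= c <= b -> 0 <= c <= 1.
  by move=> /andP[? _] /andP[_ ?] /andP[? ?]; apply/andP; split; lra.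
have C0 : 0 <= C.
  have := wC 0 1; rewrite !lexx !ler01 => /(_ isT isT); rewrite sub0r normrN normr1 mulr1.
  exact: le_trans.
have key (c : R) : 0 <= c <= 1 -> `|c - x| <= `|y - x| -> w y - w x = w1 c * (y - x) ->
    `|w y - w x - (y - x) * w1 x| <= C * (y - x) ^+ 2.
  move=> c01 cx ->; rewrite (mulrC (y - x)) -mulrBl normrM.
  apply: (@le_trans _ _ (C * `|c - x| * `|y - x|)); first by rewrite ler_wpM2r // wC.
  by rewrite -mulrA ler_wpM2l // -(real_normK (num_real (y - x))) expr2 ler_wpM2r.
have [xy|yx] := leP x y.
  have [c cxy E] := mean_value w w1 x y xy (fun z h => wd z (between _ _ _ x01 y01 h)).
  apply: (key c); [exact: between cxy| |exact: E].
  by case/andP: cxy => ? ?; rewrite !ger0_norm; lra.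
have [c cxy E] := mean_value w w1 y x (ltW yx) (fun z h => wd z (between _ _ _ y01 x01 h)).
apply: (key c); [exact: between cxy| |].
  by case/andP: cxy => ? ?; rewrite !ler0_norm; lra.
by rewrite -[LHS]opprB E; ring.
Qed.

(** The derivative of the remainder is the first-order remainder of [w1], so one mean value step on
    top of [taylor1] suffices. *)
Lemma taylor2 (w w1 w2 : R -> R) (C : R) x y :
  0 <= x <= 1 -> 0 <= y <= 1 ->
  (forall z, 0 <= z <= 1 -> is_derive z 1 w (w1 z)) ->
  (forall z, 0 <= z <= 1 -> is_derive z 1 w1 (w2 z)) ->
  (forall z z', 0 <= z <= 1 -> 0 <= z' <= 1 -> `|w2 z - w2 z'| <= C * `|z - z'|) ->
  `|w y - w x - (y - x) * w1 x - (y - x) ^+ 2 / 2 * w2 x| <= C * `|y - x| ^+ 3.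
Proof.
move=> x01 y01 wd w1d w2C.
have between (a b c : R) : 0 <= a <= 1 -> 0 <= b <= 1 -> a <= c <= b -> 0 <= c <= 1.
  by move=> /andP[? _] /andP[_ ?] /andP[? ?]; apply/andP; split; lra.
pose f z := w z - w x - (z - x) * w1 x - (z - x) ^+ 2 / 2 * w2 x.
pose df z := w1 z - w1 x - (z - x) * w2 x.
have fd z : 0 <= z <= 1 -> is_derive z 1 f (df z).
  move=> z01; have hx := drv_sub _ _ _ _ _ (drv_id z) (drv_cst x z).
  have h := drv_sub _ _ _ _ _ (drv_sub _ _ _ _ _ (drv_sub _ _ _ _ _ (wd z z01) (drv_cst (w x) z))
    (drv_mul _ _ _ _ _ hx (drv_cst (w1 x) z)))
    (drv_mul _ _ _ _ _ (drv_mul _ _ _ _ _ (drv_mul _ _ _ _ _ hx hx) (drv_cst 2^-1 z)) (drv_cst (w2 x) z)).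
  by apply: (is_derive_eq h); rewrite /df; field.
have key (c : R) : 0 <= c <= 1 -> `|c - x| <= `|y - x| -> f y - f x = df c * (y - x) ->
    `|f y| <= C * `|y - x| ^+ 3.
  move=> c01 cx; rewrite [f x](_ : _ = 0); last by rewrite /f; ring.
  rewrite subr0 => ->; rewrite normrM.
  apply: (@le_trans _ _ (C * (c - x) ^+ 2 * `|y - x|)).
    by rewrite ler_wpM2r //; apply: taylor1 w2C.
  have C0 : 0 <= C.
    have := w2C 0 1; rewrite !lexx !ler01 => /(_ isT isT); rewrite sub0r normrN normr1 mulr1.
    exact: le_trans.
  rewrite -mulrA ler_wpM2l // (exprSr _ 2) ler_wpM2r //.
  by rewrite -(real_normK (num_real (c - x))) lerXn2r ?nnegrE.
have [xy|yx] := leP x y.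
  have [c cxy E] := mean_value f df x y xy (fun z h => fd z (between _ _ _ x01 y01 h)).
  apply: (key c); [exact: between cxy| |exact: E].
  by case/andP: cxy => ? ?; rewrite !ger0_norm; lra.
have [c cxy E] := mean_value f df y x (ltW yx) (fun z h => fd z (between _ _ _ y01 x01 h)).
apply: (key c); [exact: between cxy| |].
  by case/andP: cxy => ? ?; rewrite !ler0_norm; lra.
by rewrite -[LHS]opprB E; ring.
Qed.

Lemma lipschitz_of_derive (w w1 : R -> R) (C : R) x y :
  0 <= x <= 1 -> 0 <= y <= 1 ->
  (forall z, 0 <= z <= 1 -> is_derive z 1 w (w1 z)) ->
  (forall z, 0 <= z <= 1 -> `|w1 z| <= C) ->
  `|w x - w y| <= C * `|x - y|.
Proof.
move=> x01 y01 wd wC.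
wlog xy : x y x01 y01 / y <= x.
  move=> h; have [|/ltW] := leP y x; first exact: h.
  by rewrite distrC (distrC x); exact: h.
have sub (c : R) : y <= c <= x -> 0 <= c <= 1.
  by move: x01 y01 => /andP[? ?] /andP[? ?] /andP[? ?]; apply/andP; split; lra.
have [c cxy ->] := mean_value w w1 y x xy (fun z h => wd z (sub z h)).
by rewrite normrM ler_wpM2r // wC // sub.
Qed.

(* Half-integer grid points: reflecting site 0 or N across the boundary of
   [0, 1] gives the next grid point, so the reflecting walk is consistent with
   the Neumann condition to the order needed. *)
Definition grid (N k : nat) : R := (k%:R + 2^-1) / (N.+1)%:R.

Lemma grid01 N k : (k <= N)%N -> 0 <= grid N k <= 1.
Proof.
move=> kN; rewrite /grid divr_ge0 ?addr_ge0 //= ler_pdivrMr ?ltr0n // mul1r.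
have -> : N.+1%:R = N%:R + 1 :> R by rewrite natr1.
by apply: lerD; rewrite ?ler_nat // invf_le1 // ler1n.
Qed.

Lemma gridS N k : grid N k.+1 = grid N k + (N.+1)%:R^-1.
Proof.
by rewrite /grid -natr1; field; rewrite ?natr1 ?nat1r ?pnatr_eq0.
Qed.

(** At an interior site the first-order terms of the two neighbours cancel. At an end the absent
    neighbour contributes 0, which has to match the missing Taylor polynomial to order h^3:
    expanding [w1] from the site to the wall, at distance h/2, where it vanishes, gives exactly
    this. The term in [W] comes from the mesh 1/(N+1) against the factor N^2. *)
Lemma lap_consistency (N : nat) (w w1 w2 : R -> R) (C W : R) k :
  (0 < N)%N -> (k <= N)%N ->
  (forall z, 0 <= z <= 1 -> is_derive z 1 w (w1 z)) ->
  (forall z, 0 <= z <= 1 -> is_derive z 1 w1 (w2 z)) ->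
  (forall z z', 0 <= z <= 1 -> 0 <= z' <= 1 -> `|w2 z - w2 z'| <= C * `|z - z'|) ->
  (forall z, 0 <= z <= 1 -> `|w2 z| <= W) ->
  w1 0 = 0 -> w1 1 = 0 ->
  `|N%:R ^+ 2 * lap N (fun i => w (grid N i)) k - w2 (grid N k) / 2| <= (2 * C + W) / (N.+1)%:R.
Proof.
move=> N0 kN wd w1d w2C w2W w10 w11.
set h := (N.+1)%:R^-1; set z := grid N k.
have h0 : 0 < h by rewrite invr_gt0 ltr0n.
have Nh : N%:R * h = 1 - h by rewrite /h -natr1; field; rewrite ?natr1 ?nat1r ?pnatr_eq0.
have h1 : h <= 1 by rewrite invf_le1 ?ltr0n // ler1n.
have z01 : 0 <= z <= 1 := grid01 N k kN.
have C0 : 0 <= C.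
  have := w2C 0 1; rewrite !lexx !ler01 => /(_ isT isT); rewrite sub0r normrN normr1 mulr1.
  exact: le_trans.
have hC : 0 <= C * h ^+ 3 by rewrite mulr_ge0 // exprn_ge0 // ltW.
set r := if (k < N)%N then w (grid N k.+1) - w z else 0.
set l := if (0 < k)%N then w (grid N k.-1) - w z else 0.
have rE : `|r - (h * w1 z + h ^+ 2 / 2 * w2 z)| <= C * h ^+ 3.
  rewrite /r; case: ifP => [kN'|/negbT]; last first.
    rewrite -leqNgt => Nk; have {Nk kN}kE : k = N by apply/eqP; rewrite eqn_leq kN Nk.
    have zE : z = 1 - h / 2 by rewrite /z /grid kE /h -natr1; field; rewrite ?natr1 ?nat1r ?pnatr_eq0.
    have := taylor1 w1 w2 C z 1 z01 (ltac:(by rewrite ler01 lexx)) w1d w2C.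
    rewrite w11 (_ : 1 - z = h / 2); last by rewrite zE; ring.
    move=> T; rewrite (_ : _ - _ = h * (0 - w1 z - h / 2 * w2 z)); last by field.
    rewrite normrM (ger0_norm (ltW h0)); apply: le_trans (ler_wpM2l (ltW h0) T) _.
    rewrite (_ : h * (C * (h / 2) ^+ 2) = C * h ^+ 3 / 4); last by field.
    lra.
  have := taylor2 w w1 w2 C z (grid N k.+1) z01 (grid01 _ _ kN') wd w1d w2C.
  rewrite gridS -/z -/h (_ : z + h - z = h); last by ring.
  rewrite (ger0_norm (ltW h0)); apply: le_trans; rewrite le_eqVlt; apply/orP; left; apply/eqP.
  by congr (`| _ |); ring.
have lE : `|l - (- h * w1 z + h ^+ 2 / 2 * w2 z)| <= C * h ^+ 3.
  rewrite /l; case: ifP => [k0|/negbT]; last first.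
    rewrite -leqNgt leqn0 => /eqP kE.
    have zE : z = h / 2 by rewrite /z /grid kE add0r mulrC.
    have := taylor1 w1 w2 C z 0 z01 (ltac:(by rewrite ler01 lexx)) w1d w2C.
    rewrite w10 (_ : 0 - z = - (h / 2)); last by rewrite zE; ring.
    move=> T; rewrite (_ : _ - _ = - h * (0 - w1 z - - (h / 2) * w2 z)); last by field.
    rewrite normrM normrN (ger0_norm (ltW h0)); apply: le_trans (ler_wpM2l (ltW h0) T) _.
    rewrite (_ : h * (C * (- (h / 2)) ^+ 2) = C * h ^+ 3 / 4); last by field.
    lra.
  have := taylor2 w w1 w2 C z (grid N k.-1) z01 (grid01 _ _ (leq_trans (leq_pred _) kN)) wd w1d w2C.
  have zE : z = grid N k.-1 + h by rewrite -gridS prednK.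
  rewrite (_ : grid N k.-1 - z = - h); last by rewrite zE; ring.
  rewrite normrN (ger0_norm (ltW h0)); apply: le_trans; rewrite le_eqVlt; apply/orP; left; apply/eqP.
  by congr (`| _ |); ring.
have W0 : 0 <= W by apply: le_trans (w2W z z01).
rewrite (_ : _ - _ = N%:R ^+ 2 * ((r - (h * w1 z + h ^+ 2 / 2 * w2 z)) +
    (l - (- h * w1 z + h ^+ 2 / 2 * w2 z))) / 2 + ((N%:R * h) ^+ 2 - 1) / 2 * w2 z); last first.
  by rewrite /lap -/r -/l; field.
apply: le_trans (ler_normD _ _) _.
rewrite [leRHS]mulrDl; apply: lerD.
  rewrite -mulrA normrM (ger0_norm (sqr_ge0 _)) normrM (ger0_norm (_ : 0 <= 2^-1 :> R)) //.
  apply: (@le_trans _ _ (N%:R ^+ 2 * ((C * h ^+ 3 + C * h ^+ 3) / 2))).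
    rewrite ler_wpM2l ?sqr_ge0 // ler_wpM2r //.
    exact: le_trans (ler_normD _ _) (lerD rE lE).
  rewrite (_ : _ * _ = (N%:R * h) ^+ 2 * (C * h)); last by field.
  rewrite Nh; have : 0 <= C * h by rewrite mulr_ge0 // ltW.
  by nra.
rewrite Nh normrM mulrC ler_pM // ?w2W //.
rewrite (_ : _ / 2 = - (h * (2 - h) / 2)); last by field.
rewrite normrN ger0_norm; first by nra.
by rewrite divr_ge0 // mulr_ge0 //; lra.
Qed.

End Taylor.

(** * Macroscopic mass profiles *)

Section Profiles.
Context {R : realType}.
Local Notation mu := (@lebesgue_measure R).
Implicit Types (u g : R -> R) (a b c x y z : R) (N : nat).

Lemma integrable_bounded_mul (D : set R) g u (B : R) : measurable D ->
  measurable_fun D g -> (forall z, D z -> `|g z| <= B) ->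
  mu.-integrable D (EFin \o u) -> mu.-integrable D (EFin \o (fun z => g z * u z)).
Proof.
move=> mD mg gB ui.
have gb : [bounded g x | x in D].
  exists B; split; first exact: num_real.
  by move=> M BM x Dx; apply: le_trans (gB x Dx) (ltW BM).
have := @integrableMr _ _ R mu D mD g (EFin \o u) mg gb ui.
by apply: eq_integrable => // z _; rewrite /= EFinM.
Qed.

Lemma integrable_subitv (a b c d : R) u : c <= a -> b <= d ->
  mu.-integrable `[c, d] (EFin \o u) -> mu.-integrable `[a, b] (EFin \o u).
Proof.
move=> ca bd; apply: integrableS => //.
by apply: subset_itv; rewrite bnd_simp.
Qed.

Lemma Rintegral_split u a b c : a <= b -> b <= c ->
  mu.-integrable `[a, c] (EFin \o u) ->
  Rintegral mu `[a, c] u = Rintegral mu `[a, b] u + Rintegral mu `[b, c] u.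
Proof.
move=> ab bc ui; apply/eqP; rewrite addrC -subr_eq; apply/eqP.
rewrite Rintegral_itvB //.
rewrite Rintegral_itv_obnd_cbnd //; apply: integrableS ui => //.
by apply: subset_itv; rewrite bnd_simp.
Qed.

Lemma Fmac1 u x : 1 <= x -> Fmac x u = 0.
Proof.
rewrite /Fmac le_eqVlt => /predU1P[<-|x1]; first by rewrite set_itv1 Rintegral_set1.
by rewrite set_itv_ge ?Rintegral_set0 // bnd_simp -ltNge.
Qed.

Lemma FmacB u x y : 0 <= x -> x <= y -> y <= 1 -> mu.-integrable `[0, 1] (EFin \o u) ->
  Fmac x u - Fmac y u = Rintegral mu `[x, y] u.
Proof.
move=> x0 xy y1 ui; rewrite /Fmac (Rintegral_split u x y 1) ?addrK //.
exact: integrable_subitv ui.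
Qed.

(** Nonnegativity is asked at every point, so that comparisons involve no exceptional set;
    [bounded_representative] provides such a version of the initial datum. *)
Definition profile u := mu.-integrable `[0, 1] (EFin \o u) /\ forall z, 0 <= z <= 1 -> 0 <= u z.

Lemma Rintegral_profile_ge0 u x y : profile u -> 0 <= x -> y <= 1 -> 0 <= Rintegral mu `[x, y] u.
Proof.
move=> [_ u0] x0 y1; apply: Rintegral_ge0 => z /=; rewrite in_itv /= => /andP[xz zy].
by apply: u0; apply/andP; split; lra.
Qed.

Lemma Fmac_anti u x y : profile u -> 0 <= x -> x <= y -> Fmac y u <= Fmac x u.
Proof.
move=> pu x0 xy; have [y1|y1] := leP y 1.
  by rewrite -subr_ge0 FmacB //; [exact: Rintegral_profile_ge0|case: pu].
by rewrite [leLHS]Fmac1 ?(ltW y1) //; exact: Rintegral_profile_ge0.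
Qed.

Lemma Fmac_ge0 u x : profile u -> 0 <= x -> 0 <= Fmac x u.
Proof. by move=> pu x0; exact: Rintegral_profile_ge0. Qed.

Definition lipschitz01 (g : R -> R) (L : R) := forall x y, 0 <= x <= 1 -> 0 <= y <= 1 ->
  `|g x - g y| <= L * `|x - y|.

Lemma lipschitz_ge0 g (L : R) : lipschitz01 g L -> 0 <= L.
Proof.
move=> /(_ 0 1); rewrite !lexx !ler01 => /(_ isT isT); rewrite sub0r normrN normr1 mulr1.
exact: le_trans.
Qed.

(** Composing with the projection onto [0, 1] gives a function continuous on the whole line that
    agrees with [g] on the interval. *)
Lemma lipschitz_measurable g (L : R) : lipschitz01 g L -> measurable_fun (`[0, 1] : set R) g.
Proof.
move=> gL; pose p z : R := Num.max 0 (Num.min z 1).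
have p01 z : 0 <= p z <= 1.
  by rewrite /p le_max lexx /= ge_max ler01 ge_min lexx orbT.
have pE z : 0 <= z <= 1 -> p z = z.
  by move=> /andP[z0 z1]; rewrite /p (min_idPl z1) (max_idPr z0).
have pc : continuous p.
  move=> z.
  have mc : {for z, continuous (fun z : R => Num.min z 1)}.
    by apply: continuous_min; [exact: cvg_id|exact: cvg_cst].
  have : {for z, continuous (fun z : R => Num.max 0 (Num.min z 1))}.
    by apply: continuous_max; [exact: cvg_cst|exact: mc].
  exact.
have gpc : continuous (g \o p).
  move=> z; apply/cvgrPdist_lt => e e0.
  have L0 := lipschitz_ge0 g L gL.
  have L1 : 0 < L + 1 by rewrite ltr_pwDr.
  have /cvgrPdist_lt/(_ (e / (L + 1))) := pc z.
  rewrite divr_gt0 // => /(_ isT); apply: filterS => y h /=.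
  apply: le_lt_trans (gL _ _ (p01 z) (p01 y)) _.
  apply: le_lt_trans (_ : (L + 1) * `|p z - p y| < e).
    by rewrite ler_wpM2r // lerDl.
  by rewrite mulrC -ltr_pdivlMr.
apply: (@eq_measurable_fun _ _ _ _ _ (g \o p)).
  by move=> z /set_mem /=; rewrite in_itv /= => /pE ->.
apply: measurable_funTS; exact: continuous_measurable_fun.
Qed.

Lemma Fe_split N (xi : config N) k : (k <= N)%N ->
  (Feps xi k)%:R = (xi (inord k))%:R + (Feps xi k.+1)%:R :> R.
Proof. by move=> kN; rewrite /Feps big_ltn ?ltnS // natrD /cfg_at kN. Qed.

Lemma Feps_big N (xi : config N) k : (N < k)%N -> Feps xi k = 0%N.
Proof. by move=> Nk; rewrite /Feps big_geq. Qed.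

Lemma Feps_anti N (xi : config N) k l : (k <= l)%N -> (Feps xi l <= Feps xi k)%N.
Proof.
move=> kl; have [lN|Nl] := leqP l N.+1; last by rewrite Feps_big // ltnW.
by rewrite /Feps (big_cat_nat kl lN) /= leq_addl.
Qed.

Lemma massFeps N (xi : config N) : mass N xi = (Feps xi 0)%:R :> R.
Proof.
rewrite /mass /Feps big_mkord natr_sum; apply: eq_bigr => z _.
by rewrite /cfg_at -ltnS ltn_ord inord_val.
Qed.

Lemma linFeps N (xi : config N) (b : nat -> R) :
  lin N b xi = \sum_(k < N.+1) b k * ((Feps xi k)%:R - (Feps xi k.+1)%:R).
Proof.
apply: eq_bigr => z _; rewrite (Fe_split N xi z) ?inord_val ?addrK //.
by rewrite -ltnS.
Qed.

Lemma abel_summation (b E : nat -> R) N :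
  \sum_(k < N.+1) b k * (E k - E k.+1) =
  b 0%N * E 0%N + \sum_(k < N) (b k.+1 - b k) * E k.+1 - b N * E N.+1.
Proof.
elim: N => [|N IH]; first by rewrite big_ord_recr !big_ord0 /=; ring.
by rewrite big_ord_recr /= IH [in RHS]big_ord_recr /=; ring.
Qed.

Definition close N u (zeta : R) : set (config N) :=
  [set xi | forall k, (k <= N)%N -> `|N%:R^-1 * (Feps xi k)%:R - Fmac (k%:R / N%:R) u| <= zeta].

Lemma grid_near N k z : (0 < N)%N -> (k < N)%N ->
  k%:R / N%:R <= z -> z <= k.+1%:R / N%:R -> `|grid N k - z| <= 2 / N%:R :> R.
Proof.
move=> N0 kN; have Np : 0 < N%:R :> R by rewrite ltr0n.
have kN' : k%:R <= N%:R :> R by rewrite ler_nat ltnW.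
have k0 : 0 <= k%:R :> R by [].
rewrite -natr1 mulrDl mul1r => kz zk.
have NS : N.+1%:R = N%:R + 1 :> R by rewrite natr1.
have g1 : `|grid N k - k%:R / N%:R| <= 1 / N%:R :> R.
  rewrite /grid NS (_ : _ - _ = (N%:R / 2 - k%:R) / (N%:R + 1) / N%:R); last first.
    by field; rewrite ?nat1r ?natr1 ?pnatr_eq0 /= ?gt_eqF.
  rewrite normrM normfV (ger0_norm (ltW Np)) ler_pM2r ?invr_gt0 //.
  have N1 : 0 < N%:R + 1 :> R by rewrite ltr_wpDl.
  rewrite normrM normfV (ger0_norm (ltW N1)) ler_pdivrMr // mul1r.
  by rewrite ler_norml; apply/andP; split; lra.
move: g1; rewrite !ler_norml => /andP[? ?]; apply/andP; split; lra.
Qed.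

(** On one cell the grid value of [g] is off by at most [L] times the distance from [grid_near]. The
    error is weighted by the mass of the cell, so that all cells together cost a multiple of the
    total mass. *)
Lemma block_estimate g u (B L : R) N k : profile u -> (0 < N)%N -> (k < N)%N ->
  lipschitz01 g L -> (forall z, 0 <= z <= 1 -> `|g z| <= B) ->
  `|g (grid N k) * (Fmac (k%:R / N%:R) u - Fmac (k.+1%:R / N%:R) u) -
    (Fmac (k%:R / N%:R) (fun z => g z * u z) - Fmac (k.+1%:R / N%:R) (fun z => g z * u z))|
  <= 2 * L / N%:R * (Fmac (k%:R / N%:R) u - Fmac (k.+1%:R / N%:R) u).
Proof.
move=> [ui u0] N0 kN gL gB; have Np : 0 < N%:R :> R by rewrite ltr0n.
have gui := integrable_bounded_mul _ g u B (measurable_itv `[0, 1]%R)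
  (lipschitz_measurable g L gL) (ltac:(by move=> z /=; rewrite in_itv /=; exact: gB)) ui.
set p := k%:R / N%:R; set q := k.+1%:R / N%:R.
have p0 : 0 <= p by rewrite divr_ge0.
have pq : p <= q by rewrite ler_pM2r ?invr_gt0 // ler_nat.
have q1 : q <= 1 by rewrite ler_pdivrMr // mul1r ler_nat.
rewrite !FmacB //.
have ui' : mu.-integrable `[p, q] (EFin \o u) by exact: integrable_subitv ui.
have gui' : mu.-integrable `[p, q] (EFin \o (fun z => g z * u z)) by exact: integrable_subitv gui.
have guk : mu.-integrable `[p, q] (EFin \o (fun z => g (grid N k) * u z)).
  apply: (integrable_bounded_mul _ (fun=> g (grid N k)) u `|g (grid N k)|) => //.
have ukd : mu.-integrable `[p, q] (EFin \o (fun z => 2 * L / N%:R * u z)).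
  apply: (integrable_bounded_mul _ (fun=> 2 * L / N%:R) u `|2 * L / N%:R|) => //.
rewrite -!RintegralZl // -RintegralB //.
have sub z : p <= z <= q -> 0 <= z <= 1.
  by move=> /andP[? ?]; apply/andP; split; lra.
apply: le_trans (le_normr_Rintegral _ _) _ => //.
  rewrite (_ : EFin \o _ = (fun x => ((g (grid N k) * u x)%:E - (g x * u x)%:E)%E)) //.
  exact: integrableB.
apply: le_Rintegral => //.
  apply: integrable_norm.
  rewrite (_ : EFin \o _ = (fun x => ((g (grid N k) * u x)%:E - (g x * u x)%:E)%E)) //.
  exact: integrableB.
move=> z /=; rewrite in_itv /= => /[dup] zpq /andP[pz zq].
rewrite -mulrBl normrM (ger0_norm (u0 z (sub z zpq))) ler_wpM2r ?u0 ?sub //.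
apply: le_trans (gL _ _ (grid01 N k (ltnW kN)) (sub z zpq)) _.
rewrite (_ : 2 * L / N%:R = L * (2 / N%:R)); last by ring.
by rewrite ler_wpM2l ?(lipschitz_ge0 g L gL) //; exact: grid_near.
Qed.

(** Closeness controls only tail sums. Abel summation moves the difference onto the test values,
    bounded by [B] and varying by at most L/N per site, whence (B + L) zeta. The other term is the
    cost of replacing [g] by its grid values. *)
Lemma close_lin N u g (xi : config N) (B L zeta : R) : (0 < N)%N -> profile u ->
  close N u zeta xi -> lipschitz01 g L -> (forall z, 0 <= z <= 1 -> `|g z| <= B) ->
  `|lin N (fun k => g (grid N k)) xi / N%:R - Rintegral mu `[0, 1] (fun z => g z * u z)|
    <= (B + L) * zeta + 2 * L / N%:R * Fmac 0 u.
Proof.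
move=> N0 pu xiu gL gB; have Np : 0 < N%:R :> R by rewrite ltr0n.
have Nn : N%:R != 0 :> R by rewrite gt_eqF.
pose F k := Fmac (k%:R / N%:R) u; pose G k := Fmac (k%:R / N%:R) (fun z => g z * u z).
pose E k := N%:R^-1 * (Feps xi k)%:R - F k.
pose b k := g (grid N k).
have F1 : F N.+1 = 0 by apply: Fmac1; rewrite ler_pdivlMr // mul1r ler_nat.
have F2 : F N = 0 by apply: Fmac1; rewrite divff.
have G2 : G N = 0 by apply: Fmac1; rewrite divff.
have z0 : 0 <= zeta by apply: le_trans (xiu 0%N _).
have E1 : E N.+1 = 0 by rewrite /E F1 Feps_big // mulr0 subrr.
have -> : lin N b xi / N%:R = \sum_(k < N.+1) b k * (E k - E k.+1) + \sum_(k < N) b k * (F k - F k.+1).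
  have -> : \sum_(k < N) b k * (F k - F k.+1) = \sum_(k < N.+1) b k * (F k - F k.+1).
    by rewrite big_ord_recr /= F1 F2 subrr mulr0 addr0.
  rewrite linFeps mulr_suml -big_split /=; apply: eq_bigr => k _; rewrite /E; ring.
have -> : Rintegral mu `[0, 1] (fun z => g z * u z) = \sum_(k < N) (G k - G k.+1).
  rewrite -(big_mkord xpredT (fun k => G k - G k.+1)) (telescope_sumr_eq (fun k => - G k)) //.
    by rewrite G2 /G mul0r oppr0 sub0r opprK.
  by move=> k _; rewrite opprK addrC.
rewrite -addrA -sumrB; apply: le_trans (ler_normD _ _) _; apply: lerD.
  rewrite abel_summation E1 mulr0 subr0; apply: le_trans (ler_normD _ _) _.
  rewrite [leRHS]mulrDl; apply: lerD.
    by rewrite normrM ler_pM // ?gB ?grid01 ?xiu.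
  apply: le_trans (ler_norm_sum _ _ _) _.
  apply: (@le_trans _ _ (\sum_(k < N) L / N%:R * zeta)); last first.
    by rewrite sumr_const card_ord -[leLHS](mulr_natr (L / N%:R * zeta) N) (_ : _ * N%:R = L * zeta) //; field.
  apply: ler_sum => k _; rewrite normrM ler_pM //; last by rewrite xiu // ltn_ord.
  apply: le_trans (gL _ _ (grid01 N _ (ltn_ord k)) (grid01 N k (ltnW (ltn_ord k)))) _.
  rewrite gridS addrAC subrr add0r ger0_norm ?invr_ge0 //.
  by rewrite ler_wpM2l ?(lipschitz_ge0 g L gL) // lef_pV2 ?posrE ?ltr0n // ler_nat.
apply: le_trans (ler_norm_sum _ _ _) _.
apply: (@le_trans _ _ (\sum_(k < N) 2 * L / N%:R * (F k - F k.+1))).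
  by apply: ler_sum => k _; exact: (block_estimate g u B L N k pu N0 (ltn_ord k) gL gB).
rewrite -mulr_sumr -(big_mkord xpredT (fun k => F k - F k.+1)) (telescope_sumr_eq (fun k => - F k)) //.
  by rewrite F2 /F mul0r oppr0 sub0r opprK.
by move=> k _; rewrite opprK addrC.
Qed.

End Profiles.

(** * From window averages to closeness of the initial tail sums *)

Section Initial.
Context {R : realType}.
Local Notation mu := (@lebesgue_measure R).

Lemma Rintegral_cst_itv (a b k : R) : a <= b ->
  Rintegral mu `[a, b] (fun=> k) = k * (b - a).
Proof.
move=> ab; rewrite mulrBr.
refine (FTC2_Rintegral _ (fun z => k * z) a b ab _ _) => z _; last exact: cvg_cst.
exact: linear_derive.
Qed.

Lemma near_inv (c e : R) : 0 < e -> \forall N \near \oo, c / (N%:R : R) <= e.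
Proof.
move=> e0; exists (Num.truncn (`|c| / e)).+1 => // N /= hN.
have N0 : 0 < N%:R :> R by rewrite ltr0n; apply: leq_trans hN.
have ce : 0 <= `|c| / e by rewrite divr_ge0 // ltW.
have : `|c| / e < N%:R.
  by apply: lt_le_trans (_ : (Num.truncn (`|c| / e)).+1%:R <= _); [exact: truncnS_gt|rewrite ler_nat].
rewrite ltr_pdivrMr // ler_pdivrMr // => h.
by apply: le_trans (ler_norm c) _; rewrite ltW // mulrC.
Qed.

Lemma ell_gt0 N : (0 < N)%N -> (0 < ell R N)%N.
Proof.
move=> N0; rewrite /ell truncn_ge_nat ?powR_ge0 //.
have : N%:R `^ 0 <= N%:R `^ (9 / 10) :> R by apply: ler_powR; rewrite ?ler1n //; lra.
by rewrite powRr0.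
Qed.

(** The ratio is already of order N^(-1/10); the exponent is weakened to that of the window
    tolerance, so that one [eta] serves for both in [close_of_windows]. *)
Lemma ell_le N : (0 < N)%N -> (ell R N)%:R / N%:R <= (N%:R^-1 : R) `^ (1 / 20).
Proof.
move=> N0; have Np : 0 < N%:R :> R by rewrite ltr0n.
have Nn : N%:R != 0 :> R by rewrite gt_eqF.
have : (ell R N)%:R <= N%:R `^ (9 / 10) :> R by rewrite truncn_le powR_ge0.
rewrite ler_pdivrMr // => h; apply: le_trans h _.
have -> : N%:R^-1 = N%:R `^ (-1) :> R by rewrite powR_inv1.
have E : N%:R = N%:R `^ 1 :> R by rewrite powRr1.
rewrite -powRrM [X in _ <= _ * X]E -powRD ?Nn ?implybT //.
by apply: ler_powR; rewrite ?ler1n //; lra.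
Qed.

Lemma ell_leN N : (0 < N)%N -> (ell R N <= N)%N.
Proof.
move=> N0; have Np : 0 < N%:R :> R by rewrite ltr0n.
rewrite -(ler_nat R); apply: (@le_trans _ _ (N%:R `^ (9 / 10))).
  by rewrite truncn_le powR_ge0.
by apply: ler1_powR; rewrite ?ler1n //; lra.
Qed.

Lemma inv_powR_small (e : R) : 0 < e -> \forall N \near \oo, (N%:R^-1 : R) `^ (1 / 20) <= e.
Proof.
move=> e0; have h := near_inv 1 (e ^+ 20) (exprn_gt0 20 e0).
apply: filterS h => N; rewrite (div1r N%:R) => h.
have -> : e = (e ^+ 20) `^ (1 / 20).
  rewrite -powR_mulrn ?(ltW e0) // -powRrM (_ : _ * _ = 1) ?powRr1 ?(ltW e0) //.
  by field.
have r0 : 0 <= 1 / 20 :> R by lra.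
have n1 : (N%:R^-1 : R) \is Num.nneg by rewrite nnegrE invr_ge0.
have n2 : (e ^+ 20 : R) \is Num.nneg by rewrite nnegrE exprn_ge0 // ltW.
exact: (ge0_ler_powR r0 n1 n2 h).
Qed.

Lemma window_sum N (xi : config N) x l : (x + l <= N.+1)%N ->
  \sum_(x <= y < x + l) (cfg_at xi y)%:R = (Feps xi x)%:R - (Feps xi (x + l))%:R :> R.
Proof.
move=> xl; rewrite /Feps (big_cat_nat (leq_addr l x) xl) /= natrD addrK.
by rewrite natr_sum.
Qed.

(** One window to the left adds at most l/N times the window error to the tail error [D], so
    stepping leftwards costs at most (N + 1)/N eta <= 2 eta in total. From [y0] on, monotonicity of
    both tails takes over: they are small there, since the remaining length is at most [eta] and [u]
    is at most [M]. This part costs (1 + 2M) eta. *)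
Lemma close_of_windows N (xi : config N) (u : R -> R) (M eta : R) (l : nat) :
  (0 < N)%N -> (0 < l)%N -> (l <= N)%N -> 0 <= eta -> l%:R / N%:R <= eta ->
  profile u -> (forall z, 0 <= z <= 1 -> u z <= M) ->
  (forall x, (x + l <= N.+1)%N -> `|Aell R xi l x - Aell' N u l x| <= eta) ->
  close N u ((3 + 2 * M) * eta) xi.
Proof.
move=> N0 l0 lN eta0 leta pu uM win.
have Np : 0 < N%:R :> R by rewrite ltr0n.
have lp : 0 < l%:R :> R by rewrite ltr0n.
have Nn : N%:R != 0 :> R by rewrite gt_eqF.
have ln : l%:R != 0 :> R by rewrite gt_eqF.
have M0 : 0 <= M.
  by apply: le_trans (uM 0 _); [apply pu.2|]; rewrite lexx ler01.
pose D k := N%:R^-1 * (Feps xi k)%:R - Fmac (k%:R / N%:R) u.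
have lNp : 0 < l%:R / N%:R :> R by rewrite divr_gt0.
have D1 x : (x + l <= N.+1)%N -> `|D x| <= `|D (x + l)%N| + l%:R / N%:R * eta.
  move=> xl; rewrite -lerBlDl; apply: le_trans (lerB_dist _ _) _.
  rewrite (_ : D x - _ = l%:R / N%:R * (Aell R xi l x - Aell' N u l x)); last first.
    by rewrite /Aell /Aell' window_sum // /D; field; rewrite ?ln ?Nn.
  by rewrite normrM (gtr0_norm lNp) ler_wpM2l ?(ltW lNp) // win.
have DN : D N.+1 = 0.
  by rewrite /D Feps_big // mulr0 Fmac1 ?subrr // ler_pdivlMr // mul1r ler_nat.
(* Start of the last admissible window, which ends just past the final site, where both tails
   vanish. *)
pose y0 := (N.+1 - l)%N.
have y0l : (y0 + l = N.+1)%N by rewrite /y0 subnK // ltnW.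
have Dy0 : `|D y0| <= l%:R / N%:R * eta.
  by have := D1 y0; rewrite y0l leqnn DN normr0 add0r; apply.
have Fy0 : Fmac (y0%:R / N%:R) u <= M * eta.
  have y01 : (y0 <= N)%N by rewrite /y0 leq_subLR -add1n leq_add2r.
  have y0N : y0%:R / N%:R <= 1 :> R by rewrite ler_pdivrMr // mul1r ler_nat.
  have y0p : 0 <= y0%:R / N%:R :> R by rewrite divr_ge0.
  apply: (@le_trans _ _ (Rintegral mu `[y0%:R / N%:R, 1] (fun=> M))).
    apply: le_Rintegral => //.
    - by apply: integrable_subitv pu.1.
    - exact: integrable_cst_itv.
    - move=> z /=; rewrite in_itv /= => /andP[yz z1]; apply: uM; apply/andP; split; lra.
  rewrite Rintegral_cst_itv // ler_wpM2l //; apply: le_trans leta.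
  have lE : l%:R = N%:R + 1 - y0%:R :> R by rewrite natr1 -y0l natrD addrAC subrr add0r.
  rewrite lE -subr_ge0 (_ : _ - _ = N%:R^-1); last by field.
  by rewrite invr_ge0.
have Dlast y : (y0 <= y)%N -> `|D y| <= (1 + 2 * M) * eta.
  move=> y0y.
  have yp : 0 <= y0%:R / N%:R :> R by rewrite divr_ge0.
  have yy : y0%:R / N%:R <= y%:R / N%:R :> R by rewrite ler_pM2r ?invr_gt0 // ler_nat.
  have F1 := Fmac_anti u _ _ pu yp yy.
  have F0 := Fmac_ge0 u _ pu (le_trans yp yy).
  have E1 : N%:R^-1 * (Feps xi y)%:R <= N%:R^-1 * (Feps xi y0)%:R :> R.
    by rewrite ler_pM2l ?invr_gt0 // ler_nat Feps_anti.
  have E0 : 0 <= N%:R^-1 * (Feps xi y)%:R :> R by rewrite mulr_ge0 // invr_ge0.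
  have eta1 : l%:R / N%:R * eta <= eta.
    have l1 : l%:R / N%:R <= 1 :> R by rewrite ler_pdivrMr // mul1r ler_nat.
    by rewrite -[leRHS]mul1r ler_wpM2r.
  move: Dy0; rewrite /D ler_norml => /andP[h1 h2].
  by rewrite ler_norml; apply/andP; split; lra.
suff main n k : (N.+1 - k <= n)%N -> (k <= N.+1)%N ->
    `|D k| <= (N.+1 - k)%:R / N%:R * eta + (1 + 2 * M) * eta.
  move=> k kN; apply: le_trans (main _ k (leqnn _) (leqW kN)) _.
  rewrite -mulrDl ler_wpM2r //.
  have : (N.+1 - k)%:R / N%:R <= 2 :> R.
    rewrite ler_pdivrMr // -natrM ler_nat; clear - N0; lia.
  lra.
elim: n k => [|n IH] k kn kN.
  apply: le_trans (Dlast k _) _; first by clear - kn l0; rewrite /y0; lia.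
  by rewrite lerDr mulr_ge0 // divr_ge0.
have [y0k|ky0] := leqP y0 k.
  apply: le_trans (Dlast k y0k) _.
  by rewrite lerDr mulr_ge0 // divr_ge0.
have kl : (k + l <= N.+1)%N by rewrite -y0l leq_add2r ltnW.
apply: le_trans (D1 k kl) _.
have := IH (k + l)%N (ltac:(clear - kn l0 ky0 y0l kN; lia)) kl.
have -> : (N.+1 - k)%:R = (N.+1 - (k + l))%:R + l%:R :> R.
  by rewrite -natrD; congr (_%:R); clear - kl; lia.
rewrite mulrDl mulrDl; lra.
Qed.

End Initial.

Lemma rate_shift {R : realType} (x y p q e f : R) :
  x <= y + e -> y - p - q <= e + f -> x - p - q <= 2 * e + f.
Proof. by lra. Qed.

Lemma grid_arith {R : realType} (k k' n r : R) :
  k <= 1 -> k' * n < r + 1 -> 2 <= (k' - k) * n -> k * (n + 1) <= r + 2^-1.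
Proof. by rewrite mulrBl; lra. Qed.

Lemma final_arith {R : realType} (K I h eta q r x : R) :
  q <= eta / 2 -> r <= eta / 2 -> - (q + r) <= x - I -> K + I + h - eta <= K + x + h.
Proof. by lra. Qed.

Lemma initial_arith {R : realType} (K I h eta q r x d m m' c : R) :
  q <= eta / 2 -> r <= eta / 2 -> x - I <= q + r -> m <= m' ->
  K + x + h + (d + m) + c <= K + (I + eta) + h + (d + m') + c.
Proof. by lra. Qed.

(** * Passage to the macroscopic limit *)

Section MacroBound.
Context {R : realType} (j : R) (j0 : 0 < j) (xi : forall N : nat, config N).
Local Notation mu := (@lebesgue_measure R).
Implicit Types (s t z x : R).

(** Nonemptiness is a separate clause because [rightmost] is 0 on the empty configuration. *)
Definition occupied_near N (k : R) : set (config N) :=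
  [set eta | nonempty_cfg eta /\ (Num.truncn (k * N%:R) <= rightmost eta)%N].

(** A tail sum within [zeta] of a value larger than [zeta] cannot vanish. *)
Lemma close_occupied N (u : R -> R) (k zeta : R) (eta : config N) :
  (0 < N)%N -> profile u -> 0 <= k <= 1 -> zeta < Fmac k u -> close N u zeta eta ->
  occupied_near N k eta.
Proof.
move=> N0 pu /andP[k0 k1] zF cl; have Np : 0 < N%:R :> R by rewrite ltr0n.
set x := Num.truncn (k * N%:R).
have xk : x%:R <= k * N%:R by rewrite truncn_le mulr_ge0.
have xN : (x <= N)%N.
  by rewrite -(ler_nat R); apply: le_trans xk _; rewrite -[leRHS]mul1r ler_wpM2r.
have Fx : Fmac k u <= Fmac (x%:R / N%:R) u.
  by apply: Fmac_anti => //; rewrite ?divr_ge0 // ler_pdivrMr.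
have : 0 < N%:R^-1 * (Feps eta x)%:R :> R.
  by have := cl x xN; rewrite ler_norml => /andP[h _]; lra.
rewrite pmulr_rgt0 ?invr_gt0 // ltr0n /Feps.
have [|h] := boolP [exists z : 'I_N.+1, (x <= z)%N && (0 < eta z)%N]; last first.
  move: h => /existsPn h.
  suff -> : (\sum_(x <= y < N.+1) cfg_at eta y = 0)%N by [].
  rewrite big_nat_cond big1 // => y /andP[/andP[xy yN] _].
  have yN' : (y <= N)%N := yN.
  by have := h (inord y); rewrite /cfg_at yN' inordK // xy /= lt0n negbK => /eqP.
move=> /existsP[z /andP[xz z0]] _; split; first by apply/existsP; exists z.
by apply: leq_trans xz _; rewrite /rightmost; exact: (@leq_bigmax_cond _ [pred y : 'I_N.+1 | (0 < eta y)%N] (fun y => y : nat) z z0).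
Qed.

Lemma rightmost_le N (eta : config N) : (rightmost eta <= N)%N.
Proof. by apply/bigmax_leqP => z _; rewrite -ltnS. Qed.

Lemma occupied_cvg (u : R -> R) (k s : R) : 0 <= s -> profile u -> 0 <= k <= 1 -> 0 < Fmac k u ->
  (forall zeta, 0 < zeta ->
    (fun N : nat => trans_prob j (xi N) (N%:R ^+ 2 * s) (close N u zeta)) @ \oo --> (1 : R)) ->
  (fun N : nat => surv j N (xi N) (occupied_near N k) (N%:R ^+ 2 * s)) @ \oo --> (1 : R).
Proof.
move=> s0 pu k01 F0 h; have z0 : 0 < Fmac k u / 2 by rewrite divr_gt0.
have nr : \forall N \near \oo, trans_prob j (xi N) (N%:R ^+ 2 * s) (close N u (Fmac k u / 2)) <=
    surv j N (xi N) (occupied_near N k) (N%:R ^+ 2 * s) <= 1.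
  exists 1%N => // N /= N0.
  have Ns : 0 <= N%:R ^+ 2 * s by rewrite mulr_ge0 ?exprn_ge0.
  rewrite surv_le1 ?(ltW j0) // andbT.
  apply: le_trans (trans_prob_le_surv j N (ltW j0) _ _ _ Ns) _.
  apply: surv_mono => //; first exact: ltW.
  by move=> eta; apply: close_occupied => //; lra.
exact: (squeeze_cvgr nr (h _ z0) (cvg_cst _)).
Qed.

Lemma cvg_invn : (fun N : nat => N%:R^-1 : R) @ \oo --> (0 : R).
Proof.
apply/cvgr0Pnorm_le => e e0; apply: filterS (near_inv 1 e e0) => N.
by rewrite div1r ger0_norm ?invr_ge0.
Qed.

Lemma vacancy_integral_cvg (k t : R) : 0 <= t ->
  (forall s, 0 < s <= t ->
   (fun N : nat => surv j N (xi N) (occupied_near N k) (N%:R ^+ 2 * s)) @ \oo --> (1 : R)) ->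
  (fun N : nat => Rintegral mu `[0, t]
     (fun s => 1 - surv j N (xi N) (occupied_near N k) (N%:R ^+ 2 * s))) @ \oo --> (0 : R).
Proof.
move=> t0 h.
pose f N s : R := 1 - surv j N (xi N) (occupied_near N k) (N%:R ^+ 2 * s).
have fm N : measurable_fun (`[0, t] : set R) (f N).
  apply: measurable_funB => //; apply: surv_continuous_measurable; first exact: ltW.
  by rewrite exprn_ge0.
(* The hypothesis gives no convergence at s = 0, so the limit is taken on the half-open interval,
   which differs by a null set. *)
have sub : (`]0, t] : set R) `<=` `[0, t] by apply: subset_itv; rewrite bnd_simp.
have fm' N : measurable_fun (`]0, t] : set R) (f N) by apply: measurable_funS (fm N).
have f1 N s : 0 <= s -> `|f N s| <= 1.
  move=> s0; have Ns : 0 <= N%:R ^+ 2 * s by rewrite mulr_ge0 ?exprn_ge0.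
  rewrite /f ger0_norm ?subr_ge0 ?surv_le1 ?(ltW j0) //.
  by rewrite lerBlDr lerDl surv_ge0 // ltW.
have i1 : mu.-integrable `]0, t] (EFin \o (fun=> 1 : R)).
  by apply: (integrableS _ _ _ (integrable_cst_itv 0 t 1)) => //; exact: sub.
have [||_ lim] := dominated_Rintegral_cvg `]0, t] f (fun=> 0) (fun=> 1) (measurable_itv _) fm' _ i1.
- move=> s /=; rewrite in_itv /= => s0t; rewrite -(subrr (1 : R)).
  by apply: cvgB; [exact: cvg_cst|exact: h].
- by move=> N s /=; rewrite in_itv /= => /andP[s0 _]; apply: f1; exact: ltW.
have I0 : Rintegral mu `]0, t] (fun=> 0) = 0 by rewrite /Rintegral integral0.
have E N : Rintegral mu `]0, t] (f N) = Rintegral mu `[0, t] (f N).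
  apply: Rintegral_itv_obnd_cbnd.
  apply: le_integrable i1 => //; first by apply/measurable_EFinP; exact: fm'.
  move=> s /=; rewrite in_itv /= => /andP[s0 _]; rewrite lee_fin (ger0_norm ler01).
  by apply: f1; exact: ltW.
have EF : (fun N => Rintegral mu `]0, t] (f N)) = (fun N => Rintegral mu `[0, t] (f N)).
  by apply/funext; exact: E.
by rewrite I0 EF in lim; exact: lim.
Qed.

(* Here [s] is backward time: [a 0] is tested against the profile at time [t].
   The sharp rate bound is only required for particles removed in [k, 1]; the
   defect [C] elsewhere is either absent or irrelevant because [Fmac k' (u s) > 0]
   forces the rightmost particle beyond [k]. *)
Lemma macro_bound (u0 : R -> R) (u : R -> R -> R) (t k k' e d B L C2 W C : R)
    (a da a1 a2 : R -> R -> R) (H dH : R -> R) :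
  0 < t -> profile u0 ->
  (forall zeta, 0 < zeta -> \forall N \near \oo, close N u0 zeta (xi N)) ->
  (forall s, 0 < s <= t -> profile (u s)) ->
  (forall s zeta, 0 < s <= t -> 0 < zeta ->
    (fun N : nat => trans_prob j (xi N) (N%:R ^+ 2 * s) (close N (u s) zeta)) @ \oo --> (1 : R)) ->
  (forall s z, 0 <= s <= t -> 0 <= z <= 1 -> is_derive s 1 (a^~ z) (da s z)) ->
  (forall s z, 0 <= s <= t -> 0 <= z <= 1 -> is_derive z 1 (a s) (a1 s z)) ->
  (forall s z, 0 <= s <= t -> 0 <= z <= 1 -> is_derive z 1 (a1 s) (a2 s z)) ->
  (forall s, 0 <= s <= t -> a1 s 0 = 0) -> (forall s, 0 <= s <= t -> a1 s 1 = 0) ->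
  (forall s z, 0 <= s <= t -> 0 <= z <= 1 -> `|a s z| <= B) ->
  (forall s z, 0 <= s <= t -> 0 <= z <= 1 -> `|a1 s z| <= L) ->
  (forall s z, 0 <= s <= t -> 0 <= z <= 1 -> `|a2 s z| <= W) ->
  (forall s, 0 <= s <= t -> lipschitz01 (a2 s) C2) ->
  (forall s z, 0 <= s <= t -> 0 <= z <= 1 -> a2 s z / 2 - da s z <= e) ->
  (forall s, 0 <= s <= t -> is_derive s 1 H (dH s)) ->
  (forall s, 0 <= s <= t -> `|H s| <= B) ->
  0 <= C ->
  (forall s, 0 <= s <= t -> j * a s 0 - dH s <= e + C) ->
  (forall s z, 0 <= s <= t -> 0 <= z <= 1 -> j * (a s 0 - a s z) - dH s <= e + C) ->
  (forall s z, 0 <= s <= t -> k <= z <= 1 -> j * (a s 0 - a s z) - dH s <= e) ->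
  0 <= k -> k < k' -> k' <= 1 ->
  (C = 0 \/ forall s, 0 < s <= t -> 0 < Fmac k' (u s)) ->
  0 < e -> 0 < d -> 4 * e <= d * expR (- t) ->
  Rintegral mu `[0, 1] (fun z => a 0 z * u t z) + H 0 <=
  Rintegral mu `[0, 1] (fun z => a t z * u0 z) + H t + d * (1 + Fmac 0 u0 ^+ 2).
Proof.
move=> t0 pu0 cl0 pu trc ad azd a1d a10 a11 aB aL aW aC2 aheat Hd HB C0 bndE bndC bndk k0 kk' k'1 Cor e0 d0 ed.
have t0' : 0 <= t := ltW t0.
have tt : 0 <= t <= t by rewrite t0' lexx.
have ot : 0 <= (0 : R) <= t by rewrite lexx t0'.
have t0t : 0 < t <= t by rewrite t0 lexx.
set It := Rintegral mu `[0, 1] (fun z => a 0 z * u t z).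
set I0 := Rintegral mu `[0, 1] (fun z => a t z * u0 z).
have aLip s : 0 <= s <= t -> lipschitz01 (a s) L.
  by move=> s0t x y x01 y01; apply: (lipschitz_of_derive _ (a1 s)) => // z z01; [exact: azd|exact: aL].
have L0 : 0 <= L := lipschitz_ge0 _ _ (aLip t tt).
have B0 : 0 <= B by apply: le_trans (HB t tt).
have F00 : 0 <= Fmac 0 u0 by exact: Fmac_ge0.
(* Collects the slacks: one eta on each side of the comparison, and (F + eta)^2 <= F^2 + eta (2 F +
   1) for eta <= 1. *)
pose q := 2 + d * (2 * Fmac 0 u0 + 1).
have q0 : 0 < q.
  by rewrite /q ltr_pwDl // mulr_ge0 ?(ltW d0) // addr_ge0 // mulr_ge0.
suff main eta : 0 < eta -> eta <= 1 -> It + H 0 <= I0 + H t + d * (1 + Fmac 0 u0 ^+ 2) + eta * q.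
  apply/ler_addgt0Pr => r r0; pose m := Num.min 1 (r / q).
  have m0 : 0 < m by rewrite lt_min ltr01 divr_gt0.
  have m1 : m <= 1 by rewrite ge_min lexx.
  apply: le_trans (main m m0 m1) _; rewrite lerD2l.
  by rewrite -ler_pdivlMr // ge_min lexx orbT.
move=> eta0 eta1.
(* The first two summands are the constant required by [first_moment_bound]; the bracket makes [X]
   nonnegative. *)
pose K := B + B ^+ 2 * expR t / (4 * d) + (`|It| + B + 1).
pose X := K + It + H 0 - eta.
pose Y := K + (I0 + eta) + H t + d * (1 + (Fmac 0 u0 + eta) ^+ 2).
have KB : B + B ^+ 2 * expR t / (4 * d) <= K.
  by rewrite /K lerDl !addr_ge0.
have X0 : 0 <= X.
  have h1 : 0 <= B ^+ 2 * expR t / (4 * d).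
    by rewrite divr_ge0 ?mulr_ge0 ?sqr_ge0 ?expR_ge0 // ltW.
  have := ler_norm (- It); rewrite normrN => h2.
  have /ler_normlP[h3 _] := HB 0 ot.
  by rewrite /X /K; lra.
(* The first bound controls the initial mass, the second the term (B + L) zeta of [close_lin]. *)
pose zeta := Num.min eta (eta / (2 * (B + L + 1))).
have BL : 0 < B + L + 1 by lra.
have z0 : 0 < zeta by rewrite lt_min eta0 divr_gt0 // mulr_gt0.
have zeta1 : zeta <= eta by rewrite ge_min lexx.
have zetaBL : (B + L) * zeta <= eta / 2.
  apply: (@le_trans _ _ ((B + L + 1) * (eta / (2 * (B + L + 1))))).
    apply: ler_pM; [exact: addr_ge0|exact: ltW|by rewrite lerDl|by rewrite ge_min lexx orbT].
  by rewrite le_eqVlt; apply/orP; left; apply/eqP; field; rewrite gt_eqF.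
pose good N := occupied_near N k'.
pose I N := Rintegral mu `[0, t] (fun s => 1 - surv j N (xi N) (good N) (N%:R ^+ 2 * s)).
have CI : (fun N => C * I N) @ \oo --> (0 : R).
  case: Cor => [->|Fp].
    rewrite (_ : (fun N => 0 * I N) = fun=> 0); first exact: cvg_cst.
    by apply/funext => N; rewrite mul0r.
  rewrite -(mulr0 C); apply: cvgM; first exact: cvg_cst.
  apply: vacancy_integral_cvg => // s /[dup] s0t /andP[s0 _].
  apply: (occupied_cvg (u s)) => //; [exact: ltW|exact: pu| |exact: Fp|].
    by clear -k0 kk' k'1; apply/andP; split; lra.
  by move=> ze ze0; exact: trc.
have lhs : (fun N : nat => X * trans_prob j (xi N) (N%:R ^+ 2 * t) (close N (u t) zeta)) @ \oo --> X.
  rewrite -[X in _ --> X]mulr1; apply: cvgM; first exact: cvg_cst.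
  exact: trc.
have rhs : (fun N : nat => Y + 2 * j * d * t / N%:R + C * I N) @ \oo --> Y.
  rewrite -[X in _ --> X]addr0; apply: cvgD => //.
  rewrite -[X in _ --> X]addr0; apply: cvgD; first exact: cvg_cst.
  rewrite -[X in _ --> X](mulr0 (2 * j * d * t)); apply: cvgM; first exact: cvg_cst.
  exact: cvg_invn.
suff XY : X <= Y.
  have : (Fmac 0 u0 + eta) ^+ 2 <= Fmac 0 u0 ^+ 2 + eta * (2 * Fmac 0 u0 + 1) by nra.
  by move: XY; rewrite /X /Y /q; nra.
apply: (ler_cvg_to lhs rhs).
have n1 := near_inv (2 * L * Fmac 0 u0) (eta / 2) (divr_gt0 eta0 (ltr0n _ 2)).
have n2 := near_inv (2 * L * Fmac 0 (u t)) (eta / 2) (divr_gt0 eta0 (ltr0n _ 2)).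
have n3 := near_inv (2 * C2 + W) e e0.
have n4 := near_inv (j * L) e e0.
(* The floor in [occupied_near] and the offset of [grid] together cost at most 2/N, absorbed by the
   gap between [k] and [k']. *)
have n5 := near_inv 2 (k' - k) (ltac:(rewrite subr_gt0 //)).
near=> N.
have N0 : (0 < N)%N by near: N; exists 1%N.
have Np : 0 < N%:R :> R by rewrite ltr0n.
have Nt : 0 <= N%:R ^+ 2 * t by rewrite mulr_ge0 ?exprn_ge0.
have m1 : 2 * L * Fmac 0 u0 / N%:R <= eta / 2 by near: N; exact: n1.
have m2 : 2 * L * Fmac 0 (u t) / N%:R <= eta / 2 by near: N; exact: n2.
have m3 : (2 * C2 + W) / N%:R <= e by near: N; exact: n3.
have m4 : j * L / N%:R <= e by near: N; exact: n4.
have m5 : 2 / N%:R <= k' - k by near: N; exact: n5.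
have m6 : close N u0 zeta (xi N) by near: N; exact: cl0.
have invS : (N.+1)%:R^-1 <= N%:R^-1 :> R.
  by rewrite lef_pV2 ?posrE ?ltr0n // ler_nat.
have step1 : X * trans_prob j (xi N) (N%:R ^+ 2 * t) (close N (u t) zeta) <=
    X * surv j N (xi N) (close N (u t) zeta) (N%:R ^+ 2 * t).
  by rewrite ler_wpM2l // trans_prob_le_surv // ltW.
apply: le_trans step1 _.
(* The error passed on is [2 * e]: one [e] for discretising the Laplacian or the value at 0, one
   from the hypotheses on [a]. Hence [4 * e] against [d * expR (- t)]. *)
have step2 := @first_moment_bound R j N (ltW j0) N0 (fun s i => a s (grid N i))
  (fun s i => da s (grid N i)) H dH (close N (u t) zeta) (good N) B (2 * e) d K X C t (xi N).
apply: le_trans (step2 _ _ _ _ _ _ _ _ _ _ _ _ _ _) _ => //.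
- by clear -ed; lra.
- by clear -e0; lra.
- by move=> s i s0t iN; apply: ad => //; exact: grid01.
- by move=> s i s0t iN; apply: aB => //; exact: grid01.
- move=> s i s0t iN.
  have := lap_consistency N (a s) (a1 s) (a2 s) C2 W i N0 iN (azd s ^~ s0t) (a1d s ^~ s0t)
    (aC2 s s0t) (aW s ^~ s0t) (a10 s s0t) (a11 s s0t).
  rewrite ler_norml => /andP[_ h1].
  have h2 := aheat s _ s0t (grid01 N i iN).
  have CW : 0 <= 2 * C2 + W.
    rewrite addr_ge0 ?mulr_ge0 ?(lipschitz_ge0 _ _ (aC2 s s0t)) //.
    exact: le_trans (aW s _ s0t (grid01 N i iN)).
  have h3 : (2 * C2 + W) / N.+1%:R <= e by apply: le_trans m3; rewrite ler_wpM2l.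
  have h4 := lerD h1 h2; rewrite addrA subrK in h4; apply: le_trans h4 _.
  by apply: le_trans (lerD h3 (lexx e)) _; rewrite [leRHS]mulr_natl.
- move=> s z s0t.
  have g0 := @grid01 R N 0 (leq0n N).
  have h1 : j * `|a s (grid N 0) - a s 0| <= e.
    have z01 : 0 <= (0 : R) <= 1 by rewrite lexx ler01.
    have hL := aLip s s0t (grid N 0) 0 g0 z01.
    apply: le_trans m4; rewrite -(mulrA j L) ler_pM2l //; apply: le_trans hL _.
    rewrite ler_wpM2l // subr0 /grid add0r ger0_norm ?mulr_ge0 ?invr_ge0 //.
    apply: le_trans invS; by rewrite -[leRHS]mul1r ler_wpM2r ?invr_ge0 // invf_le1 // ler1n.
  have h2 : j * a s (grid N 0) <= j * a s 0 + e.
    rewrite -lerBlDl -mulrBr; apply: le_trans h1; rewrite ler_pM2l //; exact: ler_norm.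
  rewrite indicE; have [/set_mem[ne Rz]|_] := boolP (z \in good N).
    rewrite ne mulr1n subrr mulr0 addr0 mulrBr.
    have Rg := @grid01 R N _ (rightmost_le N z).
    have kR : k <= grid N (rightmost z).
      have Rk : k' * N%:R < (rightmost z)%:R + 1.
        apply: lt_le_trans (truncnS_gt _) _; rewrite -natr1 lerD2r ler_nat; exact: Rz.
      rewrite /grid ler_pdivlMr ?ltr0n // -natr1.
      have m5' : 2 <= (k' - k) * N%:R by rewrite -ler_pdivrMr.
      exact: (grid_arith k k' N%:R _ (ltW (lt_le_trans kk' k'1)) Rk m5').
    have := bndk s (grid N (rightmost z)) s0t; rewrite kR; case/andP: (Rg) => _ -> /(_ isT).
    rewrite mulrBr -[X in _ <= X -> _]addr0 -[X in _ -> _ <= X]addr0; exact: rate_shift.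
  rewrite mulr0n subr0 mulr1 mulrBr; case: ifP => _.
    have := bndC s _ s0t (grid01 N _ (rightmost_le N z)); rewrite mulrBr; exact: rate_shift.
  by have := bndE s s0t; rewrite mulr0 -[j * a s 0]subr0; exact: rate_shift.
- move=> z cz; have := close_lin N (u t) (a 0) z B L zeta N0 (pu t t0t) cz (aLip 0 ot) (aB 0 ^~ ot).
  rewrite -/It ler_norml => /andP[h _].
  rewrite /X; move: m2; rewrite mulrAC => m2; exact: final_arith zetaBL m2 h.
have h1 := close_lin N u0 (a t) (xi N) B L zeta N0 pu0 m6 (aLip t tt) (aB t ^~ tt).
move: h1; rewrite -/I0 ler_norml => /andP[_ h1].
have h2 : scaled_mass N (xi N) ^+ 2 <= (Fmac 0 u0 + eta) ^+ 2.
  rewrite lerXn2r ?nnegrE ?scaled_mass_ge0 ?addr_ge0 ?(ltW eta0) //.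
  have := m6 0%N (leq0n N); rewrite ler_norml mul0r => /andP[_ h].
  by rewrite /scaled_mass massFeps mulrC -lerBlDl; exact: le_trans h zeta1.
have h3 : d * scaled_mass N (xi N) ^+ 2 <= d * (Fmac 0 u0 + eta) ^+ 2 by rewrite ler_pM2l.
rewrite -/(I N) /Y mulrDr (mulrDr d) lerD2r mulr1 (mulrAC (2 * j * d)).
move: m1 h1; rewrite (mulrAC (2 * L)) => m1 h1; exact: initial_arith zetaBL m1 h1 h3.
Unshelve. all: by end_near.
Qed.

End MacroBound.

(** * Neumann heat kernel *)

Section Gaussian.
Context {R : realType}.
Implicit Types (s x y z : R).

Lemma drv_inv (f : R -> R) (df x : R) : f x != 0 -> is_derive x 1 f df ->
  is_derive x 1 (fun y => (f y)^-1) (- df / f x ^+ 2).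
Proof.
move=> fx hf; apply: (is_derive_eq (is_deriveV fx hf)).
by rewrite /GRing.scale /= mulrC mulrN mulNr.
Qed.

Definition gauss1 s x : R := - (x / s) * gauss s x.
Definition gauss2 s x : R := (x ^+ 2 / s ^+ 2 - s^-1) * gauss s x.
Definition gauss3 s x : R := (- (x ^+ 3 / s ^+ 3) + 3 * x / s ^+ 2) * gauss s x.

Lemma drv_sqr x : is_derive x 1 (fun y : R => y ^+ 2) (2 * x).
Proof.
by apply: (is_derive_eq (drv_mul _ _ _ _ _ (drv_id x) (drv_id x))); ring.
Qed.

Lemma gauss_ge0 s x : 0 <= gauss s x.
Proof. by rewrite divr_ge0 ?expR_ge0 ?sqrtr_ge0. Qed.

Lemma gauss_even s x : gauss s (- x) = gauss s x.
Proof. by rewrite /gauss sqrrN. Qed.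

Lemma gauss_dx s x : 0 < s -> is_derive x 1 (gauss s) (gauss1 s x).
Proof.
move=> s0.
have h := drv_mul _ _ _ _ _ (drv_exp _ _ _ (drv_mul _ _ _ _ _ (drv_opp _ _ _ (drv_sqr x)) (drv_cst (2 * s)^-1 x)))
  (drv_cst (Num.sqrt (2 * pi * s))^-1 x).
apply: (is_derive_eq h); rewrite /gauss1 /gauss.
set E := expR _; set Q := (Num.sqrt _)^-1; field.
by rewrite gt_eqF.
Qed.

Lemma gauss1_dx s x : 0 < s -> is_derive x 1 (gauss1 s) (gauss2 s x).
Proof.
move=> s0.
have h := drv_mul _ _ _ _ _ (drv_opp _ _ _ (drv_mul _ _ _ _ _ (drv_id x) (drv_cst s^-1 x)))
  (gauss_dx s x s0).
apply: (is_derive_eq h); rewrite /gauss2 /gauss1; field.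
by rewrite gt_eqF.
Qed.

Lemma gauss2_dx s x : 0 < s -> is_derive x 1 (gauss2 s) (gauss3 s x).
Proof.
move=> s0.
have h := drv_mul _ _ _ _ _ (drv_sub _ _ _ _ _ (drv_mul _ _ _ _ _ (drv_sqr x) (drv_cst (s ^+ 2)^-1 x))
   (drv_cst s^-1 x)) (gauss_dx s x s0).
apply: (is_derive_eq h); rewrite /gauss3 /gauss2 /gauss1; field.
by rewrite gt_eqF.
Qed.

(** The heat equation with half the Laplacian, matching hops at rate 1/2. *)
Lemma gauss_ds s x : 0 < s -> is_derive s 1 (fun s => gauss s x) (gauss2 s x / 2).
Proof.
move=> s0.
have ps : 0 < 2 * pi * s by rewrite mulr_gt0 // mulr_gt0 // pi_gt0.
have q0 : Num.sqrt (2 * pi * s) != 0 by rewrite gt_eqF // sqrtr_gt0.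
have s20 : 2 * s != 0 by rewrite gt_eqF // mulr_gt0.
have hl k : is_derive s 1 (fun s : R => k * s) k.
  by apply: (is_derive_eq (drv_scale k _ _ _ (drv_id s))); rewrite mulr1.
have hq := drv_inv (fun s => Num.sqrt (2 * pi * s)) _ s q0 (drv_comp _ _ _ _ _ (hl (2 * pi)) (is_derive1_sqrt ps)).
have he := drv_exp _ _ _ (drv_mul _ _ _ _ _ (drv_cst (- (x ^+ 2)) s) (drv_inv (fun s => 2 * s) _ s s20 (hl 2))).
apply: (is_derive_eq (drv_mul _ _ _ _ _ he hq)); rewrite /gauss2 /gauss.
set E := expR _; set Q := Num.sqrt (2 * pi * s).
have QE : 2 * pi * s = Q ^+ 2 by rewrite sqr_sqrtr // ltW.
have -> : 2 * pi = Q ^+ 2 / s by rewrite -QE mulfK // gt_eqF.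
field.
by rewrite q0 gt_eqF.
Qed.

Lemma gauss1_ds s x : 0 < s -> is_derive s 1 (fun s => gauss1 s x) (gauss3 s x / 2).
Proof.
move=> s0; have sn : s != 0 by rewrite gt_eqF.
have h := drv_mul _ _ _ _ _ (drv_opp _ _ _ (drv_mul _ _ _ _ _ (drv_cst x s) (drv_inv (fun s => s) _ s sn (drv_id s))))
  (gauss_ds s x s0).
apply: (is_derive_eq h); rewrite /gauss3 /gauss2; field.
by rewrite gt_eqF.
Qed.

(** The maximum of [gauss s], attained at 0. *)
Definition peak s : R := (Num.sqrt (2 * pi * s))^-1.

Lemma peak_gt0 s : 0 < s -> 0 < peak s.
Proof. by move=> s0; rewrite invr_gt0 sqrtr_gt0 mulr_gt0 // mulr_gt0 // pi_gt0. Qed.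

Lemma peak_anti s s' : 0 < s -> s <= s' -> peak s' <= peak s.
Proof.
move=> s0 ss; have p0 : 0 < 2 * pi :> R by rewrite mulr_gt0 // pi_gt0.
rewrite lef_pV2 ?posrE ?sqrtr_gt0 ?mulr_gt0 ?pi_gt0 //; last exact: lt_le_trans ss.
by rewrite ler_sqrt ?ler_pM2l // mulr_ge0 ?(ltW p0) // (le_trans (ltW s0)).
Qed.

Lemma gauss_le_peak s x : 0 < s -> gauss s x <= peak s.
Proof.
move=> s0; rewrite /gauss -[leRHS]mul1r ler_wpM2r ?(ltW (peak_gt0 s s0)) //.
by rewrite -expR0 ler_expR mulNr oppr_le0 divr_ge0 ?sqr_ge0 // mulr_ge0 // ltW.
Qed.

Lemma expRN_le_inv y : 0 < y -> expR (- y) <= y^-1.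
Proof.
move=> y0; rewrite expRN lef_pV2 ?posrE ?expR_gt0 //.
by apply: le_trans (expR_ge1Dx y); rewrite lerDr.
Qed.

(** The crude bound exp(-y) <= 1/y is enough: an inverse square is summable over the images, and s
    times [peak s] vanishes with s. *)
Lemma gauss_tail s x y : 0 < s -> 0 < y -> y <= `|x| -> gauss s x <= peak s * (2 * s / y ^+ 2).
Proof.
move=> s0 y0 yx; rewrite /gauss mulrC ler_wpM2l ?(ltW (peak_gt0 s s0)) //.
have y20 : 0 < y ^+ 2 / (2 * s) by rewrite divr_gt0 ?exprn_gt0 // mulr_gt0.
apply: (@le_trans _ _ (expR (- (y ^+ 2 / (2 * s))))).
  rewrite ler_expR mulNr lerN2 ler_pM2r ?invr_gt0 ?mulr_gt0 //.
  by rewrite -[leRHS](real_normK (num_real x)) lerXn2r ?nnegrE // ltW.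
by apply: le_trans (expRN_le_inv _ y20) _; rewrite invf_div.
Qed.

End Gaussian.

(** * Truncated image sums and the corrected test functions *)

Section Images.
Context {R : realType}.
Implicit Types (r s z y : R).

Definition image_term (f : R -> R -> R) (e : R) r s z (m : int) : R :=
  e * f s (r - (z + 2 * m%:~R)) + f s (r - (2 * m%:~R - z)).

(* [e] is the sign produced by differentiating the first family of images, whose
   argument decreases in [z]. *)
Definition images (f : R -> R -> R) (e : R) (M : nat) r s z : R :=
  image_term f e r s z 0 +
  \sum_(i < M) (image_term f e r s z (Posz i.+1) + image_term f e r s z (Negz i)).

Lemma image_term_dz (f df : R -> R -> R) (e : R) r s z m :
  (forall y, is_derive y 1 (f s) (df s y)) ->
  is_derive z 1 (fun z => image_term f e r s z m) (image_term df (- e) r s z m).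
Proof.
move=> fd; pose c : R := 2 * m%:~R.
have h1 : is_derive z 1 (fun z => r - (z + c)) (-1).
  by apply: (is_derive_eq (drv_sub _ _ _ _ _ (drv_cst r z) (drv_add _ _ _ _ _ (drv_id z) (drv_cst c z)))); ring.
have h2 : is_derive z 1 (fun z => r - (c - z)) 1.
  by apply: (is_derive_eq (drv_sub _ _ _ _ _ (drv_cst r z) (drv_sub _ _ _ _ _ (drv_cst c z) (drv_id z)))); ring.
apply: (is_derive_eq (drv_add _ _ _ _ _ (drv_scale e _ _ _ (drv_comp _ _ _ _ _ h1 (fd _))) (drv_comp _ _ _ _ _ h2 (fd _)))).
by rewrite /image_term -/c; ring.
Qed.

Lemma image_term_ds (f df : R -> R -> R) (e : R) r s z m :
  (forall y, is_derive s 1 (f^~ y) (df s y)) ->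
  is_derive s 1 (fun s => image_term f e r s z m) (image_term df e r s z m).
Proof. by move=> fd; exact: (drv_add _ _ _ _ _ (drv_scale e _ _ _ (fd _)) (fd _)). Qed.

Lemma images_dz (f df : R -> R -> R) (e : R) M r s z :
  (forall y, is_derive y 1 (f s) (df s y)) ->
  is_derive z 1 (fun z => images f e M r s z) (images df (- e) M r s z).
Proof.
move=> fd; apply: (drv_add _ _ _ _ _ (image_term_dz f df e r s z 0 fd)).
by apply: drv_sum => i; exact: (drv_add _ _ _ _ _ (image_term_dz f df e r s z _ fd) (image_term_dz f df e r s z _ fd)).
Qed.

Lemma images_ds (f df : R -> R -> R) (e : R) M r s z :
  (forall y, is_derive s 1 (f^~ y) (df s y)) ->
  is_derive s 1 (fun s => images f e M r s z) (images df e M r s z).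
Proof.
move=> fd; apply: (drv_add _ _ _ _ _ (image_term_ds f df e r s z 0 fd)).
by apply: drv_sum => i; exact: (drv_add _ _ _ _ _ (image_term_ds f df e r s z _ fd) (image_term_ds f df e r s z _ fd)).
Qed.

Lemma imagesS f (e : R) M r s z : images f e M.+1 r s z =
  images f e M r s z + (image_term f e r s z (Posz M.+1) + image_term f e r s z (Negz M)).
Proof. by rewrite /images big_ord_recr /= addrA. Qed.

Lemma images_half (f : R -> R -> R) (e : R) M r s z :
  images (fun s y => f s y / 2) e M r s z = images f e M r s z / 2.
Proof.
have th m : image_term (fun s y => f s y / 2) e r s z m = image_term f e r s z m / 2.
  by rewrite /image_term; field.
rewrite /images th [in RHS]mulrDl mulr_suml; congr (_ + _); apply: eq_bigr => i _.
by rewrite !th [in RHS]mulrDl.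
Qed.

Lemma NegzR (M : nat) : (Negz M)%:~R = - (M%:R + 1) :> R.
Proof. by rewrite NegzE mulrNz -pmulrn natr1. Qed.

Lemma PoszR (M : nat) : (Posz M.+1)%:~R = M%:R + 1 :> R.
Proof. by rewrite -pmulrn natr1. Qed.

Lemma images1_at0 f M r s : images f (-1) M r s 0 = 0.
Proof.
have t0 m : image_term f (-1) r s 0 m = 0.
  by rewrite /image_term add0r subr0 mulN1r addNr.
by rewrite /images t0 add0r big1 // => i _; rewrite !t0 addr0.
Qed.

Definition flux f M r s : R := f s (r + 1 + 2 * M%:R) - f s (r - 1 - 2 * M%:R) : R.

(** At z = 1 images that mirror each other about 1 cancel in pairs. The truncation is symmetric
    about 0 but not about 1, so the two outermost terms survive. *)
Lemma images1_at1 f M r s : images f (-1) M r s 1 = flux f M r s.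
Proof.
elim: M => [|M IH].
  rewrite /images big_ord0 addr0 /image_term /flux !mulr0z !mulr0 !(addr0, subr0) sub0r opprK.
  by ring.
have E : M.+1%:R = M%:R + 1 :> R by rewrite natr1.
rewrite imagesS IH /flux /image_term PoszR NegzR E.
rewrite (_ : r - (1 + 2 * (M%:R + 1)) = r - 1 - 2 * (M%:R + 1)); last by ring.
rewrite (_ : r - (2 * (M%:R + 1) - 1) = r - 1 - 2 * M%:R); last by ring.
rewrite (_ : r - (1 + 2 * - (M%:R + 1)) = r + 1 + 2 * M%:R); last by ring.
rewrite (_ : r - (2 * - (M%:R + 1) - 1) = r + 1 + 2 * (M%:R + 1)); last by ring.
ring.
Qed.

Definition img M r s z := images (@gauss R) 1 M r s z.
Definition img1 M r s z := images (@gauss1 R) (-1) M r s z.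
Definition img2 M r s z := images (@gauss2 R) 1 M r s z.
Definition img3 M r s z := images (@gauss3 R) (-1) M r s z.
Definition kap M r s := flux (@gauss1 R) M r s.
Definition dkap M r s := flux (@gauss3 R) M r s / 2.

(* The truncated image sum violates the Neumann condition at 1 by [kap]; the
   quadratic correction restores it at the price of a small source term. *)
Definition tst M r s z := img M r s z - kap M r s * (z ^+ 2 / 2).
Definition tst1 M r s z := img1 M r s z - kap M r s * z.
Definition tst2 M r s z := img2 M r s z - kap M r s.
Definition dtst M r s z := img2 M r s z / 2 - dkap M r s * (z ^+ 2 / 2).

Lemma img_ds M r s z : 0 < s -> is_derive s 1 (fun s => img M r s z) (img2 M r s z / 2).
Proof.
move=> s0; rewrite -images_half.
by apply: images_ds => y; exact: gauss_ds.
Qed.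

Lemma tst_ds M r s z : 0 < s -> is_derive s 1 (fun s => tst M r s z) (dtst M r s z).
Proof.
move=> s0; apply: drv_sub; first exact: img_ds.
have hk : is_derive s 1 (kap M r) (dkap M r s).
  have h := drv_sub _ _ _ _ _ (gauss1_ds s (r + 1 + 2 * M%:R) s0) (gauss1_ds s (r - 1 - 2 * M%:R) s0).
  by apply: (is_derive_eq h); rewrite /dkap /flux mulrBl.
by apply: (is_derive_eq (drv_mul _ _ _ _ _ hk (drv_cst (z ^+ 2 / 2) s))); ring.
Qed.

Lemma tst_dz M r s z : 0 < s -> is_derive z 1 (tst M r s) (tst1 M r s z).
Proof.
move=> s0; have h1 : is_derive z 1 (img M r s) (img1 M r s z).
  by apply: images_dz => y; exact: gauss_dx.
apply: (is_derive_eq (drv_sub _ _ _ _ _ h1 (drv_scale (kap M r s) _ _ _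
  (drv_mul _ _ _ _ _ (drv_sqr z) (drv_cst 2^-1 z))))).
by rewrite /tst1; field.
Qed.

Lemma tst1_dz M r s z : 0 < s -> is_derive z 1 (tst1 M r s) (tst2 M r s z).
Proof.
move=> s0; have h1 : is_derive z 1 (img1 M r s) (img2 M r s z).
  have h := images_dz (@gauss1 R) (@gauss2 R) (-1) M r s z (fun y => gauss1_dx s y s0).
  by apply: (is_derive_eq h); rewrite opprK.
apply: (is_derive_eq (drv_sub _ _ _ _ _ h1 (drv_scale (kap M r s) _ _ _ (drv_id z)))).
by rewrite /tst2 mulr1.
Qed.

Lemma tst2_dz M r s z : 0 < s -> is_derive z 1 (tst2 M r s) (img3 M r s z).
Proof.
move=> s0; have h1 : is_derive z 1 (img2 M r s) (img3 M r s z).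
  by apply: images_dz => y; exact: gauss2_dx.
apply: (is_derive_eq (drv_sub _ _ _ _ _ h1 (drv_cst (kap M r s) z))).
by rewrite subr0.
Qed.

Lemma tst1_at0 M r s : tst1 M r s 0 = 0.
Proof. by rewrite /tst1 /img1 images1_at0 mulr0 subr0. Qed.

Lemma tst1_at1 M r s : tst1 M r s 1 = 0.
Proof. by rewrite /tst1 /img1 images1_at1 mulr1 subrr. Qed.

(** Only the existence of bounds away from time 0 matters; stability under sums and products spares
    their computation. *)
Definition bounded_on (a b : R) (f : R -> R -> R) :=
  exists2 C : R, 0 <= C & forall s z, a <= s <= b -> 0 <= z <= 1 -> `|f s z| <= C.

Lemma bounded_cst a b (k : R) : bounded_on a b (fun _ _ => k).
Proof. by exists `|k|. Qed.

Lemma bounded_add a b f g : bounded_on a b f -> bounded_on a b g ->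
  bounded_on a b (fun s z => f s z + g s z).
Proof.
move=> [C C0 fC] [D D0 gD]; exists (C + D); first exact: addr_ge0.
by move=> s z h1 h2; apply: le_trans (ler_normD _ _) _; rewrite lerD ?fC ?gD.
Qed.

Lemma bounded_mul a b f g : bounded_on a b f -> bounded_on a b g ->
  bounded_on a b (fun s z => f s z * g s z).
Proof.
move=> [C C0 fC] [D D0 gD]; exists (C * D); first exact: mulr_ge0.
by move=> s z h1 h2; rewrite normrM ler_pM ?fC ?gD.
Qed.

Lemma bounded_sum a b n (f : 'I_n -> R -> R -> R) : (forall i, bounded_on a b (f i)) ->
  bounded_on a b (fun s z => \sum_(i < n) f i s z).
Proof.
move=> h; have [C PC] := choice (fun i => (let: ex_intro2 C C0 fC := h i in ex_intro _ C (conj C0 fC)) :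
   exists C : R, 0 <= C /\ forall s z, a <= s <= b -> 0 <= z <= 1 -> `|f i s z| <= C).
exists (\sum_(i < n) C i); first by apply: sumr_ge0 => i _; exact: (PC i).1.
move=> s z h1 h2; apply: le_trans (ler_norm_sum _ _ _) _.
by apply: ler_sum => i _; exact: (PC i).2.
Qed.

Lemma bounded_z a b : bounded_on a b (fun _ z => z).
Proof. by exists 1 => // s z _ /andP[z0 z1]; rewrite ger0_norm. Qed.

Lemma bounded_inv (a b : R) : 0 < a -> bounded_on a b (fun s _ => s^-1).
Proof.
move=> a0; exists a^-1; first by rewrite invr_ge0 ltW.
move=> s z /andP[as_ sb] _; have s0 := lt_le_trans a0 as_.
by rewrite ger0_norm ?invr_ge0 ?(ltW s0) // lef_pV2.
Qed.

Lemma bounded_gauss (a b : R) (x : R -> R) : 0 < a -> bounded_on a b (fun s z => gauss s (x z)).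
Proof.
move=> a0; exists (peak a); first exact/ltW/peak_gt0.
move=> s z /andP[as_ sb] _; have s0 := lt_le_trans a0 as_.
by rewrite ger0_norm ?gauss_ge0 // (le_trans (gauss_le_peak s _ s0)) // peak_anti.
Qed.

Lemma bounded_images (a b e : R) f M r :
  (forall x : R -> R, bounded_on a b (fun _ => x) -> bounded_on a b (fun s z => f s (x z))) ->
  bounded_on a b (fun s z => images f e M r s z).
Proof.
move=> h.
have bt m : bounded_on a b (fun s z => image_term f e r s z m).
  apply: bounded_add; first apply: bounded_mul; first exact: bounded_cst.
    apply: (h (fun z => r - (z + 2 * m%:~R))).
    have [C C0 hC] := bounded_add _ _ _ _ (bounded_cst a b (r - 2 * m%:~R)) (bounded_mul _ _ _ _ (bounded_cst a b (-1)) (bounded_z a b)).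
    exists C => // s z h1 h2; have := hC s z h1 h2; congr (`|_| <= _); ring.
  apply: (h (fun z => r - (2 * m%:~R - z))).
  have [C C0 hC] := bounded_add _ _ _ _ (bounded_cst a b (r - 2 * m%:~R)) (bounded_z a b).
  exists C => // s z h1 h2; have := hC s z h1 h2; congr (`|_| <= _); ring.
apply: bounded_add => //; apply: bounded_sum => i; exact: bounded_add.
Qed.

Lemma bounded_ext a b f g : (forall s z, f s z = g s z) -> bounded_on a b f -> bounded_on a b g.
Proof. by move=> fg [C C0 fC]; exists C => // s z h1 h2; rewrite -fg fC. Qed.

Section bounds.
Variables (a b : R) (a0 : 0 < a).

Lemma bounded_g1 (x : R -> R) : bounded_on a b (fun _ => x) ->
  bounded_on a b (fun s z => gauss1 s (x z)).
Proof.
move=> bx; have bg := bounded_gauss a b x a0; have bi := bounded_inv a b a0.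
apply: bounded_ext (bounded_mul _ _ _ _ (bounded_cst a b (-1)) (bounded_mul _ _ _ _ (bounded_mul _ _ _ _ bx bi) bg)) => s z.
by rewrite /gauss1; ring.
Qed.

Lemma bounded_g2 (x : R -> R) : bounded_on a b (fun _ => x) ->
  bounded_on a b (fun s z => gauss2 s (x z)).
Proof.
move=> bx; have bg := bounded_gauss a b x a0; have bi := bounded_inv a b a0.
have bxi := bounded_mul _ _ _ _ bx bi.
apply: bounded_ext (bounded_mul _ _ _ _ (bounded_add _ _ _ _ (bounded_mul _ _ _ _ bxi bxi)
  (bounded_mul _ _ _ _ (bounded_cst a b (-1)) bi)) bg) => s z.
by rewrite /gauss2 -exprVn; ring.
Qed.

Lemma bounded_g3 (x : R -> R) : bounded_on a b (fun _ => x) ->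
  bounded_on a b (fun s z => gauss3 s (x z)).
Proof.
move=> bx; have bg := bounded_gauss a b x a0; have bi := bounded_inv a b a0.
have bxi := bounded_mul _ _ _ _ bx bi.
apply: bounded_ext (bounded_mul _ _ _ _ (bounded_add _ _ _ _
  (bounded_mul _ _ _ _ (bounded_cst a b (-1)) (bounded_mul _ _ _ _ bxi (bounded_mul _ _ _ _ bxi bxi)))
  (bounded_mul _ _ _ _ (bounded_cst a b 3) (bounded_mul _ _ _ _ bxi bi))) bg) => s z.
by rewrite /gauss3 -!exprVn; ring.
Qed.

Lemma bounded_kap M r : bounded_on a b (fun s _ => kap M r s).
Proof.
have b1 := bounded_g1 _ (bounded_cst a b (r + 1 + 2 * M%:R)).
have b2 := bounded_g1 _ (bounded_cst a b (r - 1 - 2 * M%:R)).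
apply: bounded_ext (bounded_add _ _ _ _ b1 (bounded_mul _ _ _ _ (bounded_cst a b (-1)) b2)) => s z.
by rewrite /kap /flux mulN1r.
Qed.

Lemma bounded_tst M r : bounded_on a b (tst M r).
Proof.
apply: (bounded_ext _ _ (fun s z => img M r s z + kap M r s * (- 2^-1 * (z * z)))).
  by move=> s z; rewrite /tst; ring.
apply: bounded_add; first by apply: bounded_images => x _; exact: bounded_gauss.
apply: bounded_mul; first exact: bounded_kap.
apply: bounded_mul; first exact: bounded_cst.
by apply: bounded_mul; exact: bounded_z.
Qed.

Lemma bounded_tst1 M r : bounded_on a b (tst1 M r).
Proof.
apply: (bounded_ext _ _ (fun s z => img1 M r s z + kap M r s * (-1 * z))).
  by move=> s z; rewrite /tst1; ring.
apply: bounded_add; first by apply: bounded_images; exact: bounded_g1.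
apply: bounded_mul; first exact: bounded_kap.
by apply: bounded_mul; [exact: bounded_cst|exact: bounded_z].
Qed.

Lemma bounded_tst2 M r : bounded_on a b (tst2 M r).
Proof.
apply: (bounded_ext _ _ (fun s z => img2 M r s z + -1 * kap M r s)).
  by move=> s z; rewrite /tst2; ring.
apply: bounded_add; first by apply: bounded_images; exact: bounded_g2.
by apply: bounded_mul; [exact: bounded_cst|exact: bounded_kap].
Qed.

Lemma bounded_img3 M r : bounded_on a b (img3 M r).
Proof. by apply: bounded_images; exact: bounded_g3. Qed.

End bounds.

Lemma gauss1_small s y (M : nat) : 0 < s -> (0 < M)%N -> 2 * M%:R <= `|y| -> `|gauss1 s y| <= peak s / M%:R.
Proof.
move=> s0 M0 My; have Mp : 0 < M%:R :> R by rewrite ltr0n.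
have y0 : 0 < `|y| by apply: lt_le_trans My; rewrite mulr_gt0.
have h := gauss_tail s y `|y| s0 y0 (lexx _).
rewrite /gauss1 normrM normrN normrM normfV (gtr0_norm s0) (ger0_norm (gauss_ge0 s y)).
have sy : 0 <= `|y| / s by rewrite divr_ge0 // ltW.
apply: le_trans (ler_wpM2l sy h) _.
rewrite (_ : `|y| / s * (peak s * (2 * s / `|y| ^+ 2)) = peak s * (2 / `|y|)); last first.
  by field; rewrite !gt_eqF.
rewrite ler_wpM2l ?(ltW (peak_gt0 s s0)) // ler_pdivrMr // mulrC ler_pdivlMr //.
Qed.

(** The cubic and linear prefactors contribute 16 and 6, and 22/|y| <= 11/M. *)
Lemma gauss3_small s y (M : nat) : 0 < s -> (0 < M)%N -> 2 * M%:R <= `|y| ->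
  `|gauss3 s y| <= 11 * peak s / s / M%:R.
Proof.
move=> s0 M0 My; have Mp : 0 < M%:R :> R by rewrite ltr0n.
have y0 : 0 < `|y| by apply: lt_le_trans My; rewrite mulr_gt0.
have yn : `|y| != 0 by rewrite gt_eqF.
have sn : s != 0 by rewrite gt_eqF.
have pk := peak_gt0 s s0.
have h := gauss_tail s y `|y| s0 y0 (lexx _).
(* The cubic prefactor asks for a fourth power: the exponential is split into two equal factors,
   each at most 4 s / y^2. *)
have h2 : gauss s y <= peak s * (16 * s ^+ 2 / `|y| ^+ 4).
  have x0 : 0 < `|y| ^+ 2 / (4 * s) by rewrite divr_gt0 ?exprn_gt0 // mulr_gt0.
  rewrite /gauss mulrC ler_wpM2l ?(ltW pk) //.
  have -> : - y ^+ 2 / (2 * s) = - (`|y| ^+ 2 / (4 * s)) + - (`|y| ^+ 2 / (4 * s)).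
    by rewrite real_normK ?num_real //; field.
  rewrite expRD; have e := expRN_le_inv _ x0.
  apply: le_trans (ler_pM (expR_ge0 _) (expR_ge0 _) e e) _.
  by rewrite le_eqVlt; apply/orP; left; apply/eqP; field; rewrite sn yn.
have g0 := gauss_ge0 s y.
rewrite /gauss3 normrM (ger0_norm g0).
apply: (@le_trans _ _ ((`|y| ^+ 3 / s ^+ 3 + 3 * `|y| / s ^+ 2) * gauss s y)).
  rewrite ler_wpM2r //; apply: le_trans (ler_normD _ _) _.
  rewrite normrN !normrM !normfV !normrX (ger0_norm (ltW s0)) lerD2l.
  by rewrite (ger0_norm (_ : 0 <= 3 :> R)).
rewrite mulrDl.
have c3 : 0 <= `|y| ^+ 3 / s ^+ 3 by rewrite divr_ge0 ?exprn_ge0 // ltW.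
have c1 : 0 <= 3 * `|y| / s ^+ 2 by rewrite divr_ge0 ?mulr_ge0 ?exprn_ge0 // ltW.
apply: le_trans (lerD (ler_wpM2l c3 h2) (ler_wpM2l c1 h)) _.
rewrite (_ : `|y| ^+ 3 / s ^+ 3 * (peak s * (16 * s ^+ 2 / `|y| ^+ 4)) +
  3 * `|y| / s ^+ 2 * (peak s * (2 * s / `|y| ^+ 2)) = 22 * peak s / s / `|y|); last first.
  by field; rewrite sn yn.
rewrite ler_pdivrMr // (mulrAC _ M%:R^-1) ler_pdivlMr //.
rewrite (_ : 22 * peak s / s * M%:R = 11 * peak s / s * (2 * M%:R)); last by ring.
by rewrite ler_wpM2l // divr_ge0 ?(ltW s0) // mulr_ge0 // ltW.
Qed.

Lemma flux_small (f : R -> R -> R) (C : R) M r s : 0 <= r <= 1 ->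
  (forall y, 2 * M%:R <= `|y| -> `|f s y| <= C) -> `|flux f M r s| <= 2 * C.
Proof.
move=> /andP[r0 r1] fC; have M0 : 0 <= M%:R :> R by [].
rewrite /flux; apply: le_trans (ler_normB _ _) _.
rewrite (_ : 2 * C = C + C); last by ring.
apply: lerD; apply: fC.
  by rewrite ger0_norm; lra.
by rewrite ler0_norm; lra.
Qed.

End Images.

(** * The full Neumann kernel as a limit of image sums *)

Section Kernel.
Context {R : realType}.
Local Notation mu := (@lebesgue_measure R).
Implicit Types (r s z y x : R).

Lemma image_term_ge0 r s z m : 0 <= image_term (@gauss R) 1 r s z m.
Proof. by rewrite /image_term mul1r addr_ge0 ?gauss_ge0. Qed.

(** The four new Gaussians are centred at distance at least 2M from r, and 2M >= M + 1 because M is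
    positive. *)
Lemma img_step M r s z : (0 < M)%N -> 0 < s -> 0 <= r <= 1 -> 0 <= z <= 1 ->
  img M.+1 r s z <= img M r s z + 8 * s * peak s / M.+1%:R ^+ 2.
Proof.
move=> M0 s0 /andP[r0 r1] /andP[z0 z1].
have M1 : 1 <= M%:R :> R by rewrite ler1n.
have SM : M.+1%:R = M%:R + 1 :> R by rewrite natr1.
have tail y : M.+1%:R <= `|y| -> gauss s y <= peak s * (2 * s / M.+1%:R ^+ 2).
  by move=> My; apply: gauss_tail => //; rewrite ltr0n.
rewrite /img imagesS lerD2l /image_term !mul1r PoszR NegzR.
have t1 : gauss s (r - (z + 2 * (M%:R + 1))) <= peak s * (2 * s / M.+1%:R ^+ 2).
  by apply: tail; rewrite SM ler0_norm; lra.
have t2 : gauss s (r - (2 * (M%:R + 1) - z)) <= peak s * (2 * s / M.+1%:R ^+ 2).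
  by apply: tail; rewrite SM ler0_norm; lra.
have t3 : gauss s (r - (z + 2 * - (M%:R + 1))) <= peak s * (2 * s / M.+1%:R ^+ 2).
  by apply: tail; rewrite SM ger0_norm; lra.
have t4 : gauss s (r - (2 * - (M%:R + 1) - z)) <= peak s * (2 * s / M.+1%:R ^+ 2).
  by apply: tail; rewrite SM ger0_norm; lra.
apply: le_trans (lerD (lerD t1 t2) (lerD t3 t4)) _.
by rewrite le_eqVlt; apply/orP; left; apply/eqP; ring.
Qed.

Lemma img_nd r s z : nondecreasing_seq (fun M => img M r s z).
Proof.
apply/nondecreasing_seqP => M; rewrite /img imagesS lerDl addr_ge0 //; exact: image_term_ge0.
Qed.

Lemma img_le M M' r s z : (0 < M)%N -> 0 < s -> 0 <= r <= 1 -> 0 <= z <= 1 ->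
  img M' r s z <= img M r s z + 8 * s * peak s / M%:R.
Proof.
move=> M0 s0 r01 z01; have Mp : 0 < M%:R :> R by rewrite ltr0n.
have c0 : 0 <= 8 * s * peak s by rewrite !mulr_ge0 ?(ltW s0) // ltW // peak_gt0.
have [MM|MM] := leqP M' M.
  by apply: le_trans (img_nd r s z _ _ MM) _; rewrite lerDl divr_ge0.
(* The increments telescope through 1/(w + 1)^2 <= 1/w - 1/(w + 1). *)
suff H n : img (M + n) r s z <= img M r s z + 8 * s * peak s * (M%:R^-1 - (M + n)%:R^-1).
  have := H (M' - M)%N; rewrite subnKC ?(ltnW MM) // => /le_trans; apply.
  by rewrite lerD2l ler_wpM2l // gerBl invr_ge0.
elim: n => [|n IH]; first by rewrite addn0 subrr mulr0 addr0.
have Mn0 : (0 < M + n)%N by rewrite addn_gt0 M0.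
rewrite addnS; apply: le_trans (img_step _ r s z Mn0 s0 r01 z01) _.
apply: le_trans (lerD IH (lexx _)) _; rewrite -addrA lerD2l -mulrDr ler_wpM2l //.
have np : 0 < (M + n)%:R :> R by rewrite ltr0n.
rewrite -(natr1 (M + n)); set w := (M + n)%:R in np *.
rewrite -subr_ge0 (_ : _ - _ = (w * (w + 1) ^+ 2)^-1); last first.
  field; rewrite -!natrD natr1 !pnatr_eq0 /= -!lt0n M0 andbT.
  by rewrite addn_gt0 M0.
by rewrite invr_ge0 mulr_ge0 ?exprn_ge0 ?addr_ge0 // ltW.
Qed.

Fixpoint indices (M : nat) : seq int :=
  if M is M'.+1 then [:: Posz M'.+1, Negz M' & indices M'] else [:: 0].

Lemma mem_indices M (m : int) : (m \in indices M) = (absz m <= M)%N.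
Proof.
elim: M m => [|M IH] m /=.
  by rewrite inE; case: m => [[|n]|n].
rewrite !inE IH; case: m => n /=.
  by transitivity ((n == M.+1) || (n <= M)%N); last by rewrite [RHS]leq_eqVlt ltnS.
by transitivity ((n == M) || (n < M)%N); last by rewrite -leq_eqVlt.
Qed.

Lemma indices_uniq M : uniq (indices M).
Proof.
elim: M => [//|M IH] /=.
by rewrite inE !mem_indices /= !ltnn IH.
Qed.

Lemma img_indices M r s z : img M r s z = \sum_(m <- indices M) image_term (@gauss R) 1 r s z m.
Proof.
elim: M => [|M IH]; first by rewrite /img /images big_ord0 addr0 big_seq1.
by rewrite /img imagesS -/(img M r s z) IH /= !big_cons [LHS]addrC -addrA.
Qed.

(** Every finite set of indices lies in a symmetric block [indices K], and [img_le] bounds all the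
    sums [img K] at once. The extended sum is thus finite and [fine] is harmless. *)
Lemma Gneum_sandwich M r s z : (0 < M)%N -> 0 < s -> 0 <= r <= 1 -> 0 <= z <= 1 ->
  img M r s z <= Gneum s r z <= img M r s z + 8 * s * peak s / M%:R.
Proof.
move=> M0 s0 r01 z01.
pose f m : \bar R := (image_term (@gauss R) 1 r s z m)%:E.
have -> : Gneum s r z = fine (\esum_(m in [set: int]) f m).
  congr fine; apply: eq_esum => m _; rewrite /f /image_term mul1r; congr (_%:E).
have f0 m : (0 <= f m)%E by rewrite lee_fin image_term_ge0.
have fM K : (\sum_(m \in [set` indices K]) f m = (img K r s z)%:E)%E.
  by rewrite -fsbig_seq ?indices_uniq // sumEFin img_indices.
set E := esum _ _.
have lo : ((img M r s z)%:E <= E)%E.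
  apply: esum_ge; exists [set` indices M]; last by rewrite fM.
  by split => //; exact: finite_seq.
have hi : (E <= (img M r s z + 8 * s * peak s / M%:R)%:E)%E.
  apply: ge_ereal_sup => _ [F [finF _] <-].
  pose K := (\max_(m <- enum_fset (fset_set F)) absz m)%N.
  apply: (@le_trans _ _ (\sum_(m \in [set` indices K]) f m)%E).
    apply: lee_fsum_nneg_subset => //; first exact: finite_seq.
      move=> m /set_mem Fm; apply/mem_set; rewrite /= mem_indices.
      apply: (@leq_bigmax_seq _ _ xpredT (fun m => absz m)) => //.
      by rewrite -[_ \in _]/(m \in fset_set F) in_fset_set //; exact/mem_set.
  by rewrite fM lee_fin img_le.
move: E lo hi => [e| |] //=; rewrite ?lee_fin => h1 h2.
by rewrite h1 h2.
Qed.

Lemma Gneum_ge0 r s z : 0 <= Gneum s r z.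
Proof.
apply: fine_ge0; apply: esum_ge0 => m _.
by rewrite lee_fin addr_ge0 ?gauss_ge0.
Qed.

Lemma Gneum_img_dist (a b : R) M r s z : (0 < M)%N -> 0 < a -> a <= s <= b -> 0 <= r <= 1 -> 0 <= z <= 1 ->
  `|Gneum s r z - img M r s z| <= 8 * b * peak a / M%:R.
Proof.
move=> M0 a0 /andP[as_ sb] r01 z01; have s0 := lt_le_trans a0 as_.
have /andP[h1 h2] := Gneum_sandwich M r s z M0 s0 r01 z01.
rewrite ger0_norm ?subr_ge0 // lerBlDl; apply: le_trans h2 _; rewrite lerD2l.
rewrite ler_pM2r ?invr_gt0 ?ltr0n // ler_pM ?mulr_ge0 ?(ltW s0) ?(ltW (peak_gt0 s s0)) //.
  by rewrite ler_pM2l.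
exact: peak_anti.
Qed.

(** The 6 counts the Gaussians of [img 1]; the rest is the tail in the sandwich. *)
Lemma Gneum_le_peak r s z : 0 < s -> 0 <= r <= 1 -> 0 <= z <= 1 ->
  Gneum s r z <= (6 + 8 * s) * peak s.
Proof.
move=> s0 r01 z01; have /andP[_ h] := Gneum_sandwich 1 r s z (ltn0Sn 0) s0 r01 z01.
apply: le_trans h _; rewrite divr1 [leRHS]mulrDl lerD2r /img /images big_ord1 /image_term !mul1r.
have g y := gauss_le_peak s y s0.
apply: le_trans (lerD (lerD (g _) (g _)) (lerD (lerD (g _) (g _)) (lerD (g _) (g _)))) _.
by rewrite le_eqVlt; apply/orP; left; apply/eqP; ring.
Qed.

Lemma cvg_of_dist (f : nat -> R) (l C : R) :
  (forall n, (0 < n)%N -> `|l - f n| <= C / n%:R) -> f @ \oo --> l.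
Proof.
move=> h; apply/cvgrPdist_le => e e0; have n1 := near_inv C e e0.
near=> n; apply: le_trans (h n _) _; first by near: n; exists 1%N.
by near: n; exact: n1.
Unshelve. all: by end_near. Qed.

Lemma img_cvg r s z : 0 < s -> 0 <= r <= 1 -> 0 <= z <= 1 ->
  (fun M => img M r s z) @ \oo --> Gneum s r z.
Proof.
move=> s0 r01 z01; apply: (cvg_of_dist _ _ (8 * s * peak s)) => M M0.
by apply: Gneum_img_dist => //; rewrite !lexx.
Qed.

Lemma img_continuous_s M r s z : 0 < s -> {for s, continuous (fun s => img M r s z)}.
Proof. by move=> s0; exact: (is_derive_continuous _ _ _ (img_ds M r s z s0)). Qed.

Lemma img_continuous_z M r s z : 0 < s -> {for z, continuous (img M r s)}.
Proof.
move=> s0; apply: (is_derive_continuous _ _ (img1 M r s z)).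
by apply: images_dz => y; exact: gauss_dx.
Qed.

Lemma Gneum_measurable_z r s : 0 < s -> 0 <= r <= 1 ->
  measurable_fun (`[0, 1] : set R) (Gneum s r).
Proof.
move=> s0 r01; apply: (@measurable_fun_cvg _ _ _ _ (fun M => img M r s)).
  move=> M; apply: subspace_continuous_measurable_fun => //.
  by apply: continuous_within_cc => z _; exact: img_continuous_z.
by move=> z /=; rewrite in_itv /= => z01; exact: img_cvg.
Qed.

(** The truncation error is uniform for times in [s/2, 2s], so continuity passes from the finite
    sums to the limit. *)
Lemma Gneum_continuous_s r s z : 0 < s -> 0 <= r <= 1 -> 0 <= z <= 1 ->
  {for s, continuous (fun s => Gneum s r z)}.
Proof.
move=> s0 r01 z01; apply/cvgrPdist_le => e e0.
pose a := s / 2; pose b := 2 * s.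
have a0 : 0 < a by rewrite divr_gt0.
have e3 : 0 < e / 3 by rewrite divr_gt0.
have [M0 _ hM] := near_inv (8 * b * peak a) (e / 3) e3.
pose M := M0.+1.
have hb : 8 * b * peak a / M%:R <= e / 3 by apply: hM => /=.
have D s' : a <= s' <= b -> `|Gneum s' r z - img M r s' z| <= e / 3.
  by move=> h; apply: le_trans hb; exact: Gneum_img_dist.
have ss : a <= s <= b by rewrite /a /b; apply/andP; split; lra.
have /cvgrPdist_le/(_ _ e3) hc := img_continuous_s M r s z s0.
near=> s'.
have h1 : a <= s' <= b.
  have : `|s - s'| <= s / 2 by near: s'; apply: cvgr_dist_le; [exact: cvg_id|rewrite divr_gt0].
  by rewrite ler_norml /a /b => /andP[? ?]; apply/andP; split; lra.
have h2 : `|img M r s z - img M r s' z| <= e / 3 by near: s'; exact: hc.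
have := D s ss; have := D s' h1; move: h2; rewrite !ler_norml => /andP[? ?] /andP[? ?] /andP[? ?].
by apply/andP; split; lra.
Unshelve. all: by end_near. Qed.

End Kernel.

(** * The Neumann kernel as an approximate identity up to the boundary *)

Section ApproximateIdentity.
Context {R : realType}.
Local Notation mu := (@lebesgue_measure R).
Import gauss_integral_proof.
Implicit Types (r s z y x : R).

(** The source and its mirror images in 0 and in 1, the only ones that can come close to r. *)
Definition main_images s r z : R := gauss s (r - z) + gauss s (r + z) + gauss s (2 - r - z).

Lemma main_images_ge0 s r z : 0 <= main_images s r z.
Proof. by rewrite !addr_ge0 ?gauss_ge0. Qed.

(** The 14 is 6 for the three other Gaussians of [img 1], all at distance at least 1, plus 8 for the
    tail. *)
Lemma Gneum_main_images s r z : 0 < s -> 0 <= r <= 1 -> 0 <= z <= 1 ->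
  `|Gneum s r z - main_images s r z| <= 14 * (s * peak s).
Proof.
move=> s0 r01 z01; have /andP[h1 h2] := Gneum_sandwich 1 r s z (ltn0Sn 0) s0 r01 z01.
have E : img 1 r s z = main_images s r z + (gauss s (r - z - 2) + gauss s (r - z + 2) + gauss s (r + z + 2)).
  rewrite /img /images big_ord1 /image_term PoszR NegzR mulr0z mulr0 !mul1r !add0r !mulr1 /main_images.
  rewrite -(gauss_even s (2 - r - z)).
  rewrite (_ : r - (2 - z) = - (2 - r - z)); last by ring.
  rewrite addr0 opprK (_ : r - (z + 2) = r - z - 2); last by ring.
  rewrite (_ : r - (z + 2 * -1) = r - z + 2); last by ring.
  rewrite (_ : r - (2 * -1 - z) = r + z + 2); last by ring.
  ring.
move: r01 z01 => /andP[r0 r1] /andP[z0 z1].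
have tail y : 1 <= `|y| -> 0 <= gauss s y <= 2 * (s * peak s).
  move=> y1; rewrite gauss_ge0 /=; apply: le_trans (gauss_tail s y 1 s0 ltr01 y1) _.
  by rewrite expr1n divr1 le_eqVlt; apply/orP; left; apply/eqP; ring.
have /andP[a0 a1] := tail (r - z - 2) (ltac:(rewrite ler0_norm; lra)).
have /andP[b0 b1] := tail (r - z + 2) (ltac:(rewrite ger0_norm; lra)).
have /andP[c0 c1] := tail (r + z + 2) (ltac:(rewrite ger0_norm; lra)).
move: h2; rewrite divr1 -(mulrA 8) => h2.
rewrite ler_norml; apply/andP; split; lra.
Qed.

Lemma main_images_far s r z (d : R) : 0 < s -> 0 < d -> 0 <= r <= 1 -> 0 <= z <= 1 -> d <= `|z - r| ->
  main_images s r z <= 6 * (s * peak s) / d ^+ 2.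
Proof.
move=> s0 d0 /andP[r0 r1] /andP[z0 z1] dz.
have tail y : d <= `|y| -> gauss s y <= 2 * (s * peak s) / d ^+ 2.
  move=> yd; apply: le_trans (gauss_tail s y d s0 d0 yd) _.
  by rewrite le_eqVlt; apply/orP; left; apply/eqP; field; rewrite gt_eqF.
have h1 : gauss s (r - z) <= 2 * (s * peak s) / d ^+ 2 by apply: tail; rewrite distrC.
have h2 : gauss s (r + z) <= 2 * (s * peak s) / d ^+ 2.
  apply: tail; apply: le_trans dz _; rewrite (ger0_norm (addr_ge0 r0 z0)) ler_norml.
  by apply/andP; split; lra.
have h3 : gauss s (2 - r - z) <= 2 * (s * peak s) / d ^+ 2.
  apply: tail; apply: le_trans dz _; rewrite (@ger0_norm _ (2 - r - z)); last by lra.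
  by rewrite ler_norml; apply/andP; split; lra.
apply: le_trans (lerD (lerD h1 h2) h3) _.
by rewrite le_eqVlt; apply/orP; left; apply/eqP; field; rewrite gt_eqF.
Qed.

Lemma gauss_continuous s x : 0 < s -> {for x, continuous (gauss s)}.
Proof. by move=> s0; exact: (is_derive_continuous _ _ _ (gauss_dx s x s0)). Qed.

Lemma gauss_primitive s : 0 < s -> exists2 Psi : R -> R,
  Psi 0 = 0 /\ forall x, 0 <= x -> is_derive x 1 Psi (gauss s x) &
  forall x, 0 <= x -> Psi x = (Num.sqrt pi)^-1 * integral0_gauss (x / Num.sqrt (2 * s)).
Proof.
move=> s0; have [E [E0 Ed]] := primitive_exists gauss_fun (fun x _ => @continuous_gauss_fun R x).
have s20 : 0 < 2 * s by rewrite mulr_gt0.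
pose c := (Num.sqrt (2 * s))^-1.
have c0 : 0 < c by rewrite invr_gt0 sqrtr_gt0.
have EI x : 0 <= x -> E x = integral0_gauss x.
  move=> x0; rewrite -[LHS]subr0 -[X in _ - X]E0; apply/esym.
  refine (FTC2_Rintegral _ E 0 x x0 _ _) => y /andP[y0 _]; first exact: Ed.
  exact: continuous_gauss_fun.
exists (fun x => (Num.sqrt pi)^-1 * E (c * x)); last first.
  by move=> x x0; rewrite -EI ?mulr_ge0 ?invr_ge0 ?sqrtr_ge0 // (mulrC c).
split; first by rewrite mulr0 E0 mulr0.
move=> x x0.
have cx0 : 0 <= c * x by rewrite mulr_ge0 // ltW.
have h := drv_scale (Num.sqrt pi)^-1 _ _ _ (drv_comp _ _ _ _ _ (linear_derive c x) (Ed _ cx0)).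
apply: (is_derive_eq h); rewrite /gauss_fun /gauss exprMn.
have -> : c ^+ 2 = (2 * s)^-1 by rewrite exprVn sqr_sqrtr // ltW.
have -> : Num.sqrt (2 * pi * s) = Num.sqrt pi * Num.sqrt (2 * s).
  by rewrite -sqrtrM ?pi_ge0 //; congr Num.sqrt; ring.
rewrite [(Num.sqrt pi * _)^-1]invfM -/c (_ : - ((2 * s)^-1 * x ^+ 2) = - x ^+ 2 / (2 * s)); last by ring.
by ring.
Qed.

Definition main_mass s r : R := Rintegral mu `[0, 1] (main_images s r).

(** Unfolding the reflections turns the three integrals into that of one Gaussian centred at r over
    [-1, 2]. Both ends stay at distance at least 1 from r, so no mass is lost in the limit even for
    r = 0 or r = 1. *)
Lemma main_massE s r : 0 < s -> 0 <= r <= 1 ->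
  main_mass s r = (Num.sqrt pi)^-1 * (integral0_gauss ((1 + r) / Num.sqrt (2 * s)) +
     integral0_gauss ((2 - r) / Num.sqrt (2 * s))).
Proof.
move=> s0 /andP[r0 r1]; have [Psi [Psi0 Pd] PE] := gauss_primitive s s0.
have gc x : {for x, continuous (gauss s)} := gauss_continuous s x s0.
have dm (c x : R) : is_derive x 1 (fun x => c - x) (-1).
  by apply: (is_derive_eq (drv_sub _ _ _ _ _ (drv_cst c x) (drv_id x))); rewrite sub0r.
have dp (c x : R) : is_derive x 1 (fun x => c + x) 1.
  by apply: (is_derive_eq (drv_add _ _ _ _ _ (drv_cst c x) (drv_id x))); rewrite add0r.
have cm (c x : R) : {for x, continuous (fun x => gauss s (c - x))}.
  exact: (continuous_comp (is_derive_continuous _ _ _ (dm c x)) (gc _)).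
have cp (c x : R) : {for x, continuous (fun x => gauss s (c + x))}.
  exact: (continuous_comp (is_derive_continuous _ _ _ (dp c x)) (gc _)).
have im (c a b : R) : mu.-integrable `[a, b] (EFin \o (fun x => gauss s (c - x))).
  by apply: continuous_integrable => x _; exact: cm.
have ip (c a b : R) : mu.-integrable `[a, b] (EFin \o (fun x => gauss s (c + x))).
  by apply: continuous_integrable => x _; exact: cp.
have right (c a b : R) : a <= b -> b <= c ->
    Rintegral mu `[a, b] (fun x => gauss s (c - x)) = Psi (c - a) - Psi (c - b).
  move=> ab bc.
  rewrite (_ : Psi (c - a) - _ = - Psi (c - b) - - Psi (c - a)); last by ring.
  refine (FTC2_Rintegral _ (fun x => - Psi (c - x)) a b ab _ _) => x /andP[ax xb]; last exact: cm.
  have cx : 0 <= c - x by lra.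
  apply: (is_derive_eq (drv_opp _ _ _ (drv_comp _ _ _ _ _ (dm c x) (Pd _ cx)))).
  by rewrite mulrN1 opprK.
have left (c a b : R) : a <= b -> 0 <= c + a ->
    Rintegral mu `[a, b] (fun x => gauss s (c + x)) = Psi (c + b) - Psi (c + a).
  move=> ab bc.
  refine (FTC2_Rintegral _ (fun x => Psi (c + x)) a b ab _ _) => x /andP[ax xb]; last exact: cp.
  have cx : 0 <= c + x by lra.
  apply: (is_derive_eq (drv_comp _ _ _ _ _ (dp c x) (Pd _ cx))).
  by rewrite mulr1.
have S1 : Rintegral mu `[0, 1] (fun z => gauss s (r - z)) = Psi r + Psi (1 - r).
  rewrite (Rintegral_split _ 0 r 1 r0 r1 (im r 0 1)).
  rewrite right // subrr subr0 Psi0 subr0; congr (_ + _).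
  rewrite -(_ : Rintegral mu `[r, 1] (fun z => gauss s (- r + z)) = Psi (1 - r)).
    by apply: eq_Rintegral => z _; rewrite -gauss_even; congr (gauss s _); ring.
  by rewrite left // addNr // Psi0 subr0 addrC.
have S2 := left r 0 1 ler01 (ltac:(by rewrite addr0)).
have S3 := right (2 - r) 0 1 ler01 (ltac:(lra)).
have M : main_mass s r = Psi (r + 1) + Psi (2 - r).
  have iAB : mu.-integrable `[0, 1] (EFin \o (fun z => gauss s (r - z) + gauss s (r + z))).
    rewrite (_ : EFin \o _ = (fun x => ((gauss s (r - x))%:E + (gauss s (r + x))%:E)%E)) //.
    by apply: integrableD => //; [exact: im|exact: ip].
  rewrite /main_mass /main_images (RintegralD _ iAB (im (2 - r) 0 1)) //.
  rewrite (RintegralD _ (im r 0 1) (ip r 0 1)) //.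
  rewrite S1 S2 S3 addr0 subr0 (_ : 2 - r - 1 = 1 - r); last by ring.
  ring.
have h1 : 0 <= r + 1 by rewrite addr_ge0.
have h2 : 0 <= 2 - r by clear -r1; lra.
by rewrite M (PE _ h1) (PE _ h2) -mulrDr (addrC r).
Qed.

(** The regularisation time as a sequence, so that convergence theorems for sequences of integrals
    apply. *)
Definition tau (n : nat) : R := n.+1%:R^-1.

Lemma tau_gt0 n : 0 < tau n. Proof. by rewrite invr_gt0. Qed.

Lemma tau_le1 n : tau n <= 1. Proof. by rewrite invf_le1 // ler1n. Qed.

Lemma tau_cvg : tau @ \oo --> (0 : R).
Proof. exact: cvg_harmonic. Qed.

Lemma tau_peak_cvg : (fun n => tau n * peak (tau n)) @ \oo --> (0 : R).
Proof.
have h : (fun n => Num.sqrt (tau n) * (Num.sqrt (2 * pi))^-1) @ \oo --> (0 : R).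
  rewrite -[X in _ --> X](mul0r (Num.sqrt (2 * pi))^-1); apply: cvgM; last exact: cvg_cst.
  by rewrite -sqrtr0; apply: continuous_cvg; [exact: sqrt_continuous|exact: tau_cvg].
rewrite (_ : (fun n => tau n * peak (tau n)) = fun n => Num.sqrt (tau n) * (Num.sqrt (2 * pi))^-1) //.
apply/funext => n; rewrite /peak sqrtrM ?mulr_ge0 ?pi_ge0 // invfM.
have q0 : Num.sqrt (tau n) != 0 by rewrite gt_eqF // sqrtr_gt0 tau_gt0.
rewrite -{1}(sqr_sqrtr (ltW (tau_gt0 n))); field.
by rewrite q0 gt_eqF // sqrtr_gt0 mulr_gt0 // pi_gt0.
Qed.

Lemma main_mass_cvg r : 0 <= r <= 1 -> (fun n => main_mass (tau n) r) @ \oo --> (1 : R).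
Proof.
move=> r01.
have lim x : 0 < x -> (fun n => integral0_gauss (x / Num.sqrt (2 * tau n))) @ \oo --> (Num.sqrt pi / 2 : R).
  (* The available limit concerns the square of the Gaussian integral; a square root and
     nonnegativity recover the integral. *)
  move=> x0; have cI : @integral0_gauss R x @[x --> +oo%R] --> Num.sqrt pi / 2.
    have : Num.sqrt (@integral0_gauss R x ^+ 2) @[x --> +oo%R] --> Num.sqrt (pi / 4).
      apply: continuous_cvg; [exact: sqrt_continuous|exact: cvg_integral0_gauss_sqr].
    rewrite sqrtrM ?pi_ge0 // sqrtrV // (_ : 4 = 2 ^+ 2); last by rewrite expr2 -natrM.
    rewrite sqrtr_sqr ger0_norm // (_ : (fun _ => Num.sqrt _) = integral0_gauss) //.
    by apply/funext => y; rewrite sqrtr_sqr ger0_norm // integral0_gauss_ge0.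
  apply: cvg_comp cI; apply/cvgryPge => A.
  have h : (fun n => Num.sqrt (2 * tau n)) @ \oo --> (0 : R).
    rewrite -[X in _ --> X]sqrtr0; apply: continuous_cvg; first exact: sqrt_continuous.
    by rewrite -(mulr0 2); apply: cvgM; [exact: cvg_cst|exact: tau_cvg].
  have e0 : 0 < x / (`|A| + 1) by rewrite divr_gt0 // ltr_wpDl.
  move/cvgr0Pnorm_le : h => /(_ _ e0); apply: filterS => n.
  have q0 : 0 < Num.sqrt (2 * tau n) by rewrite sqrtr_gt0 mulr_gt0 // tau_gt0.
  rewrite (gtr0_norm q0) ler_pdivlMr ?ltr_wpDl // => hq.
  rewrite ler_pdivlMr //; apply: le_trans hq; rewrite mulrC ler_pM2l //.
  by apply: le_trans (ler_norm A) _; rewrite lerDl.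
move: (r01) => /andP[r0 r1].
rewrite (_ : (fun n => main_mass (tau n) r) = fun n => (Num.sqrt pi)^-1 * (integral0_gauss ((1 + r) / Num.sqrt (2 * tau n)) +
     integral0_gauss ((2 - r) / Num.sqrt (2 * tau n)))); last first.
  by apply/funext => n; rewrite main_massE // tau_gt0.
have L : (Num.sqrt pi)^-1 * (Num.sqrt pi / 2 + Num.sqrt pi / 2) = 1 :> R.
  by field; rewrite gt_eqF // sqrtr_gt0 pi_gt0.
have h1 : 0 < 1 + r by clear -r0; lra.
have h2 : 0 < 2 - r by clear -r1; lra.
by rewrite -[X in _ --> X]L; exact: (cvgM (cvg_cst _) (cvgD (lim (1 + r) h1) (lim (2 - r) h2))).
Qed.

Definition cont01 (u : R -> R) := forall r, 0 <= r <= 1 -> forall e, 0 < e ->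
  exists2 d : R, 0 < d & forall z, 0 <= z <= 1 -> `|z - r| < d -> `|u z - u r| < e.

Lemma cont01_within u : cont01 u -> {within `[0, 1], continuous u}.
Proof.
move=> uc; apply/subspace_continuousP => x /=; rewrite in_itv /= => x01.
apply/cvgrPdist_lt => e e0; have [d d0 ud] := uc x x01 e e0.
rewrite near_withinE; near=> z => /=; rewrite in_itv /= => z01.
rewrite distrC; apply: ud => //; rewrite distrC.

Unshelve. all: by end_near. Qed.

Lemma cont01_integrable u : cont01 u -> mu.-integrable `[0, 1] (EFin \o u).
Proof.
move=> uc; apply: continuous_compact_integrable; first exact: segment_compact.
exact: cont01_within.
Qed.

Lemma cont01_bounded u : cont01 u -> exists2 U : R, 0 <= U & forall z, 0 <= z <= 1 -> `|u z| <= U.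
Proof.
move=> /cont01_within uc.
have [c c01 cM] := EVT_max ler01 uc; have [d d01 dm] := EVT_min ler01 uc.
exists (`|u c| + `|u d|); first by rewrite addr_ge0.
move=> z z01; have zi : z \in `[0, 1] by rewrite in_itv.
have h1 := cM z zi; have h2 := dm z zi.
have := ler_norm (u c); have := ler_norm (- u d); rewrite normrN => h3 h4.
have := normr_ge0 (u c); have := normr_ge0 (u d) => h5 h6.
by rewrite ler_norml; apply/andP; split; lra.
Qed.

Lemma approximate_identity u r : cont01 u -> 0 <= r <= 1 ->
  (fun n => Rintegral mu `[0, 1] (fun z => Gneum (tau n) r z * u z)) @ \oo --> u r.
Proof.
move=> uc r01; have [U U0 uU] := cont01_bounded u uc.
have ui := cont01_integrable u uc.
have mi n : mu.-integrable `[0, 1] (EFin \o main_images (tau n) r).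
  have t0 := tau_gt0 n.
  apply: continuous_integrable => x _.
  have dm (c : R) : is_derive x 1 (fun x => c - x) (-1).
    by apply: (is_derive_eq (drv_sub _ _ _ _ _ (drv_cst c x) (drv_id x))); rewrite sub0r.
  have dp (c : R) : is_derive x 1 (fun x => c + x) 1.
    by apply: (is_derive_eq (drv_add _ _ _ _ _ (drv_cst c x) (drv_id x))); rewrite add0r.
  apply: continuousD; first apply: continuousD.
  - exact: (continuous_comp (is_derive_continuous _ _ _ (dm r)) (gauss_continuous _ _ t0)).
  - exact: (continuous_comp (is_derive_continuous _ _ _ (dp r)) (gauss_continuous _ _ t0)).
  - exact: (continuous_comp (is_derive_continuous _ _ _ (dm (2 - r))) (gauss_continuous _ _ t0)).
have gi n : mu.-integrable `[0, 1] (EFin \o (fun z => Gneum (tau n) r z * u z)).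
  have t0 := tau_gt0 n.
  apply: (integrable_bounded_mul _ _ u ((6 + 8 * tau n) * peak (tau n))) => //.
    exact: Gneum_measurable_z.
  move=> z /=; rewrite in_itv /= => z01.
  by rewrite ger0_norm ?Gneum_ge0 // Gneum_le_peak.
have E n : Rintegral mu `[0, 1] (fun z => Gneum (tau n) r z * u z) =
    (Rintegral mu `[0, 1] (fun z => Gneum (tau n) r z * u z) - u r * main_mass (tau n) r) + u r * main_mass (tau n) r.
  by rewrite subrK.
rewrite (funext E) -[X in _ --> X]add0r; apply: cvgD; last first.
  by rewrite -[X in _ --> X]mulr1; apply: cvgM; [exact: cvg_cst|exact: main_mass_cvg].
apply/cvgr0Pnorm_le => e e0.
have e4 : 0 < e / 4 by rewrite divr_gt0.
have [d d0 ud] := uc r r01 (e / 4) e4.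
(* The 14 U is for the discarded images, and 12 U = 2 U times 6 for points at distance at least [d]
   from r, by [main_images_far]. *)
pose K := 14 * U + 12 * U / d ^+ 2.
have pt n z : 0 <= z <= 1 ->
    `|Gneum (tau n) r z * u z - u r * main_images (tau n) r z| <= K * (tau n * peak (tau n)) + e / 4 * main_images (tau n) r z.
  move=> z01; have t0 := tau_gt0 n.
  have m0 := main_images_ge0 (tau n) r z.
  have tp0 : 0 <= tau n * peak (tau n) by rewrite mulr_ge0 ?(ltW t0) // ltW // peak_gt0.
  rewrite (_ : _ - _ = (Gneum (tau n) r z - main_images (tau n) r z) * u z + (u z - u r) * main_images (tau n) r z); last by ring.
  apply: le_trans (ler_normD _ _) _.
  have A : `|(Gneum (tau n) r z - main_images (tau n) r z) * u z| <= 14 * U * (tau n * peak (tau n)).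
    rewrite normrM (_ : 14 * U * _ = 14 * (tau n * peak (tau n)) * U); last by ring.
    by rewrite ler_pM // ?uU // Gneum_main_images.
  rewrite [leRHS](_ : _ = 14 * U * (tau n * peak (tau n)) + (12 * U / d ^+ 2 * (tau n * peak (tau n)) +
    e / 4 * main_images (tau n) r z)); last by rewrite /K; ring.
  apply: lerD; first exact: A.
  rewrite normrM (ger0_norm m0).
  have U12 : 0 <= 12 * U / d ^+ 2 by rewrite divr_ge0 ?mulr_ge0 ?exprn_ge0 // ltW.
  have [zd|dz] := ltP `|z - r| d.
    apply: (@le_trans _ _ (e / 4 * main_images (tau n) r z)).
      by rewrite ler_wpM2r // ltW // ud.
    by rewrite lerDr mulr_ge0.
  have far := main_images_far (tau n) r z d t0 d0 r01 z01 dz.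
  have uu : `|u z - u r| <= 2 * U.
    by apply: le_trans (ler_normB _ _) _; have := uU z z01; have := uU r r01; lra.
  apply: le_trans (ler_pM (normr_ge0 _) m0 uu far) _.
  rewrite (_ : 2 * U * _ = 12 * U / d ^+ 2 * (tau n * peak (tau n))); last by ring.
  by rewrite lerDl mulr_ge0 // ltW.
have bnd n : `|Rintegral mu `[0, 1] (fun z => Gneum (tau n) r z * u z) - u r * main_mass (tau n) r|
    <= K * (tau n * peak (tau n)) + e / 4 * main_mass (tau n) r.
  have umi : mu.-integrable `[0, 1] (EFin \o (fun z => u r * main_images (tau n) r z)).
    by apply: (integrable_bounded_mul _ (fun=> u r) _ `|u r|).
  have emi : mu.-integrable `[0, 1] (EFin \o (fun z => e / 4 * main_images (tau n) r z)).
    by apply: (integrable_bounded_mul _ (fun=> e / 4) _ `|e / 4|).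
  have ki := integrable_cst_itv 0 1 (K * (tau n * peak (tau n))).
  have di : mu.-integrable `[0, 1] (EFin \o (fun z => Gneum (tau n) r z * u z - u r * main_images (tau n) r z)).
    rewrite (_ : EFin \o _ = (fun z => ((Gneum (tau n) r z * u z)%:E - (u r * main_images (tau n) r z)%:E)%E)) //.
    by apply: integrableB => //; exact: gi.
  have E1 : u r * main_mass (tau n) r = Rintegral mu `[0, 1] (fun z => u r * main_images (tau n) r z).
    by rewrite RintegralZl //; exact: mi.
  have E2 : e / 4 * main_mass (tau n) r = Rintegral mu `[0, 1] (fun z => e / 4 * main_images (tau n) r z).
    by rewrite RintegralZl //; exact: mi.
  have E3 : K * (tau n * peak (tau n)) = Rintegral mu `[0, 1] (fun=> K * (tau n * peak (tau n))).
    by rewrite Rintegral_cst_itv // subr0 mulr1.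
  rewrite E1 E2 E3 -(RintegralB _ (gi n) umi) // -(RintegralD _ ki emi) //.
  apply: le_trans (le_normr_Rintegral _ di) _ => //.
  apply: le_Rintegral => //.
  - exact: integrable_norm di.
  - rewrite (_ : EFin \o _ = (fun z => ((K * (tau n * peak (tau n)))%:E + (e / 4 * main_images (tau n) r z)%:E)%E)) //.
    exact: integrableD.
  - by move=> z /=; rewrite in_itv /= => z01; exact: pt.
have c1 : (fun n => K * (tau n * peak (tau n)) + e / 4 * main_mass (tau n) r) @ \oo --> (e / 4 : R).
  rewrite -[X in _ --> X]add0r; apply: cvgD.
    by rewrite -(mulr0 K); apply: cvgM; [exact: cvg_cst|exact: tau_peak_cvg].
  by rewrite -[X in _ --> X]mulr1; apply: cvgM; [exact: cvg_cst|exact: main_mass_cvg].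
have : \forall n \near \oo, K * (tau n * peak (tau n)) + e / 4 * main_mass (tau n) r <= e.
  apply: (cvgr_le _ c1); lra.
by apply: filterS => n; apply: le_trans (bnd n).
Qed.

End ApproximateIdentity.

(** * Evolution of the hydrodynamic profile *)

Section Evolution.
Context {R : realType}.
Local Notation mu := (@lebesgue_measure R).
Implicit Types (r s z y x : R).

Lemma Rintegral_dist (a b : R) (f g h : R -> R) :
  mu.-integrable `[a, b] (EFin \o f) -> mu.-integrable `[a, b] (EFin \o g) ->
  mu.-integrable `[a, b] (EFin \o h) ->
  (forall z, a <= z <= b -> `|f z - g z| <= h z) ->
  `|Rintegral mu `[a, b] f - Rintegral mu `[a, b] g| <= Rintegral mu `[a, b] h.
Proof.
move=> fi gi hi fgh.
have di : mu.-integrable `[a, b] (EFin \o (fun z => f z - g z)).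
  rewrite (_ : EFin \o _ = (fun z => ((f z)%:E - (g z)%:E)%E)) //.
  exact: integrableB.
rewrite -RintegralB //; apply: le_trans (le_normr_Rintegral _ di) _ => //.
apply: le_Rintegral => //; first exact: integrable_norm di.
Qed.

Lemma kap_small (a : R) M r s : 0 < a -> a <= s -> (0 < M)%N -> 0 <= r <= 1 ->
  `|kap M r s| <= 2 * (peak a / M%:R).
Proof.
move=> a0 as_ M0 r01; have s0 := lt_le_trans a0 as_.
apply: flux_small => // y My; apply: le_trans (gauss1_small s y M s0 M0 My) _.
by rewrite ler_pM2r ?invr_gt0 ?ltr0n // peak_anti.
Qed.

Lemma dkap_small (a : R) M r s : 0 < a -> a <= s -> (0 < M)%N -> 0 <= r <= 1 ->
  `|dkap M r s| <= 11 * peak a / a / M%:R.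
Proof.
move=> a0 as_ M0 r01; have s0 := lt_le_trans a0 as_.
have Mp : 0 < M%:R :> R by rewrite ltr0n.
have h : `|flux (@gauss3 R) M r s| <= 2 * (11 * peak a / a / M%:R).
  apply: flux_small => // y My; apply: le_trans (gauss3_small s y M s0 M0 My) _.
  rewrite ler_pM2r ?invr_gt0 // ler_pM ?mulr_ge0 ?invr_ge0 ?(ltW s0) ?(ltW (peak_gt0 s s0)) //.
    by rewrite ler_pM2l // peak_anti.
  by rewrite lef_pV2 ?posrE.
by rewrite /dkap normrM (ger0_norm (_ : 0 <= 2^-1)) // ler_pdivrMr // mulrC.
Qed.

Lemma tst_img_dist (a : R) M r s z : 0 < a -> a <= s -> (0 < M)%N -> 0 <= r <= 1 -> 0 <= z <= 1 ->
  `|tst M r s z - img M r s z| <= peak a / M%:R.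
Proof.
move=> a0 as_ M0 r01 /andP[z0 z1]; have h := kap_small a M r s a0 as_ M0 r01.
rewrite /tst (_ : _ - _ = - (kap M r s * (z ^+ 2 / 2))); last by ring.
rewrite normrN normrM; have z2 : 0 <= z ^+ 2 / 2 by rewrite divr_ge0 ?sqr_ge0.
have z21 : z ^+ 2 / 2 <= 2^-1.
  by rewrite ler_pdivrMr // mulVf // expr_le1.
rewrite (ger0_norm z2); apply: le_trans (ler_pM (normr_ge0 _) z2 h z21) _.
by rewrite mulrAC mulfV // mul1r.
Qed.

Lemma tst_Gneum_dist (a b : R) M r s z : 0 < a -> a <= s <= b -> (0 < M)%N -> 0 <= r <= 1 -> 0 <= z <= 1 ->
  `|Gneum s r z - tst M r s z| <= (8 * b + 1) * peak a / M%:R.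
Proof.
move=> a0 sab M0 r01 z01; move: (sab) => /andP[as_ sb].
rewrite (_ : _ - _ = (Gneum s r z - img M r s z) - (tst M r s z - img M r s z)); last by ring.
apply: le_trans (ler_normB _ _) _.
have h1 := Gneum_img_dist a b M r s z M0 a0 sab r01 z01.
have h2 := tst_img_dist a M r s z a0 as_ M0 r01 z01.
by apply: le_trans (lerD h1 h2) _; rewrite !mulrDl !mul1r.
Qed.

Lemma tst_continuous_z M r s z : 0 < s -> {for z, continuous (tst M r s)}.
Proof. by move=> s0; exact: (is_derive_continuous _ _ _ (tst_dz M r s z s0)). Qed.

Lemma tst_continuous_s M r s z : 0 < s -> {for s, continuous (fun s => tst M r s z)}.
Proof. by move=> s0; exact: (is_derive_continuous _ _ _ (tst_ds M r s z s0)). Qed.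

Lemma Gneum_mul_integrable r s (u : R -> R) : 0 < s -> 0 <= r <= 1 ->
  mu.-integrable `[0, 1] (EFin \o u) ->
  mu.-integrable `[0, 1] (EFin \o (fun z => Gneum s r z * u z)).
Proof.
move=> s0 r01 ui; apply: (integrable_bounded_mul _ _ u ((6 + 8 * s) * peak s)) => //.
  exact: Gneum_measurable_z.
move=> z /=; rewrite in_itv /= => z01.
by rewrite ger0_norm ?Gneum_ge0 // Gneum_le_peak.
Qed.

Lemma tst_mul_integrable M r s (u : R -> R) : 0 < s ->
  mu.-integrable `[0, 1] (EFin \o u) ->
  mu.-integrable `[0, 1] (EFin \o (fun z => tst M r s z * u z)).
Proof.
move=> s0 ui; have [B _ hB] := bounded_tst s s s0 M r.
apply: (integrable_bounded_mul _ _ u B) => //.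
  apply: subspace_continuous_measurable_fun => //.
  by apply: continuous_within_cc => z _; exact: tst_continuous_z.
by move=> z /=; rewrite in_itv /= => z01; apply: hB => //; rewrite lexx.
Qed.

Lemma tst_mul_cvg r s (u : R -> R) : 0 < s -> 0 <= r <= 1 -> profile u ->
  (fun M => Rintegral mu `[0, 1] (fun z => tst M r s z * u z)) @ \oo -->
  Rintegral mu `[0, 1] (fun z => Gneum s r z * u z).
Proof.
move=> s0 r01 [ui u0].
apply: (cvg_of_dist _ _ ((8 * s + 1) * peak s * Rintegral mu `[0, 1] u)) => M M0.
have E : (8 * s + 1) * peak s * Rintegral mu `[0, 1] u / M%:R =
   Rintegral mu `[0, 1] (fun z => (8 * s + 1) * peak s / M%:R * u z).
  by rewrite RintegralZl //; ring.
rewrite E; apply: Rintegral_dist.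
- exact: Gneum_mul_integrable.
- exact: tst_mul_integrable.
- exact: (integrable_bounded_mul _ (fun=> (8 * s + 1) * peak s / M%:R) _ `|(8 * s + 1) * peak s / M%:R|).
move=> z z01; rewrite -mulrBl normrM (ger0_norm (u0 z z01)) ler_wpM2r ?u0 //.
by apply: tst_Gneum_dist => //; rewrite !lexx.
Qed.

Definition boundary_gap r s : R := Gneum s r 0 - Gneum s r 1.
Definition tst_gap M r s : R := tst M r s 0 - tst M r s 1.

Lemma boundary_gap_le r s : 0 < s -> 0 <= r <= 1 -> `|boundary_gap r s| <= 2 * ((6 + 8 * s) * peak s).
Proof.
move=> s0 r01; apply: le_trans (ler_normB _ _) _.
have h0 := Gneum_le_peak r s 0 s0 r01 (ltac:(by rewrite lexx ler01)).
have h1 := Gneum_le_peak r s 1 s0 r01 (ltac:(by rewrite lexx ler01)).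
by rewrite !ger0_norm ?Gneum_ge0 //; lra.
Qed.

Lemma gap_shift_cvg (t0 t : R) r : 0 < t0 -> 0 <= t -> 0 <= r <= 1 ->
  (fun M => Rintegral mu `[0, t] (fun s => tst_gap M r (s + t0))) @ \oo -->
  Rintegral mu `[0, t] (fun s => boundary_gap r (s + t0)).
Proof.
move=> tp t1 r01; pose c := (8 * (t + t0) + 1) * peak t0.
have z0 : 0 <= (0 : R) <= 1 by rewrite lexx ler01.
have z1 : 0 <= (1 : R) <= 1 by rewrite lexx ler01.
have sh s : is_derive s 1 (fun s => s + t0) 1 := drv_shift t0 s.
have shc s : {for s, continuous (fun s => s + t0)} := is_derive_continuous _ _ _ (sh s).
apply: (cvg_of_dist _ _ (2 * c * t)) => M M0.
have E : 2 * c * t / M%:R = Rintegral mu `[0, t] (fun=> 2 * c / M%:R).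
  by rewrite Rintegral_cst_itv //; ring.
have sp s : 0 <= s -> 0 < s + t0 by move=> s0; rewrite ltr_wpDl.
rewrite E; apply: Rintegral_dist.
- apply: continuous_integrable => s /andP[s0 _]; apply: continuousB.
    exact: (continuous_comp (shc s) (Gneum_continuous_s r (s + t0) 0 (sp _ s0) r01 z0)).
  exact: (continuous_comp (shc s) (Gneum_continuous_s r (s + t0) 1 (sp _ s0) r01 z1)).
- apply: continuous_integrable => s /andP[s0 _]; apply: continuousB.
    exact: (continuous_comp (shc s) (tst_continuous_s M r (s + t0) 0 (sp _ s0))).
  exact: (continuous_comp (shc s) (tst_continuous_s M r (s + t0) 1 (sp _ s0))).
- exact: integrable_cst_itv.
move=> s /andP[s0 st].
have sb : t0 <= s + t0 <= t + t0 by apply/andP; split; lra.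
rewrite /boundary_gap /tst_gap.
rewrite (_ : _ - _ = (Gneum (s + t0) r 0 - tst M r (s + t0) 0) - (Gneum (s + t0) r 1 - tst M r (s + t0) 1)); last by ring.
apply: le_trans (ler_normB _ _) _.
have h0 := tst_Gneum_dist t0 (t + t0) M r (s + t0) 0 tp sb M0 r01 z0.
have h1 := tst_Gneum_dist t0 (t + t0) M r (s + t0) 1 tp sb M0 r01 z1.
by apply: le_trans (lerD h0 h1) _; rewrite /c; lra.
Qed.

(** [macro_bound] for the signed test function, shifted by [t0] away from the singularity. Its heat
    residual involves [kap] and [dkap] alone, whence the smallness condition on [M]; the value
    [4 * e * expR t] saturates the condition on [d]. *)
Lemma tst_macro (j : R) (xi : forall N : nat, config N) (u0 : R -> R) (u : R -> R -> R)
    (t t0 sg e k k' C BH : R) (H dH : R -> R) M r :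
  0 < j -> 0 < t -> 0 < t0 -> `|sg| = 1 -> (0 < M)%N -> 0 <= r <= 1 ->
  profile u0 ->
  (forall zeta, 0 < zeta -> \forall N \near \oo, close N u0 zeta (xi N)) ->
  (forall s, 0 < s <= t -> profile (u s)) ->
  (forall s zeta, 0 < s <= t -> 0 < zeta ->
    (fun N : nat => trans_prob j (xi N) (N%:R ^+ 2 * s) (close N (u s) zeta)) @ \oo --> (1 : R)) ->
  (forall s, 0 <= s <= t -> is_derive s 1 H (dH s)) ->
  (forall s, 0 <= s <= t -> `|H s| <= BH) ->
  0 <= C -> 0 < e -> peak t0 / M%:R + 11 * peak t0 / t0 / M%:R <= e ->
  (forall s, 0 <= s <= t -> j * (sg * tst M r (s + t0) 0) - dH s <= e + C) ->
  (forall s z, 0 <= s <= t -> 0 <= z <= 1 ->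
     j * (sg * tst M r (s + t0) 0 - sg * tst M r (s + t0) z) - dH s <= e + C) ->
  (forall s z, 0 <= s <= t -> k <= z <= 1 ->
     j * (sg * tst M r (s + t0) 0 - sg * tst M r (s + t0) z) - dH s <= e) ->
  0 <= k -> k < k' -> k' <= 1 ->
  (C = 0 \/ forall s, 0 < s <= t -> 0 < Fmac k' (u s)) ->
  sg * Rintegral mu `[0, 1] (fun z => tst M r t0 z * u t z) + H 0 <=
  sg * Rintegral mu `[0, 1] (fun z => tst M r (t + t0) z * u0 z) + H t
    + 4 * e * expR t * (1 + Fmac 0 u0 ^+ 2).
Proof.
move=> j0 tp t0p sg1 M0 r01 pu0 cl0 pu trc Hd HB C0 e0 eM bndE bndC bndk k0 kk' k'1 Cor.
have sp s : 0 <= s <= t -> 0 < s + t0 by move=> /andP[s0 _]; rewrite ltr_wpDl.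
have sb s : 0 <= s <= t -> t0 <= s + t0 <= t + t0.
  by move=> /andP[? ?]; apply/andP; split; lra.
have [B B0 hB] := bounded_tst t0 (t + t0) t0p M r.
have [L L0 hL] := bounded_tst1 t0 (t + t0) t0p M r.
have [W W0 hW] := bounded_tst2 t0 (t + t0) t0p M r.
have [C2 C20 hC2] := bounded_img3 t0 (t + t0) t0p M r.
have sgn x : `|sg * x| = `|x| by rewrite normrM sg1 mul1r.
have sh s : is_derive s 1 (fun s => s + t0) 1 := drv_shift t0 s.
have BH0 : 0 <= BH by apply: le_trans (HB 0 _); rewrite // lexx ltW.
have := @macro_bound R j j0 xi u0 u t k k' e (4 * e * expR t) (B + BH) L C2 W C
  (fun s z => sg * tst M r (s + t0) z) (fun s z => sg * dtst M r (s + t0) z)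
  (fun s z => sg * tst1 M r (s + t0) z) (fun s z => sg * tst2 M r (s + t0) z) H dH tp pu0 cl0 pu trc.
have -> : Rintegral mu `[0, 1] (fun z => sg * tst M r (0 + t0) z * u t z) =
   sg * Rintegral mu `[0, 1] (fun z => tst M r t0 z * u t z).
  rewrite -RintegralZl //; last by apply: tst_mul_integrable => //; apply: (pu t _).1; rewrite tp lexx.
  by apply: eq_Rintegral => z _; rewrite add0r mulrA.
have -> : Rintegral mu `[0, 1] (fun z => sg * tst M r (t + t0) z * u0 z) =
   sg * Rintegral mu `[0, 1] (fun z => tst M r (t + t0) z * u0 z).
  rewrite -RintegralZl //; last by apply: tst_mul_integrable; [rewrite addr_gt0|exact: pu0.1].
  by apply: eq_Rintegral => z _; rewrite mulrA.
move=> F; refine (F _ _ _ _ _ _ _ _ _ _ Hd _ C0 bndE bndC bndk k0 kk' k'1 Cor e0 _ _); clear F.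
- move=> s z s01 z01; apply: drv_scale.
  by apply: (is_derive_eq (drv_comp _ _ _ _ _ (sh s) (tst_ds M r (s + t0) z (sp s s01)))); rewrite mulr1.
- by move=> s z s01 z01; apply: drv_scale; apply: tst_dz; exact: sp.
- by move=> s z s01 z01; apply: drv_scale; apply: tst1_dz; exact: sp.
- by move=> s s01; rewrite tst1_at0 mulr0.
- by move=> s s01; rewrite tst1_at1 mulr0.
- by move=> s z s01 z01; rewrite sgn; apply: le_trans (hB _ _ (sb s s01) z01) _; rewrite lerDl.
- by move=> s z s01 z01; rewrite sgn; apply: (hL _ _ (sb s s01) z01).
- by move=> s z s01 z01; rewrite sgn; apply: (hW _ _ (sb s s01) z01).
- move=> s s01 x y x01 y01; rewrite -mulrBr sgn.
  refine (lipschitz_of_derive (tst2 M r (s + t0)) (img3 M r (s + t0)) C2 x y x01 y01 _ _) => z z01.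
    by apply: tst2_dz; exact: sp.
  exact: (hC2 _ _ (sb s s01) z01).
- move=> s z s01 z01; have /andP[ts _] := sb s s01.
  have h1 := kap_small t0 M r (s + t0) t0p ts M0 r01.
  have h2 := dkap_small t0 M r (s + t0) t0p ts M0 r01.
  have z2 : 0 <= z ^+ 2 / 2 by rewrite divr_ge0 ?sqr_ge0.
  have z21 : z ^+ 2 / 2 <= 1.
    rewrite ler_pdivrMr // mul1r; apply: (@le_trans _ _ 1); last by rewrite ler1n.
    by move: z01 => /andP[? ?]; rewrite expr_le1.
  apply: le_trans eM; apply: le_trans (ler_norm _) _.
  rewrite (_ : _ - _ = sg * (dkap M r (s + t0) * (z ^+ 2 / 2) - kap M r (s + t0) / 2)); last first.
    by rewrite /tst2 /dtst; field.
  rewrite sgn; apply: le_trans (ler_normB _ _) _; rewrite addrC; apply: lerD.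
    rewrite normrM (ger0_norm (_ : 0 <= 2^-1)) // ler_pdivrMr // mulrC.
    exact: h1.
  rewrite normrM (ger0_norm z2) -[leRHS]mulr1; exact: ler_pM.
- by move=> s s01; apply: le_trans (HB s s01) _; rewrite lerDr.
- by rewrite mulr_gt0 ?expR_gt0 // mulr_gt0.
- by rewrite -mulrA -expRD subrr expR0 mulr1.
Qed.

End Evolution.

Lemma midpoint_bounds {R : realType} (x : R) : x < 1 -> x < (x + 1) / 2 /\ (x + 1) / 2 < 1.
Proof. by move=> x1; split; lra. Qed.

(** * The regularised evolution identity and the lower bound at the right end *)

Section Identities.
Context {R : realType} (j : R) (j0 : 0 < j) (xi : forall N : nat, config N)
  (u0 : R -> R) (u : R -> R -> R) (pu0 : profile u0).
Local Notation mu := (@lebesgue_measure R).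
Implicit Types (r s t z y x e : R).
Context (cl0 : forall zeta : R, 0 < zeta -> \forall N \near \oo, close N u0 zeta (xi N))
  (pu : forall s : R, 0 < s -> profile (u s))
  (trc : forall s zeta : R, 0 < s -> 0 < zeta ->
    (fun N : nat => trans_prob j (xi N) (N%:R ^+ 2 * s) (close N (u s) zeta)) @ \oo --> (1 : R)).

Lemma eventually_small (t0 e : R) : 0 < t0 -> 0 < e ->
  \forall M \near \oo, peak t0 / M%:R + 11 * peak t0 / t0 / M%:R <= e.
Proof.
move=> tp e0; have h := near_inv (peak t0 + 11 * peak t0 / t0) e e0.
by apply: filterS h => M; rewrite mulrDl.
Qed.

(** [H] integrates the flux that removals located exactly at 1 would produce; positivity of all
    tails confines the actual removals to a neighbourhood of 1. *)
Lemma evolution_inequality (sg t t0 e : R) r : `|sg| = 1 -> 0 < t -> 0 < t0 -> 0 < e -> 0 <= r <= 1 ->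
  (forall s k, 0 < s <= t -> 0 <= k < 1 -> 0 < Fmac k (u s)) ->
  sg * Rintegral mu `[0, 1] (fun z => Gneum t0 r z * u t z) <=
  sg * Rintegral mu `[0, 1] (fun z => Gneum (t + t0) r z * u0 z) +
  sg * j * Rintegral mu `[0, t] (fun s => boundary_gap r (s + t0)) +
  4 * e * expR t * (1 + Fmac 0 u0 ^+ 2).
Proof.
move=> sg1 tp t0p e0 r01 occ.
have t1 : 0 <= t := ltW tp.
have z0 : 0 <= (0 : R) <= 1 by rewrite lexx ler01.
have z1 : 0 <= (1 : R) <= 1 by rewrite lexx ler01.
have tt0 : 0 < t + t0 by rewrite addr_gt0.
have limL : (fun M => sg * Rintegral mu `[0, 1] (fun z => tst M r t0 z * u t z)) @ \oo -->
   sg * Rintegral mu `[0, 1] (fun z => Gneum t0 r z * u t z).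
  by apply: cvgM; [exact: cvg_cst|apply: tst_mul_cvg => //; exact: pu].
have limR : (fun M => sg * Rintegral mu `[0, 1] (fun z => tst M r (t + t0) z * u0 z) +
    sg * j * Rintegral mu `[0, t] (fun s => tst_gap M r (s + t0)) +
    4 * e * expR t * (1 + Fmac 0 u0 ^+ 2)) @ \oo -->
  sg * Rintegral mu `[0, 1] (fun z => Gneum (t + t0) r z * u0 z) +
  sg * j * Rintegral mu `[0, t] (fun s => boundary_gap r (s + t0)) +
  4 * e * expR t * (1 + Fmac 0 u0 ^+ 2).
  apply: cvgD; last exact: cvg_cst.
  apply: cvgD; first by apply: cvgM; [exact: cvg_cst|exact: tst_mul_cvg].
  by apply: cvgM; [exact: cvg_cst|exact: gap_shift_cvg].
apply: (ler_cvg_to limL limR).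
have n1 := eventually_small t0 e t0p e0.
near=> M.
have M0 : (0 < M)%N by near: M; exists 1%N.
have eM : peak t0 / M%:R + 11 * peak t0 / t0 / M%:R <= e by near: M; exact: n1.
have sh s : is_derive s 1 (fun s => s + t0) 1 := drv_shift t0 s.
have shc s : {for s, continuous (fun s => s + t0)} := is_derive_continuous _ _ _ (sh s).
have sp s : 0 <= s -> 0 < s + t0 by move=> s0; rewrite ltr_wpDl.
have gc s : 0 <= s -> {for s, continuous (fun s => tst_gap M r (s + t0))}.
  move=> s0; apply: continuousB.
    exact: (continuous_comp (shc s) (tst_continuous_s M r (s + t0) 0 (sp _ s0))).
  exact: (continuous_comp (shc s) (tst_continuous_s M r (s + t0) 1 (sp _ s0))).
have [G [G0 Gd]] := primitive_exists _ gc.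
have GE : Rintegral mu `[0, t] (fun s => tst_gap M r (s + t0)) = G t.
  transitivity (G t - G 0); last by rewrite G0 subr0.
  by refine (FTC2_Rintegral _ G 0 t t1 _ _) => s /andP[s0 _]; [exact: Gd|exact: gc].
have sb s : 0 <= s <= t -> t0 <= s + t0 <= t + t0.
  by move=> /andP[? ?]; apply/andP; split; lra.
have [B B0 hB] := bounded_tst t0 (t + t0) t0p M r.
have [L L0 hL] := bounded_tst1 t0 (t + t0) t0p M r.
have gB s : 0 <= s <= t -> `|tst_gap M r (s + t0)| <= 2 * B.
  move=> s01; apply: le_trans (ler_normB _ _) _.
  have a0 := hB _ _ (sb s s01) z0; have a1 := hB _ _ (sb s s01) z1.
  by apply: le_trans (lerD a0 a1) _; rewrite -mulr2n mulr_natl.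
have GB s : 0 <= s <= t -> `|G s| <= 2 * B * t.
  move=> /andP[s0 st].
  have [c /andP[c0 cs] E] := mean_value G _ 0 s s0 (fun x h => Gd x (elimT andP h).1).
  have -> : G s = G s - G 0 by rewrite G0 subr0.
  rewrite E subr0 normrM (ger0_norm s0) ler_pM //.
  by apply: gB; rewrite c0 (le_trans cs).
have sgj x : j * (sg * x) <= j * `|x|.
  by rewrite ler_pM2l //; apply: le_trans (ler_norm _) _; rewrite normrM sg1 mul1r.
(* Ensures j L (1 - z) <= e for z >= k, so moving the removal from z to 1 costs at most [e]. *)
pose k := Num.max 0 (1 - e / (j * L + 1)).
have jL : 0 < j * L + 1 by rewrite ltr_wpDl // mulr_ge0 // ltW.
have k0 : 0 <= k by rewrite le_max lexx.
have k1 : k < 1 by rewrite gt_max ltr01 /= ltrBlDr ltrDl divr_gt0.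
have [kk' k'1] := midpoint_bounds k k1.
set k' := (k + 1) / 2 in kk' k'1.
rewrite GE.
have := @tst_macro R j xi u0 u t t0 sg e k k' (2 * j * B) (j * (2 * B * t))
  (fun s => sg * j * G s) (fun s => sg * j * tst_gap M r (s + t0)) M r
  j0 tp t0p sg1 M0 r01 pu0 cl0 (fun s h => pu s (elimT andP h).1) (fun s ze h => trc s ze (elimT andP h).1).
rewrite G0 mulr0 addr0 => F.
refine (F _ _ _ e0 eM _ _ _ k0 kk' (ltW k'1) _); clear F.
- by move=> s /andP[s0 _]; apply: drv_scale; exact: Gd.
- move=> s s01; rewrite normrM normrM sg1 mul1r (gtr0_norm j0) ler_pM2l //; exact: GB.
- by rewrite !mulr_ge0 // ltW.
- move=> s s01; rewrite (_ : _ - _ = j * (sg * tst M r (s + t0) 1)); last by rewrite /tst_gap; ring.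
  apply: le_trans (sgj _) _; rewrite -(mulrA 2) mulrCA.
  have := hB _ _ (sb s s01) z1; rewrite -(ler_pM2l j0) => h.
  apply: le_trans h _; have : 0 <= j * B by rewrite mulr_ge0 // ltW.
  by rewrite mulrCA; lra.
- move=> s z s01 z01; rewrite (_ : _ - _ = j * (sg * (tst M r (s + t0) 1 - tst M r (s + t0) z))); last by rewrite /tst_gap; ring.
  apply: le_trans (sgj _) _.
  have a1 := hB _ _ (sb s s01) z1; have az := hB _ _ (sb s s01) z01.
  have : j * `|tst M r (s + t0) 1 - tst M r (s + t0) z| <= j * (B + B).
    by rewrite ler_pM2l //; exact: le_trans (ler_normB _ _) (lerD a1 az).
  by lra.
- move=> s z s01 /andP[kz zle]; rewrite (_ : _ - _ = j * (sg * (tst M r (s + t0) 1 - tst M r (s + t0) z))); last by rewrite /tst_gap; ring.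
  apply: le_trans (sgj _) _.
  have z01 : 0 <= z <= 1 by rewrite zle andbT (le_trans k0).
  have s0 : 0 < s + t0 by apply: sp; case/andP: s01.
  have hl := lipschitz_of_derive (tst M r (s + t0)) (tst1 M r (s + t0)) L 1 z z1 z01
    (fun z _ => tst_dz M r (s + t0) z s0) (fun z h => hL _ _ (sb s s01) h).
  have : j * `|tst M r (s + t0) 1 - tst M r (s + t0) z| <= j * (L * `|1 - z|) by rewrite ler_pM2l.
  move=> /le_trans; apply.
  rewrite ger0_norm ?subr_ge0 //.
  have kz' : 1 - z <= e / (j * L + 1).
    have hk : 1 - e / (j * L + 1) <= k by rewrite /k le_max lexx orbT.
    by rewrite lerBlDl -lerBlDr; apply: le_trans hk kz.
  rewrite mulrA; apply: (@le_trans _ _ ((j * L + 1) * (e / (j * L + 1)))).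
    apply: ler_pM; [by rewrite mulr_ge0 // ltW|by rewrite subr_ge0|by rewrite lerDl|exact: kz'].
  by rewrite mulrC divfK // gt_eqF.
- by right=> s s01; apply: occ => //; rewrite k'1 andbT (le_trans k0 (ltW kk')).
Unshelve. all: by end_near. Qed.

Lemma evolution_identity (t t0 : R) r : 0 < t -> 0 < t0 -> 0 <= r <= 1 ->
  (forall s k, 0 < s <= t -> 0 <= k < 1 -> 0 < Fmac k (u s)) ->
  Rintegral mu `[0, 1] (fun z => Gneum t0 r z * u t z) =
  Rintegral mu `[0, 1] (fun z => Gneum (t + t0) r z * u0 z) +
  j * Rintegral mu `[0, t] (fun s => boundary_gap r (s + t0)).
Proof.
move=> tp t0p r01 occ.
pose c := 4 * expR t * (1 + Fmac 0 u0 ^+ 2).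
have c0 : 0 < c by rewrite !mulr_gt0 ?expR_gt0 // ltr_pwDl ?sqr_ge0.
have small (x y : R) : (forall e, 0 < e -> x <= y + e * c) -> x <= y.
  move=> h; apply/ler_addgt0Pr => e e0; have := h (e / c) (divr_gt0 e0 c0).
  by rewrite divfK // gt_eqF.
apply/eqP; rewrite eq_le; apply/andP; split; apply: small => e e0.
  have := evolution_inequality 1 t t0 e r (normr1 _) tp t0p e0 r01 occ.
  rewrite !mul1r /c; move=> /le_trans; apply.
  by rewrite le_eqVlt; apply/orP; left; apply/eqP; ring.
have := evolution_inequality (-1) t t0 e r (normrN1 _) tp t0p e0 r01 occ.
by rewrite /c !mulN1r mulNr; lra.
Qed.

(** The sign is -1 and nothing is assumed on the rightmost particle: positivity of the kernel at 0
    leaves j b(R), and b is at most 14 times [peak] up to a small error, with 14 = 6 + 8 for times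
    at most 1. [H] is a primitive of this bound; integrating s^(-1/2) turns 14 into 28. *)
Lemma density_lower_bound (t t0 : R) : 0 < t -> 0 < t0 -> t + t0 <= 1 ->
  Rintegral mu `[0, 1] (fun z => Gneum (t + t0) 1 z * u0 z) -
    28 * j / Num.sqrt (2 * pi) * (Num.sqrt (t + t0) - Num.sqrt t0) <=
  Rintegral mu `[0, 1] (fun z => Gneum t0 1 z * u t z).
Proof.
move=> tp t0p tt1.
have t1 : 0 <= t := ltW tp.
have z0 : 0 <= (0 : R) <= 1 by rewrite lexx ler01.
have z1 : 0 <= (1 : R) <= 1 by rewrite lexx ler01.
have tt0 : 0 < t + t0 by rewrite addr_gt0.
pose q := 28 * j / Num.sqrt (2 * pi).
pose c := 4 * expR t * (1 + Fmac 0 u0 ^+ 2).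
have c0 : 0 < c by rewrite !mulr_gt0 ?expR_gt0 // ltr_pwDl ?sqr_ge0.
suff main e : 0 < e -> - Rintegral mu `[0, 1] (fun z => Gneum t0 1 z * u t z) + q * Num.sqrt t0 <=
    - Rintegral mu `[0, 1] (fun z => Gneum (t + t0) 1 z * u0 z) + q * Num.sqrt (t + t0) + e * c.
  rewrite -/q; apply/ler_addgt0Pr => e e0; have := main (e / c) (divr_gt0 e0 c0).
  rewrite divfK ?gt_eqF //.
  have arith (A B x y d : R) : - B + y <= - A + x + d -> A - (x - y) <= B + d by lra.
  by rewrite mulrBr; exact: arith.
move=> e0.
have limL : (fun M => - Rintegral mu `[0, 1] (fun z => tst M 1 t0 z * u t z) + q * Num.sqrt t0) @ \oo -->
   - Rintegral mu `[0, 1] (fun z => Gneum t0 1 z * u t z) + q * Num.sqrt t0.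
  apply: cvgD; last exact: cvg_cst.
  by apply: cvgN; apply: tst_mul_cvg => //; exact: pu.
have limR : (fun M => - Rintegral mu `[0, 1] (fun z => tst M 1 (t + t0) z * u0 z) + q * Num.sqrt (t + t0) + e * c) @ \oo -->
   - Rintegral mu `[0, 1] (fun z => Gneum (t + t0) 1 z * u0 z) + q * Num.sqrt (t + t0) + e * c.
  apply: cvgD; last exact: cvg_cst.
  by apply: cvgD; [apply: cvgN; exact: tst_mul_cvg|exact: cvg_cst].
apply: (ler_cvg_to limL limR).
have n1 := eventually_small t0 e t0p e0.
have n2 := near_inv (j * peak t0) e e0.
near=> M.
have M0 : (0 < M)%N by near: M; exists 1%N.
have eM : peak t0 / M%:R + 11 * peak t0 / t0 / M%:R <= e by near: M; exact: n1.
have eM2 : j * peak t0 / M%:R <= e by near: M; exact: n2.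
have sp s : 0 <= s -> 0 < s + t0 by move=> s0; rewrite ltr_wpDl.
have qp : 0 <= q.
  by rewrite /q divr_ge0 ?sqrtr_ge0 // mulr_ge0 // ltW.
(* The quadratic correction vanishes at 0, so the sign of the image sum is kept there. *)
have img0 s : 0 <= tst M 1 s 0.
  rewrite /tst expr0n /= mul0r mulr0 subr0 /img /images addr_ge0 ?image_term_ge0 //.
  by apply: sumr_ge0 => i _; rewrite addr_ge0 ?image_term_ge0.
have up s z : 0 <= s <= t -> 0 <= z <= 1 -> j * tst M 1 (s + t0) z <= 14 * j * peak (s + t0) + e.
  move=> /andP[s0 st] z01.
  have ts : t0 <= s + t0 by rewrite lerDr.
  have h1 := tst_img_dist t0 M 1 (s + t0) z t0p ts M0 z1 z01.
  have /andP[h2 _] := Gneum_sandwich M 1 (s + t0) z M0 (sp _ s0) z1 z01.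
  have h3 := Gneum_le_peak 1 (s + t0) z (sp _ s0) z1 z01.
  have p0 := peak_gt0 _ (sp _ s0).
  have h4 : (6 + 8 * (s + t0)) * peak (s + t0) <= 14 * peak (s + t0).
    by rewrite ler_pM2r //; lra.
  have h5 : tst M 1 (s + t0) z <= 14 * peak (s + t0) + peak t0 / M%:R.
    by have := ler_norm (tst M 1 (s + t0) z - img M 1 (s + t0) z); lra.
  have h6 : j * tst M 1 (s + t0) z <= j * (14 * peak (s + t0) + peak t0 / M%:R) by rewrite ler_pM2l.
  apply: le_trans h6 _.
  rewrite (_ : j * (14 * peak (s + t0) + peak t0 / M%:R) = 14 * j * peak (s + t0) + j * peak t0 / M%:R); last by ring.
  by rewrite lerD2l.
have := @tst_macro R j xi u0 u t t0 (-1) e 0 2^-1 0 (q * Num.sqrt (t + t0))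
  (fun s => q * Num.sqrt (s + t0)) (fun s => 14 * j * peak (s + t0)) M 1
  j0 tp t0p (normrN1 _) M0 z1 pu0 cl0 (fun s h => pu s (elimT andP h).1) (fun s ze h => trc s ze (elimT andP h).1).
rewrite add0r !mulN1r /c mulrA mulrA (mulrC e) => F.
(* The defect constant is 0 and the sharp bound holds on all of [0, 1], so [k] is 0 and the value
   1/2 of [k'] is arbitrary. *)
refine (F _ _ (lexx 0) e0 eM _ _ _ (lexx 0) _ _ (or_introl erefl)); clear F.
- move=> s /andP[s0 st].
  have sh := drv_shift t0 s.
  apply: (is_derive_eq (drv_scale q _ _ _ (drv_comp _ _ _ _ _ sh (is_derive1_sqrt (sp _ s0))))).
  rewrite mulr1 /peak sqrtrM ?mulr_ge0 ?pi_ge0 // /q; field.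
  by rewrite !gt_eqF // sqrtr_gt0 ?sp // mulr_gt0 // pi_gt0.
- move=> s /andP[s0 st]; rewrite ger0_norm; last exact: mulr_ge0 qp (sqrtr_ge0 _).
  by apply: (ler_wpM2l qp); apply: ler_wsqrtr; rewrite lerD2r.
- move=> s /andP[s0 st]; rewrite mulN1r addr0.
  have h1 : 0 <= j * tst M 1 (s + t0) 0 by rewrite mulr_ge0 // ltW.
  have h2 : 0 <= 14 * j * peak (s + t0) by rewrite !mulr_ge0 ?(ltW j0) // ltW // peak_gt0 // sp.
  by rewrite mulrN; lra.
- move=> s z s01 z01; have h := up s z s01 z01.
  have h1 : 0 <= j * tst M 1 (s + t0) 0 by rewrite mulr_ge0 // ltW.
  by rewrite !mulN1r addr0 opprK mulrDr mulrN; lra.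
- move=> s z s01 z01; have h := up s z s01 z01.
  have h1 : 0 <= j * tst M 1 (s + t0) 0 by rewrite mulr_ge0 // ltW.
  by rewrite !mulN1r opprK mulrDr mulrN; lra.
- by rewrite invr_gt0.
- by rewrite invf_le1 // ler1n.
Unshelve. all: by end_near. Qed.

(** On the layer of width sqrt s next to 1 the kernel is at least exp(-1/2) [peak s], and the layer
    carries mass at least alpha sqrt s. The powers of s cancel, so the bound is uniform as s tends
    to 0. *)
Lemma heat_lower_bound (alpha s : R) : 0 < s -> s <= 1 ->
  (forall x, 0 <= x <= 1 -> alpha * (1 - x) <= Fmac x u0) ->
  alpha * expR (- 2^-1) / Num.sqrt (2 * pi) <= Rintegral mu `[0, 1] (fun z => Gneum s 1 z * u0 z).
Proof.
move=> s0 s1 hF.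
have z1 : 0 <= (1 : R) <= 1 by rewrite lexx ler01.
have q0 : 0 < Num.sqrt s by rewrite sqrtr_gt0.
have q1 : Num.sqrt s <= 1 by rewrite -sqrtr1 ler_sqrt.
pose a := 1 - Num.sqrt s.
have a0 : 0 <= a by rewrite subr_ge0.
have a1 : a <= 1 by rewrite /a gerBl ltW.
have gi := Gneum_mul_integrable 1 s u0 s0 z1 pu0.1.
have ui : mu.-integrable `[a, 1] (EFin \o u0) by exact: integrable_subitv pu0.1.
rewrite (Rintegral_split _ 0 a 1 a0 a1 gi).
have h0 : 0 <= Rintegral mu `[0, a] (fun z => Gneum s 1 z * u0 z).
  apply: Rintegral_ge0 => z /=; rewrite in_itv /= => /andP[za az].
  by rewrite mulr_ge0 ?Gneum_ge0 // pu0.2 // za (le_trans az).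
have p0 := peak_gt0 s s0.
have h1 : expR (- 2^-1) * peak s * Fmac a u0 <= Rintegral mu `[a, 1] (fun z => Gneum s 1 z * u0 z).
  rewrite /Fmac -RintegralZl //; apply: le_Rintegral => //.
  - exact: (integrable_bounded_mul _ (fun=> expR (- 2^-1) * peak s) _ `|expR (- 2^-1) * peak s|).
  - exact: integrable_subitv gi.
  move=> z /=; rewrite in_itv /= => /andP[az zle].
  have z01 : 0 <= z <= 1 by rewrite zle andbT (le_trans a0).
  rewrite ler_wpM2r ?pu0.2 //.
  have /andP[g _] := Gneum_sandwich 1 1 s z (ltn0Sn 0) s0 z1 z01.
  apply: le_trans g; apply: le_trans (img_nd 1 s z 0%N 1%N (leqnSn 0)).
  rewrite /img /images big_ord0 addr0 /image_term mulr0z mulr0 addr0 mul1r.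
  apply: (@le_trans _ _ (gauss s (1 - z))); last by rewrite lerDl gauss_ge0.
  rewrite /gauss -/(peak s) ler_pM2r // ler_expR.
  have : (1 - z) ^+ 2 <= s.
    rewrite -[leRHS](sqr_sqrtr (ltW s0)) lerXn2r ?nnegrE ?subr_ge0 ?(ltW q0) //.
    by move: az; rewrite /a; lra.
  by rewrite mulNr lerN2 ler_pdivrMr ?mulr_gt0 // mulrA mulVf // mul1r.
apply: (@le_trans _ _ (expR (- 2^-1) * peak s * Fmac a u0)); last by apply: le_trans h1 _; rewrite lerDr.
have hFa : alpha * Num.sqrt s <= Fmac a u0.
  by have := hF a; rewrite a0 a1 /a opprB addrC subrK; apply.
have pe : 0 <= expR (- 2^-1) * peak s by rewrite mulr_ge0 ?expR_ge0 // ltW.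
apply: le_trans (ler_wpM2l pe hFa).
rewrite le_eqVlt; apply/orP; left; apply/eqP.
have pp : 0 < 2 * pi :> R by rewrite mulr_gt0 // pi_gt0.
rewrite /peak (sqrtrM s (ltW pp)); field.
by rewrite !gt_eqF // sqrtr_gt0.
Qed.

End Identities.

(** * Removal of the regularisation time *)

Section SmallTimeLimits.
Context {R : realType}.
Local Notation mu := (@lebesgue_measure R).
Implicit Types (r s z : R).

Lemma shift_continuous (a s : R) : {for s, continuous (fun s => s + a)}.
Proof. exact: (is_derive_continuous _ _ _ (drv_shift a s)). Qed.

Lemma shift_tau_cvg s : (fun n => s + tau n) @ \oo --> s.
Proof. by rewrite -[X in _ --> X]addr0; apply: cvgD; [exact: cvg_cst|exact: tau_cvg]. Qed.

Lemma tau_anti n m : (n <= m)%N -> tau m <= tau n :> R.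
Proof. by move=> nm; rewrite lef_pV2 ?posrE // ler_nat. Qed.

Lemma drv_sqrt_peak s : 0 < s ->
  is_derive s 1 (fun s => 2 / Num.sqrt (2 * pi) * Num.sqrt s) (peak s).
Proof.
move=> s0; apply: (is_derive_eq (drv_scale _ _ _ _ (is_derive1_sqrt s0))).
have pp : 0 < 2 * pi :> R by rewrite mulr_gt0 // pi_gt0.
rewrite /peak (sqrtrM s (ltW pp)); field.
by rewrite !gt_eqF // sqrtr_gt0.
Qed.

Lemma peak_continuous s : 0 < s -> {for s, continuous (@peak R)}.
Proof.
move=> s0; have pp : 0 < 2 * pi :> R by rewrite mulr_gt0 // pi_gt0.
have h : 0 < 2 * pi * s by rewrite mulr_gt0.
have d : is_derive s 1 (fun s => 2 * pi * s) (2 * pi * 1) := drv_scale _ _ _ _ (drv_id s).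
have n0 : Num.sqrt (2 * pi * s) != 0 by rewrite gt_eqF // sqrtr_gt0.
exact: (is_derive_continuous _ _ _ (drv_inv (fun s => Num.sqrt (2 * pi * s)) _ s n0 (drv_comp _ _ _ _ _ d (is_derive1_sqrt h)))).
Qed.

Lemma peak_shift_continuous (a s : R) : 0 < s + a -> {for s, continuous (fun s => peak (s + a))}.
Proof. by move=> h; exact: (continuous_comp (shift_continuous a s) (peak_continuous _ h)). Qed.

Lemma Rintegral_peak_shift (a t : R) : 0 < a -> 0 <= t ->
  Rintegral mu `[0, t] (fun s => peak (s + a)) =
  2 / Num.sqrt (2 * pi) * Num.sqrt (t + a) - 2 / Num.sqrt (2 * pi) * Num.sqrt a.
Proof.
move=> a0 t0; have sp s : 0 <= s -> 0 < s + a by move=> s0; rewrite ltr_wpDl.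
have := FTC2_Rintegral (fun s => peak (s + a)) (fun s => 2 / Num.sqrt (2 * pi) * Num.sqrt (s + a)) 0 t t0.
rewrite add0r; apply.
  move=> s /andP[s0 _].
  have := drv_comp _ _ _ _ _ (drv_shift a s) (drv_sqrt_peak _ (sp _ s0)).
  by rewrite mulr1.
by move=> s /andP[s0 _]; apply: peak_shift_continuous; exact: sp.
Qed.

Lemma sub_oc_cc (t : R) : `]0, t] `<=` `[0, t].
Proof. by apply: subset_itv; rewrite bnd_simp. Qed.

(** [peak] blows up at 0 like s^(-1/2). The shifted functions increase to it with explicit bounded
    integrals, and monotone convergence concludes. *)
Lemma peak_integrable (t : R) : 0 <= t -> mu.-integrable `]0, t] (EFin \o (@peak R)).
Proof.
move=> t0.
have mt : measurable (`]0, t] : set R) by [].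
have si n : mu.-integrable `[0, t] (EFin \o (fun s => peak (s + tau n))).
  apply: continuous_integrable => s /andP[s0 _]; apply: peak_shift_continuous.
  by rewrite ltr_wpDl // tau_gt0.
have so n : mu.-integrable `]0, t] (EFin \o (fun s => peak (s + tau n))).
  by apply: (integrableS _ _ _ (si n)) => //; exact: sub_oc_cc.
have pc s : 0 < s -> (fun n => peak (s + tau n)) @ \oo --> peak s.
  by move=> s0; apply: (continuous_cvg _ (peak_continuous s s0)); exact: shift_tau_cvg.
have pe s : [set` `]0%R, t]] s -> (fun n => (peak (s + tau n))%:E) @ \oo --> (peak s)%:E.
  rewrite /= in_itv /= => /andP[s0 _].
  by apply/fine_cvgP; split; [exact: nearW|exact: pc].
have mpk : measurable_fun (`]0, t] : set R) (@peak R).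
  apply: (@measurable_fun_cvg _ _ _ _ (fun n s => peak (s + tau n))).
    by move=> n; apply/measurable_EFinP; exact: (measurable_int mu (so n)).
  by move=> s /=; rewrite in_itv /= => /andP[s0 _]; exact: pc.
have p0 n s : [set` `]0%R, t]] s -> (0 <= (peak (s + tau n))%:E)%E.
  rewrite /= in_itv /= => /andP[s0 _].
  by rewrite lee_fin ltW // peak_gt0 // addr_gt0 // tau_gt0.
have nd s : [set` `]0%R, t]] s -> nondecreasing_seq (fun n => (peak (s + tau n))%:E).
  rewrite /= in_itv /= => /andP[s0 _] n m nm.
  by rewrite lee_fin peak_anti ?lerD2l ?tau_anti // addr_gt0 // tau_gt0.
have mE n : measurable_fun (`]0, t] : set R) (fun s => (peak (s + tau n))%:E).
  exact: (measurable_int mu (so n)).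
apply/integrableP; split; first by apply/measurable_EFinP.
have -> : (\int[mu]_(s in [set` `]0%R, t]]) `|(EFin \o (@peak R)) s| =
    \int[mu]_(s in [set` `]0%R, t]]) limn (fun n => (peak (s + tau n))%:E))%E.
  apply: eq_integral => s /set_mem st; rewrite (cvg_lim _ (pe s st)) //=.
  move: st; rewrite /= in_itv /= => /andP[s0 _].
  by rewrite ger0_norm // ltW // peak_gt0.
rewrite (monotone_convergence mu mt mE p0 nd).
apply: (@le_lt_trans _ _ (2 / Num.sqrt (2 * pi) * Num.sqrt (t + 1))%:E); last by rewrite ltry.
apply: lime_le.
  apply: ereal_nondecreasing_is_cvgn => m n mn.
  apply: (ge0_le_integral mu mt (p0 m) (mE m) (mE n)).
  by move=> s st; exact: nd s st m n mn.
apply: nearW => n.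
have <- : (Rintegral mu `]0, t] (fun s => peak (s + tau n)))%:E =
  (\int[mu]_(s in `]0%R, t]) (peak (s + tau n))%:E)%E.
  by rewrite /Rintegral fineK //; exact: integrable_fin_num (so n).
rewrite lee_fin Rintegral_itv_obnd_cbnd // Rintegral_peak_shift ?tau_gt0 //.
have c0 : 0 <= 2 / Num.sqrt (2 * pi) :> R by rewrite divr_ge0 ?sqrtr_ge0.
rewrite -mulrBr ler_wpM2l //; apply: (@le_trans _ _ (Num.sqrt (t + tau n))).
  by rewrite gerBl sqrtr_ge0.
by apply: ler_wsqrtr; rewrite lerD2l tau_le1.
Qed.

Lemma boundary_gap_continuous r s : 0 < s -> 0 <= r <= 1 -> {for s, continuous (boundary_gap r)}.
Proof.
move=> s0 r01; have z0 : 0 <= (0 : R) <= 1 by rewrite lexx ler01.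
have z1 : 0 <= (1 : R) <= 1 by rewrite lexx ler01.
by apply: continuousB; exact: Gneum_continuous_s.
Qed.

(** A multiple of [peak] dominates all shifted gaps, because [peak] decreases; its integrability
    handles the singularity at s = 0. *)
Lemma gap_tau_cvg r (t : R) : 0 <= t -> 0 <= r <= 1 ->
  (fun n => Rintegral mu `[0, t] (fun s => boundary_gap r (s + tau n))) @ \oo -->
  Rintegral mu `[0, t] (boundary_gap r).
Proof.
move=> t0 r01; pose K := 2 * (6 + 8 * (t + 1)).
have si n : mu.-integrable `[0, t] (EFin \o (fun s => boundary_gap r (s + tau n))).
  apply: continuous_integrable => s /andP[s0 _].
  apply: (continuous_comp (shift_continuous _ s) (boundary_gap_continuous r _ _ r01)).
  by rewrite ltr_wpDl // tau_gt0.
have so n : mu.-integrable `]0, t] (EFin \o (fun s => boundary_gap r (s + tau n))).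
  by apply: (integrableS _ _ _ (si n)) => //; exact: sub_oc_cc.
have ig : mu.-integrable `]0, t] (EFin \o (fun s => K * peak s)).
  rewrite (_ : EFin \o _ = (fun s => (K%:E * (peak s)%:E)%E)) //.
  by apply: integrableZl => //; exact: peak_integrable.
have [] := dominated_Rintegral_cvg `]0, t] (fun n s => boundary_gap r (s + tau n)) (boundary_gap r)
  (fun s => K * peak s) _ _ _ ig _ => //.
- by move=> n; apply/measurable_EFinP; exact: (measurable_int mu (so n)).
- move=> s /=; rewrite in_itv /= => /andP[s0 _].
  by apply: (continuous_cvg _ (boundary_gap_continuous r s s0 r01)); exact: shift_tau_cvg.
- move=> n s /=; rewrite in_itv /= => /andP[s0 st].
  have sp : 0 < s + tau n by rewrite addr_gt0 // tau_gt0.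
  apply: le_trans (boundary_gap_le r _ sp r01) _; rewrite /K -mulrA ler_pM2l //.
  apply: ler_pM; [|by rewrite ltW // peak_gt0| |by rewrite peak_anti // lerDl ltW // tau_gt0].
    by rewrite addr_ge0 // mulr_ge0 // ltW.
  by rewrite lerD2l ler_pM2l // lerD // tau_le1.
move=> gi; rewrite (Rintegral_itv_obnd_cbnd gi).
rewrite (_ : (fun n => _) = (fun n => Rintegral mu `[0, t] (fun s => boundary_gap r (s + tau n)))) //.
by apply/funext => n; rewrite (Rintegral_itv_obnd_cbnd (so n)).
Qed.

Lemma heat_tau_cvg r (t : R) u : 0 < t -> 0 <= r <= 1 -> profile u ->
  (fun n => Rintegral mu `[0, 1] (fun z => Gneum (t + tau n) r z * u z)) @ \oo -->
  Rintegral mu `[0, 1] (fun z => Gneum t r z * u z).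
Proof.
move=> t0 r01 pu; pose K := (6 + 8 * (t + 1)) * peak t.
have sp n : 0 < t + tau n by rewrite addr_gt0 // tau_gt0.
have ig : mu.-integrable `[0, 1] (EFin \o (fun z => K * u z)).
  rewrite (_ : EFin \o _ = (fun s => (K%:E * (u s)%:E)%E)) //.
  by apply: integrableZl => //; exact: pu.1.
have [] := dominated_Rintegral_cvg `[0, 1] (fun n z => Gneum (t + tau n) r z * u z)
  (fun z => Gneum t r z * u z) (fun z => K * u z) _ _ _ ig _ => //.
- move=> n; apply/measurable_EFinP.
  exact: (measurable_int mu (Gneum_mul_integrable r _ u (sp n) r01 pu.1)).
- move=> z /=; rewrite in_itv /= => z01; apply: cvgM; last exact: cvg_cst.
  by apply: (continuous_cvg _ (Gneum_continuous_s r t z t0 r01 z01)); exact: shift_tau_cvg.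
- move=> n z /=; rewrite in_itv /= => z01; have uz := pu.2 z z01.
  rewrite ger0_norm ?mulr_ge0 ?Gneum_ge0 // ler_wpM2r //.
  apply: le_trans (Gneum_le_peak r _ z (sp n) r01 z01) _.
  apply: ler_pM; [|by rewrite ltW // peak_gt0| |by rewrite peak_anti // lerDl ltW // tau_gt0].
    by rewrite addr_ge0 // mulr_ge0 // ltW.
  by rewrite lerD2l ler_pM2l // lerD2l tau_le1.
Qed.

End SmallTimeLimits.

(** * From the hypotheses of the theorem to profiles and closeness *)

Section Conclusion.
Context {R : realType}.
Local Notation mu := (@lebesgue_measure R).
Implicit Types (r s t z : R).

(** Truncating the values of [f] changes it on a null subset of [0, 1] only, hence neither tail
    integrals nor heat convolutions, while the bounds become valid at every point. *)
Lemma bounded_representative (f : R -> R) (M : R) :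
  measurable_fun (`[0, 1] : set R) f ->
  {ae mu, forall r, r \in `[0, 1] -> 0 <= f r <= M} ->
  exists u : R -> R, [/\ profile u, forall z, 0 <= z <= 1 -> u z <= Num.max M 0,
    forall x, 0 <= x -> Fmac x f = Fmac x u &
    forall s r, 0 < s -> 0 <= r <= 1 ->
      heat_conv s f r = Rintegral mu `[0, 1] (fun z => Gneum s r z * u z)].
Proof.
move=> mf fM; pose m := Num.max M 0.
have m0 : 0 <= m by rewrite /m le_max lexx orbT.
pose u z := Num.max 0 (Num.min (f z) m).
have u0 z : 0 <= u z by rewrite le_max lexx.
have um z : u z <= m by rewrite ge_max m0 ge_min lexx orbT.
have mu01 : measurable_fun (`[0, 1] : set R) u.
  by apply: measurable_maxr => //; exact: measurable_minr.
have fu : {ae mu, forall z, z \in `[0, 1] -> f z = u z}.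
  apply: (@filterS _ _ (ae_filter_ringOfSetsType mu) _ _ _ fM) => z h z01; have /andP[f0 fz] := h z01.
  have fm : f z <= m by rewrite /m le_max fz.
  by rewrite /u (min_idPl fm) (max_idPr f0).
have ui : mu.-integrable `[0, 1] (EFin \o u).
  rewrite (_ : EFin \o u = EFin \o (fun z => u z * 1)); last first.
    by apply/funext => z /=; rewrite mulr1.
  apply: (integrable_bounded_mul _ u (fun=> 1) m) => //; last exact: integrable_cst_itv.
  by move=> z _; rewrite ger0_norm.
exists u; split=> //.
- move=> x x0; rewrite /Fmac /Rintegral; congr fine; apply: ae_eq_integral => //.
  + by apply/measurable_EFinP; apply: measurable_funS mf => //; apply: subset_itv; rewrite bnd_simp.
  + by apply/measurable_EFinP; apply: measurable_funS mu01 => //; apply: subset_itv; rewrite bnd_simp.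
  apply: (@filterS _ _ (ae_filter_ringOfSetsType mu) _ _ _ fu) => z h /=; rewrite in_itv /= => /andP[xz z1].
  by rewrite h // in_itv /= z1 (le_trans x0).
- move=> s r s0 r01; rewrite /heat_conv /Rintegral; congr fine; apply: ae_eq_integral => //.
  + by apply/measurable_EFinP; apply: measurable_funM => //; exact: Gneum_measurable_z.
  + by apply/measurable_EFinP; apply: measurable_funM => //; exact: Gneum_measurable_z.
  by apply: (@filterS _ _ (ae_filter_ringOfSetsType mu) _ _ _ fu) => z h /= z01; rewrite h.
Qed.

Lemma initial_close (xi : forall N : nat, config N) (f u : R -> R) (M : R) : 0 <= M ->
  profile u -> (forall z, 0 <= z <= 1 -> u z <= M) ->
  (forall x, 0 <= x -> Fmac x f = Fmac x u) ->
  (forall N : nat, (0 < N)%N ->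
     \big[Num.max/0]_(0 <= x < N - ell R N + 2)
        `|Aell R (xi N) (ell R N) x - Aell' N f (ell R N) x|
       <= ((N%:R : R)^-1) `^ (1 / 20)) ->
  forall zeta : R, 0 < zeta -> \forall N \near \oo, close N u zeta (xi N).
Proof.
move=> M0 pu uM fu win zeta zeta0.
have c0 : 0 < 3 + 2 * M by rewrite ltr_wpDr // mulr_ge0.
have h1 := inv_powR_small _ (divr_gt0 zeta0 c0).
near=> N.
have N0 : (0 < N)%N by near: N; exists 1%N.
have h : (N%:R^-1 : R) `^ (1 / 20) <= zeta / (3 + 2 * M) by near: N; exact: h1.
have C := close_of_windows N (xi N) u M ((N%:R^-1) `^ (1 / 20)) (ell R N) N0 (ell_gt0 N N0)
  (ell_leN N N0) (powR_ge0 _ _) (ell_le N N0) pu uM.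
have {}C : close N u ((3 + 2 * M) * (N%:R^-1) `^ (1 / 20)) (xi N).
  apply: C => x xl.
  (* The range of the maximum is exactly the set of windows with [x + ell R N <= N.+1]. *)
  have xr : x \in index_iota 0 (N - ell R N + 2).
    by rewrite mem_index_iota /=; have := ell_leN N N0 (R := R); lia.
  apply: le_trans (win N N0).
  have -> : Aell' N u (ell R N) x = Aell' N f (ell R N) x by rewrite /Aell' !fu // divr_ge0.
  exact: (le_bigmax_seq 0 x xpredT (fun y => `|Aell R (xi N) (ell R N) y - Aell' N f (ell R N) y|) xr isT).
move=> k kN; apply: le_trans (C k kN) _.
by rewrite mulrC -ler_pdivlMr.
Unshelve. all: by end_near. Qed.

Lemma close_bigmax N (u : R -> R) (zeta : R) : 0 <= zeta ->
  [set eta : config N | \big[Num.max/0]_(x : 'I_N.+1)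
     `|(N%:R : R)^-1 * (Feps eta x)%:R - Fmac ((x : nat)%:R / N%:R) u| <= zeta] = close N u zeta.
Proof.
move=> z0; apply/seteqP; split=> eta /=.
  move=> /bigmax_leP[_ h] k kN.
  by have := h (Ordinal (kN : (k < N.+1)%N)) isT.
move=> h; apply/bigmax_leP; split=> // x _.
by apply: h; rewrite -ltnS.
Qed.

Lemma cont01_section (rho : R -> R -> R) t : 0 < t ->
  {within [set p : R * R | 0 <= p.1 <= 1 /\ 0 < p.2], continuous (fun p => rho p.1 p.2)} ->
  cont01 (rho^~ t).
Proof.
move=> t0 /subspace_continuousP rc r r01 e e0.
have := rc (r, t) (conj r01 t0).
move=> /cvgrPdist_lt/(_ e e0); rewrite near_withinE => -[[A B] [/= nA nB] AB].
have [d /= d0 dA] := nA.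
exists d => // z z01 zr; rewrite distrC.
apply: (AB (z, t)) => /=; last by split.
split=> /=; last exact: nbhs_singleton nB.
by apply: dA; rewrite /= distrC.
Qed.

(** Continuity keeps [u] above half of [u 1] on an interval ending at 1. *)
Lemma Fmac_gt0 (u : R -> R) x : cont01 u -> profile u -> 0 < u 1 -> 0 <= x < 1 -> 0 < Fmac x u.
Proof.
move=> uc pu u1 /andP[x0 x1].
have z1 : 0 <= (1 : R) <= 1 by rewrite lexx ler01.
have [d d0 hd] := uc 1 z1 (u 1 / 2) (divr_gt0 u1 (ltr0n R 2)).
pose y := Num.max x (1 - d / 2).
have y1 : y < 1 by rewrite gt_max x1 /= gtrBl divr_gt0.
have xy : x <= y by rewrite le_max lexx.
apply: lt_le_trans (Fmac_anti u x y pu x0 xy).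
have ui : mu.-integrable `[y, 1] (EFin \o u) by apply: integrable_subitv pu.1; rewrite ?(le_trans x0).
apply: (@lt_le_trans _ _ (Rintegral mu `[y, 1] (fun=> u 1 / 2))).
  by rewrite Rintegral_cst_itv ?ltW // mulr_gt0 ?divr_gt0 // subr_gt0.
apply: le_Rintegral => //; first exact: integrable_cst_itv.
move=> z /=; rewrite in_itv /= => /andP[yz z1'].
have z01 : 0 <= z <= 1 by rewrite z1' andbT (le_trans x0) // (le_trans xy).
have hz : 1 - d / 2 <= z by apply: le_trans yz; rewrite le_max lexx orbT.
have : `|u z - u 1| < u 1 / 2.
  by apply: hd => //; rewrite distrC ger0_norm ?subr_ge0 //; lra.
by rewrite ltr_norml => /andP[? _]; lra.
Qed.

End Conclusion.

Lemma sqrtr_subadd {R : realType} (a b : R) : 0 <= a -> 0 <= b ->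
  Num.sqrt (a + b) <= Num.sqrt a + Num.sqrt b.
Proof.
move=> a0 b0; have s0 : 0 <= Num.sqrt a + Num.sqrt b by rewrite addr_ge0 ?sqrtr_ge0.
rewrite -(ler_pXn2r (ltn0Sn 1)) ?nnegrE ?sqrtr_ge0 //.
rewrite sqr_sqrtr ?addr_ge0 // sqrrD !sqr_sqrtr // addrAC lerDl.
by rewrite mulrn_wge0 // mulr_ge0 ?sqrtr_ge0.
Qed.

Theorem mainTheorem4 (R : realType) (j : R) (rhoinit : R -> R) (alpha : R)
    (xi : forall N : nat, config N) (rho : R -> R -> R) :
  0 < j ->
  (* rho_init in L^infty([0,1], R_+) *)
  measurable_fun (`[0, 1] : set R) rhoinit ->
  (exists M : R, {ae (@lebesgue_measure R), forall r, r \in `[0, 1] -> 0 <= rhoinit r <= M}) ->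
  0 < alpha ->
  (forall r : R, 0 <= r <= 1 -> alpha * (1 - r) <= Fmac r rhoinit) ->
  (* initial configurations close to rho_init *)
  (forall N : nat, (0 < N)%N ->
     \big[Num.max/0]_(0 <= x < N - ell R N + 2)
        `|Aell R (xi N) (ell R N) x - Aell' N rhoinit (ell R N) x|
       <= ((N%:R : R)^-1) `^ (1 / 20)) ->
  (* rho is the hydrodynamic limit *)
  (forall r t, 0 <= r <= 1 -> 0 < t -> 0 <= rho r t) ->
  {within [set p : R * R | 0 <= p.1 <= 1 /\ 0 < p.2], continuous (fun p => rho p.1 p.2)} ->
  (forall r, 0 <= r <= 1 -> (fun t => Fmac r (rho^~ t)) @ 0^'+ --> Fmac r rhoinit) ->
  (forall t zeta : R, 0 < t -> 0 < zeta ->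
     (fun N : nat => trans_prob j (xi N) ((N%:R : R) ^+ 2 * t)
        [set eta : config N |
          \big[Num.max/0]_(x : 'I_N.+1)
             `|(N%:R : R)^-1 * (Feps eta x)%:R - Fmac ((x : nat)%:R / N%:R) (rho^~ t)|
           <= zeta]) @ \oo --> (1 : R)) ->
  exists T : R, 0 < T /\
    (forall t, 0 < t <= T -> 0 < rho 1 t) /\
    (forall r t, 0 <= r <= 1 -> 0 < t <= T ->
       rho r t = heat_conv t rhoinit r
                 + j * Rintegral (@lebesgue_measure R) `[0, t]
                         (fun s => Gneum s r 0 - Gneum s r 1)).
Proof.
move=> j0 mrho [M rhoM] alpha0 hF win rho0 rhoc _ hydro.
pose m := Num.max M 0.
have m0 : 0 <= m by rewrite /m le_max lexx orbT.
have [u0 [pu0 u0m FE hE]] := bounded_representative rhoinit M mrho rhoM.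
pose u := fun s => rho^~ s.
have uc s : 0 < s -> cont01 (u s) by move=> s0; exact: cont01_section.
have pu s : 0 < s -> profile (u s).
  move=> s0; split; first exact: (cont01_integrable _ (uc s s0)).
  by move=> z z01; exact: rho0.
have cl0 := initial_close xi rhoinit u0 m m0 pu0 u0m FE win.
have trc s zeta : 0 < s -> 0 < zeta ->
    (fun N : nat => trans_prob j (xi N) (N%:R ^+ 2 * s) (close N (u s) zeta)) @ \oo --> (1 : R).
  move=> s0 z0; apply: cvg_trans (hydro s zeta s0 z0).
  by apply: near_eq_cvg; apply: nearW => N; rewrite /= close_bigmax // ltW.
have hF0 x : 0 <= x <= 1 -> alpha * (1 - x) <= Fmac x u0.
  by move=> x01; rewrite -FE; [exact: hF|case/andP: x01].
have z1 : 0 <= (1 : R) <= 1 by rewrite lexx ler01.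
pose E := expR (- 2^-1) : R.
have E0 : 0 < E by exact: expR_gt0.
(* Makes the loss [28 * j / q * w] equal to half of the bound from [heat_lower_bound]. *)
pose w := alpha * E / (56 * j).
have w0 : 0 < w by rewrite /w divr_gt0 ?mulr_gt0.
pose q := Num.sqrt (2 * pi) : R.
have q0 : 0 < q by rewrite sqrtr_gt0 mulr_gt0 // pi_gt0.
(* The first entry keeps t + tau at most 1, as [density_lower_bound] requires; the second gives sqrt
   t <= w. *)
pose T := Num.min 2^-1 (w ^+ 2).
have T0 : 0 < T by rewrite lt_min invr_gt0 ltr0n exprn_gt0.
have T2 t : t <= T -> t <= 2^-1 by move=> h; apply: le_trans h _; rewrite ge_min lexx.
have Tw t : t <= T -> Num.sqrt t <= w.
  move=> h; rewrite -[leRHS](ger0_norm (ltW w0)) -sqrtr_sqr.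
  by apply: ler_wsqrtr; apply: le_trans h _; rewrite ge_min lexx orbT.
have pos t : 0 < t <= T -> 0 < u t 1.
  move=> /andP[t0 tT].
  apply: (@lt_le_trans _ _ (alpha * E / q / 2)); first by rewrite !divr_gt0 ?mulr_gt0.
  (* The lower bound does not depend on the regularisation time, so it passes to the limit, which is
     the density at 1. *)
  have lim := approximate_identity (u t) 1 (uc t t0) z1.
  apply: (cvgr_to_ge lim); near=> n.
  have n1 : (1 <= n)%N by near: n; exists 1%N.
  have tn : tau n <= 2^-1 :> R by rewrite lef_pV2 ?posrE // ler_nat.
  have tp : 0 < tau n :> R := tau_gt0 n.
  have tt : t + tau n <= 1 by have := T2 t tT; lra.
  have := density_lower_bound j j0 xi u0 u pu0 cl0 pu trc t (tau n) t0 tp tt.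
  apply: le_trans.
  have h1 := heat_lower_bound u0 pu0 alpha (t + tau n) (addr_gt0 t0 tp) tt hF0.
  have h2 := sqrtr_subadd t (tau n) (ltW t0) (ltW tp).
  have c0 : 0 <= 28 * j / q by rewrite divr_ge0 ?mulr_ge0 ?(ltW j0) ?(ltW q0).
  have h3 : 28 * j / q * (Num.sqrt (t + tau n) - Num.sqrt (tau n)) <= 28 * j / q * w.
    rewrite ler_wpM2l // lerBlDr; apply: le_trans h2 _; rewrite lerD2r; exact: Tw.
  have h4 : 28 * j / q * w = alpha * E / q / 2.
    by rewrite /w; field; rewrite !gt_eqF.
  have -> : alpha * E / q / 2 = alpha * E / q - 28 * j / q * w by rewrite h4; field; rewrite gt_eqF.
  exact: lerB.
exists T; split=> //; split; first exact: pos.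
move=> r t r01 /andP[t0 tT].
(* The identity at time t needs mass near 1 at all earlier times as well, hence positivity on the
   whole interval up to [T]. *)
have occ s k : 0 < s <= t -> 0 <= k < 1 -> 0 < Fmac k (u s).
  move=> /andP[s0 st] k01; apply: Fmac_gt0 => //; [exact: uc|exact: pu|].
  by apply: pos; rewrite s0 (le_trans st).
have l1 := approximate_identity (u t) r (uc t t0) r01.
have l2 := cvgD (heat_tau_cvg r t u0 t0 r01 pu0) (cvgM (cvg_cst j) (gap_tau_cvg r t (ltW t0) r01)).
rewrite hE //.
(* One sequence has two limits: [rho r t] by the approximate identity, and the claimed expression by
   the evolution identity. *)
refine (cvg_unique (@norm_hausdorff R R) l1 _).
rewrite (_ : (fun n => _) = (fun n => Rintegral lebesgue_measure `[0, 1] (fun z => Gneum (t + tau n) r z * u0 z) +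
  j * Rintegral lebesgue_measure `[0, t] (fun s => boundary_gap r (s + tau n)))); first exact: l2.
by apply/funext => n; exact: (evolution_identity j j0 xi u0 u pu0 cl0 pu trc t (tau n) r t0 (tau_gt0 n) r01 occ).
Unshelve. all: by end_near. Qed.
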